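(* Assume that the initial-boundary value problem $$\frac{\partial^2u}{\partial t^2}-\left(\alpha(t)+\beta(t)\iint_\Omega|\nabla u|^2\,dx\,dy\right)\Delta u=f,\qquad u(0)=u_0,\quad \partial_tu(0)=v_0,\quad u(t)|_{\partial\Omega}=0\ \ (t\in[0,T]),$$ is well posed, with exact solution $u$, and suppose that: (i) $u_0\in D(\mathcal L_0)$; $v_0,w_0\in C^1(\overline\Omega)$; $u_x$ and $u_y$ have continuous second temporal derivatives; for every $t\in[0,T]$, $f(t)\in C^1(\overline\Omega)$ with $f(t)|_{\partial\Omega}=0$, the spatial derivatives of $f(t)$ being bounded uniformly in $t$; and moreover $u_0\in D(\mathcal L^2)$, $v_0\in D(\mathcal L)$, $f\in C([0,T];D(\mathcal L^{1/2}))$ with $f(0)\in D(\mathcal L)$. (ii) $u(t)$ is three times continuously differentiable with respect to $t$, and $u_{ttt}(t)$ is Lipschitz continuous in $t$ as a map into $L^2(\Omega)$. (iii) $u_{xx}(t)$ and $u_{yy}(t)$ are continuously differentiable with respect to $t$, and $u_{xxt}(t)$ and $u_{yyt}(t)$ are Lipschitz continuous in $t$ as maps into $L^2(\Omega)$. Then the error $z_k=u(t_k)-u_k$ of the solution sequences $\{u_k\}_{k=0}^n$ of the nonlinear scheme is second order in $\tau$ on a local interval: there exists $\overline T\in(0,T]$ such that $$\max_{1\le k\le m}\|z_k\|=O(\tau^2),\qquad m=\left[\frac{\overline T}{\tau}\right],$$ i.e. the left-hand side is at most $C\tau^2$ with $C$ independent of $\tau=T/n$, where $[\cdot]$ denotes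 the integer part.
   Context: $\Omega\subset\mathbb R^2$ is a bounded convex domain; $\|\cdot\|$ is the norm of $L^2(\Omega)$. Functions $u$ and $f$ are regarded as functions of $t$ with values in a space of functions on $\Omega$; subscripts $x,y,t$ on $u$ denote partial derivatives. $\mathcal L_0=-\Delta$ with $D(\mathcal L_0)=\{u\in C^2(\overline\Omega):u|_{\partial\Omega}=0\}$; $\mathcal L$ is its Friedrichs extension, i.e. the unique self-adjoint positive definite operator in $L^2(\Omega)$ associated with the form $a(u,v)=(\nabla u,\nabla v)$ on $H^1_0(\Omega)$; $D(\mathcal L^{1/2})=H_0^1(\Omega)$, $\|\mathcal L^{1/2}u\|=\|\nabla u\|$, and powers $\mathcal L^a$, $a>0$, with their domains are defined by the spectral calculus. $T>0$; $\alpha,\beta\in C^1([0,T])$ are real-valued with $\min_{[0,T]}\alpha>0$ and $\min_{[0,T]}\beta>0$; $f\in C([0,T];L^2(\Omega))$. For an integer $n>1$, $\tau=T/n$, $t_k=k\tau$, $\alpha_k=\alpha(t_k)$, $\beta_k=\beta(t_k)$, $f_k=f(t_k)$. Further, $$w_0=f_0+q_0\Delta u_0,\qquad q_0=\alpha_0+\beta_0\iint_\Omega|\nabla u_0|^2\,dx\,dy .$$ A solution sequence of the nonlinear scheme is a sequence $u_0,\dots,u_n\in D(\mathcal L)$ with the given $u_0$, with $u_1=u_0+\tau v_0+\frac{\tau^2}{2}w_0$ and, for $k=1,\dots,n-1$, $$\frac{u_{k+1}-2u_k+u_{k-1}}{\tau^2}+\frac12\left(\alpha_k+\frac{\beta_k}{2}\left(\|\mathcal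 L^{1/2}u_{k+1}\|^2+\|\mathcal L^{1/2}u_{k-1}\|^2\right)\right)\left(\mathcal L u_{k+1}+\mathcal L u_{k-1}\right)=f_k .$$ *)

(* Defs.v *)
(* Functions on the plane domain Omega are total functions
   R * R -> R of which only the values on Omega matter; elements of L^2(Omega) are
   represented by such functions and compared by [eqO], equality almost
   everywhere on Omega.  Functions of time with values in a space of functions on Omega
   are maps R -> (R * R -> R) of which only the values on [0, T] matter. *)
From HB Require Import structures.
From mathcomp Require Import all_boot all_order all_algebra.
From mathcomp Require Import all_classical all_reals all_analysis.
Set Implicit Arguments.
Unset Strict Implicit.
Unset Printing Implicit Defensive.
Import Order.TTheory GRing.Theory Num.Theory.
Import numFieldNormedType.Exports.
Local Open Scope classical_set_scope.
Local Open Scope ring_scope.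

Notation plane R := (R * R)%type.
Notation fld R := (R * R -> R).

Definition ex {R : realType} : plane R := (1, 0).
Definition ey {R : realType} : plane R := (0, 1).

Definition leb2 {R : realType} := (@lebesgue_measure R \x @lebesgue_measure R)%E.

Definition bounded_convex_domain {R : realType} (Omega : set (plane R)) : Prop :=
  [/\ Omega !=set0, open Omega, bounded_set Omega & @convex_set R (plane R) Omega].

Definition eqO {R : realType} (Omega : set (plane R)) (g h : fld R) : Prop :=
  ae_eq (@leb2 R) Omega g h.

Definition L2 {R : realType} (Omega : set (plane R)) (g : fld R) : Prop :=
  measurable_fun Omega g /\
  (@leb2 R).-integrable Omega (fun z => ((g z) ^+ 2)%:E).

(* Meaningful on [L2 Omega] only: [Rintegral] returns 0 on divergent integrals. *)
Definition ip {R : realType} (Omega : set (plane R)) (g h : fld R) : R :=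
  (\int[@leb2 R]_(z in Omega) (g z * h z))%R.

Definition L2norm {R : realType} (Omega : set (plane R)) (g : fld R) : R :=
  Num.sqrt (ip Omega g g).

Definition partial {R : realType} (e : plane R) (g : fld R) : fld R :=
  fun z => 'D_e g z.

Definition smooth {R : realType} (g : fld R) : Prop :=
  forall (es : seq (plane R)) (z : plane R),
    differentiable (foldr partial g es : plane R -> R) z.

Definition test_function {R : realType} (Omega : set (plane R)) (phi : fld R) : Prop :=
  smooth phi /\
  exists K : set (plane R),
    [/\ compact K, K `<=` Omega & forall z, ~ K z -> phi z = 0].

Definition closure_extension {R : realType} (Omega : set (plane R)) (g h : fld R) : Prop :=
  {within closure Omega, continuous h} /\ (forall z, Omega z -> h z = g z).

(* C^k(closure Omega): the derivatives of order at most k, in all directions, exist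
   in Omega and extend continuously to the closure. *)
Fixpoint Cclosure {R : realType} (Omega : set (plane R)) (k : nat) (g : fld R) : Prop :=
  (exists h, closure_extension Omega g h) /\
  match k with
  | 0%N => True
  | k'.+1 => forall e : plane R,
      (forall z, Omega z -> derivable g z e) /\ Cclosure Omega k' (partial e g)
  end.

Definition zero_on_boundary {R : realType} (Omega : set (plane R)) (g : fld R) : Prop :=
  exists h, closure_extension Omega g h /\ (forall z, (closure Omega `\` Omega) z -> h z = 0).

Definition dom_L0 {R : realType} (Omega : set (plane R)) (g : fld R) : Prop :=
  Cclosure Omega 2 g /\ zero_on_boundary Omega g.

Definition laplacian {R : realType} (g : fld R) : fld R :=
  fun z => partial ex (partial ex g) z + partial ey (partial ey g) z.

Definition is_wpartial {R : realType} (Omega : set (plane R)) (e : plane R) (g d : fld R) : Prop :=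
  [/\ L2 Omega g, L2 Omega d &
    forall phi, test_function Omega phi -> ip Omega g (partial e phi) = - ip Omega d phi].

Definition has_wpartial {R : realType} (Omega : set (plane R)) (e : plane R) (g : fld R) : Prop :=
  exists d, is_wpartial Omega e g d.

(* A representative of the weak derivative; a junk value unless [has_wpartial]. *)
Definition wpartial {R : realType} (Omega : set (plane R)) (e : plane R) (g : fld R) : fld R :=
  xget (fun=> 0) [set d | is_wpartial Omega e g d].

Definition H01 {R : realType} (Omega : set (plane R)) (g : fld R) : Prop :=
  [/\ has_wpartial Omega ex g, has_wpartial Omega ey g &
    exists phi : nat -> fld R,
      [/\ forall j, test_function Omega (phi j),
          L2norm Omega (fun z => phi j z - g z) @[j --> \oo] --> (0 : R),
          L2norm Omega (fun z => partial ex (phi j) z - wpartial Omega ex g z) @[j --> \oo] --> (0 : R) &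
          L2norm Omega (fun z => partial ey (phi j) z - wpartial Omega ey g z) @[j --> \oo] --> (0 : R)]].

Definition form_a {R : realType} (Omega : set (plane R)) (g h : fld R) : R :=
  ip Omega (wpartial Omega ex g) (wpartial Omega ex h) + ip Omega (wpartial Omega ey g) (wpartial Omega ey h).

Definition is_L {R : realType} (Omega : set (plane R)) (g l : fld R) : Prop :=
  [/\ H01 Omega g, L2 Omega l & forall h, H01 Omega h -> form_a Omega g h = ip Omega l h].

Definition dom_L {R : realType} (Omega : set (plane R)) (g : fld R) : Prop :=
  exists l, is_L Omega g l.

(* A representative of L g; a junk value unless [dom_L Omega g]. *)
Definition Lop {R : realType} (Omega : set (plane R)) (g : fld R) : fld R :=
  xget (fun=> 0) [set l | is_L Omega g l].

Definition dom_Lsq {R : realType} (Omega : set (plane R)) (g : fld R) : Prop :=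
  dom_L Omega g /\ dom_L Omega (Lop Omega g).

(* D(L^(1/2)) = H^1_0(Omega), and ||L^(1/2) g|| is the L^2 norm of the gradient. *)
Definition dom_Lhalf {R : realType} (Omega : set (plane R)) (g : fld R) : Prop := H01 Omega g.

Definition norm_Lhalf {R : realType} (Omega : set (plane R)) (g : fld R) : R :=
  Num.sqrt (form_a Omega g g).

Definition C1_interval {R : realType} (T : R) (a : R -> R) : Prop :=
  exists da : R -> R,
    (forall t, t \in `[0, T] ->
       (s - t)^-1 * (a s - a t) @[s --> within `[0, T] t^'] --> da t) /\
    {within `[0, T], continuous da}.

Definition tcont {R : realType} (Omega : set (plane R)) (T : R) (v : R -> fld R) : Prop :=
  forall t, t \in `[0, T] ->
    L2 Omega (v t) /\
    L2norm Omega (fun z => v s z - v t z) @[s --> within `[0, T] (nbhs t)] --> (0 : R).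

(* dv is the time derivative of v : [0, T] -> L^2(Omega), one-sided at 0 and T. *)
Definition tderiv {R : realType} (Omega : set (plane R)) (T : R) (v dv : R -> fld R) : Prop :=
  forall t, t \in `[0, T] ->
    [/\ L2 Omega (v t), L2 Omega (dv t) &
      L2norm Omega (fun z => (s - t)^-1 * (v s z - v t z) - dv t z)
        @[s --> within `[0, T] t^'] --> (0 : R)].

Fixpoint tCk {R : realType} (Omega : set (plane R)) (T : R) (k : nat) (v : R -> fld R) : Prop :=
  match k with
  | 0%N => tcont Omega T v
  | k'.+1 => exists dv, tderiv Omega T v dv /\ tCk Omega T k' dv
  end.

Definition tlipschitz {R : realType} (Omega : set (plane R)) (T : R) (v : R -> fld R) : Prop :=
  exists K : R, forall s t, s \in `[0, T] -> t \in `[0, T] ->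
    L2norm Omega (fun z => v s z - v t z) <= K * `|s - t|.

(* v in C([0, T]; D(L^(1/2))), D(L^(1/2)) carrying the graph norm *)
Definition tcont_Lhalf {R : realType} (Omega : set (plane R)) (T : R) (v : R -> fld R) : Prop :=
  tcont Omega T v /\
  forall t, t \in `[0, T] ->
    dom_Lhalf Omega (v t) /\
    norm_Lhalf Omega (fun z => v s z - v t z) @[s --> within `[0, T] (nbhs t)] --> (0 : R).

(* The nonlocal coefficient, with the integral of |grad g|^2 written as a(g, g). *)
Definition coef {R : realType} (Omega : set (plane R)) (alpha beta : R -> R) (t : R) (g : fld R) : R :=
  alpha t + beta t * form_a Omega g g.

(* u solves the problem with data (f, u0, v0), and ut is its time derivative.
   The homogeneous boundary condition is u(t) in H^1_0(Omega). *)
Definition is_solution {R : realType} (Omega : set (plane R)) (T : R) (alpha beta : R -> R)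
    (f : R -> fld R) (u0 v0 : fld R) (u ut : R -> fld R) : Prop :=
  [/\ forall t, t \in `[0, T] -> H01 Omega (u t),
      forall e, e = ex \/ e = ey ->
        [/\ tCk Omega T 1 (fun t => wpartial Omega e (u t)),
            forall t, t \in `[0, T] -> has_wpartial Omega e (wpartial Omega e (u t)) &
            tcont Omega T (fun t => wpartial Omega e (wpartial Omega e (u t)))],
      tderiv Omega T u ut /\
        exists utt, [/\ tderiv Omega T ut utt, tcont Omega T utt &
          forall t, t \in `[0, T] ->
            eqO Omega (fun z => utt t z - coef Omega alpha beta t (u t) *
                     (wpartial Omega ex (wpartial Omega ex (u t)) z +
                      wpartial Omega ey (wpartial Omega ey (u t)) z))
                  (f t)],
      eqO Omega (u 0) u0 &
      eqO Omega (ut 0) v0].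

(* Well-posedness at the data (f, u0, v0) in the sense of Hadamard: u is a
   solution, it is the only one, and solutions depend continuously on the data
   near (f, u0, v0), in the energy norms. *)
Definition well_posed {R : realType} (Omega : set (plane R)) (T : R) (alpha beta : R -> R)
    (f : R -> fld R) (u0 v0 : fld R) (u ut : R -> fld R) : Prop :=
  [/\ is_solution Omega T alpha beta f u0 v0 u ut,
      forall u' ut', is_solution Omega T alpha beta f u0 v0 u' ut' ->
        forall t, t \in `[0, T] -> eqO Omega (u' t) (u t) &
      forall eps : R, 0 < eps -> exists2 delta : R, 0 < delta &
        forall f' u0' v0' u' ut',
          tcont Omega T f' -> H01 Omega u0' -> L2 Omega v0' ->
          is_solution Omega T alpha beta f' u0' v0' u' ut' ->
          (forall t, t \in `[0, T] -> L2norm Omega (fun z => f' t z - f t z) < delta) ->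
          norm_Lhalf Omega (fun z => u0' z - u0 z) < delta ->
          L2norm Omega (fun z => v0' z - v0 z) < delta ->
          forall t, t \in `[0, T] ->
            norm_Lhalf Omega (fun z => u' t z - u t z) < eps /\
            L2norm Omega (fun z => ut' t z - ut t z) < eps].

Definition w0_of {R : realType} (Omega : set (plane R)) (alpha beta : R -> R)
    (f : R -> fld R) (u0 : fld R) : fld R :=
  fun z => f 0 z + coef Omega alpha beta 0 u0 * laplacian u0 z.

Definition scheme_solution {R : realType} (Omega : set (plane R)) (T : R) (alpha beta : R -> R)
    (f : R -> fld R) (u0 v0 : fld R) (n : nat) (U : nat -> fld R) : Prop :=
  let tau := T / n%:R in
  let tk k := k%:R * tau in
  [/\ forall k, (k <= n)%N -> dom_L Omega (U k),
      eqO Omega (U 0%N) u0,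
      eqO Omega (U 1%N)
        (fun z => u0 z + tau * v0 z + tau ^+ 2 / 2 * w0_of Omega alpha beta f u0 z) &
      forall k, (1 <= k < n)%N ->
        eqO Omega
          (fun z =>
             (U k.+1 z - 2 * U k z + U k.-1 z) / tau ^+ 2 +
             2^-1 * (alpha (tk k) + beta (tk k) / 2 *
                       (norm_Lhalf Omega (U k.+1) ^+ 2 + norm_Lhalf Omega (U k.-1) ^+ 2)) *
               (Lop Omega (U k.+1) z + Lop Omega (U k.-1) z))
          (f (tk k))].

(* Main.v *)
Require Import Defs.
From mathcomp Require Import all_boot all_order all_algebra.
From mathcomp Require Import all_classical all_reals all_analysis.
From mathcomp Require Import measurable_realfun.
From mathcomp Require Import ring lra.
From HB Require Import structures.
Import Order.TTheory GRing.Theory Num.Theory.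
Import numFieldNormedType.Exports.
Local Open Scope classical_set_scope.
Local Open Scope ring_scope.
Set Implicit Arguments.
Unset Strict Implicit.
Unset Printing Implicit Defensive.

(** The error of the scheme is estimated by an energy method. Let [z_k = u(t_k) - U_k] and let
    [A_k] be the squared norm of its gradient. Taylor's formula in [L^2] shows that the
    sampled solution satisfies the scheme up to a residual of order [tau^2]
    ([smooth_solution_bounds]), so that [z] satisfies a similar scheme whose sources are this
    residual and the change of the nonlocal coefficient. Tested with [z_(k+1) - z_(k-1)], the second difference telescopes into the increments of
    [|z_(k+1) - z_k|^2 / tau^2], and the elliptic term into [q_k (A_(k+1) - A_(k-1)) / 2], where
    [q_k] is the coefficient computed from the discrete solution ([test_scheme]).

    The difficulty is that [q_k] is not known to vary slowly with [k]. However,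
    [|grad U_k|^2 = b_k + A_k] with [b_k = |grad u(t_k)|^2 - 2 (grad u(t_k), grad z_k)]. The contribution
    of [A_k] to [q_k] telescopes into increments of [A_k^2]. In [b_k], Green's formula replaces the
    last product by [(l(t_k), z_k)] with [l] minus the Laplacian of [u]; this varies by [O(tau)]
    in one step as soon as [|z_(k+1) - z_k| = O(tau)]. Such a bound holds a priori, because the same
    computation with [u = 0] bounds the energy of the discrete solution itself ([a_priori]).
    Hence the energy
    [|z_k - z_(k-1)|^2 / tau^2 + s_k (A_k + A_(k-1)) / 2 + beta_k (A_k^2 + A_(k-1)^2) / 4], with
    [s_k = alpha_k + beta_k b_k], satisfies a discrete Gronwall inequality with initial value and
    source [O(tau^4)] ([second_order_energy]). The a priori bound also gives [|z_k| = O(k tau)], so on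
    a short time interval [b_k] is bounded below by a small negative number and [s_k] stays
    positive; this, and the Gronwall factor, is what makes the result local in time.

    It remains to place the concrete problem in this frame. The starting value [U_1] must agree
    with [u(tau)] to third order in [L^2] and to second order in [H^1_0]; this amounts to
    identifying [w_0] with [u_tt(0)], that is, the classical Laplacian of [u_0] with the
    sum of the weak derivatives of [u(0)]. Both have the same products with test functions, by
    classical integration by parts. They are also limits of test functions in [L^2]: the weak
    one through the equation, since time derivatives of elements of [H^1_0] are limits of such
    elements, and the classical one because [U_1], [u_0], [v_0] and [f(0)] are in [H^1_0]. A function
    orthogonal to the test functions and in their closure vanishes. The same argument
    identifies the gradient of [U_1] ([grad_first_step]), and it takes the place of a general
    uniqueness theorem for weak derivatives. *)

Ltac nonneg := repeat first
  [ done | assumption | exact: ler0n | exact: sqr_ge0 | exact: sqrtr_ge0 | exact: normr_ge0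
  | apply: addr_ge0 | apply: mulr_ge0 | apply: exprn_ge0 | rewrite invr_ge0
  | (apply: ltW; assumption) ].

(** * Semi-inner products *)

Definition semi_inner {R : realType} {V : lmodType R} (d : V -> V -> R) : Prop :=
  [/\ forall x y, d x y = d y x,
      forall a x y z, d (a *: x + y) z = a * d x z + d y z &
      forall x, 0 <= d x x].

Definition seminorm {R : realType} {V : lmodType R} (d : V -> V -> R) (x : V) : R :=
  Num.sqrt (d x x).

Section SemiInner.
Context {R : realType} {V : lmodType R} {d : V -> V -> R}.
Hypothesis hd : semi_inner d.
Implicit Types x y z : V.

Lemma dotC x y : d x y = d y x.
Proof. by case: hd. Qed.

Lemma dotP a x y z : d (a *: x + y) z = a * d x z + d y z.
Proof. by case: hd. Qed.

Lemma dot_ge0 x : 0 <= d x x.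
Proof. by case: hd. Qed.

Lemma dotDl x y z : d (x + y) z = d x z + d y z.
Proof. by rewrite -{1}[x]scale1r dotP mul1r. Qed.

Lemma dot0l z : d 0 z = 0.
Proof. by apply: (@addIr _ (d 0 z)); rewrite -dotDl addr0 add0r. Qed.

Lemma dotZl a x z : d (a *: x) z = a * d x z.
Proof. by rewrite -[a *: x]addr0 dotP dot0l addr0. Qed.

Lemma dotNl x z : d (- x) z = - d x z.
Proof. by rewrite -scaleN1r dotZl mulN1r. Qed.

Lemma dotBl x y z : d (x - y) z = d x z - d y z.
Proof. by rewrite dotDl dotNl. Qed.

Lemma dotDr x y z : d z (x + y) = d z x + d z y.
Proof. by rewrite !(dotC z) dotDl. Qed.

Lemma dotZr a x z : d z (a *: x) = a * d z x.
Proof. by rewrite !(dotC z) dotZl. Qed.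

Lemma dotNr x z : d z (- x) = - d z x.
Proof. by rewrite !(dotC z) dotNl. Qed.

Lemma dotBr x y z : d z (x - y) = d z x - d z y.
Proof. by rewrite !(dotC z) dotBl. Qed.

Lemma seminorm_ge0 x : 0 <= seminorm d x.
Proof. exact: sqrtr_ge0. Qed.

Lemma sqr_seminorm x : seminorm d x ^+ 2 = d x x.
Proof. by rewrite sqr_sqrtr // dot_ge0. Qed.

(** The discriminant of the nonnegative quadratic polynomial [t |-> d (t x + y) (t x + y)]
    yields the inequality; the optimal [t] is plugged in, or a large one when [d x x = 0]. *)
Lemma dot_sqr_le x y : d x y ^+ 2 <= d x x * d y y.
Proof.
have H t : 0 <= t ^+ 2 * d x x + 2 * t * d x y + d y y.
  have := dot_ge0 (t *: x + y); rewrite !(dotDl, dotDr, dotZl, dotZr) (dotC y x).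
  by congr (0 <= _); ring.
have [x0|x0] := eqVneq (d x x) 0.
  have [->|xy0] := eqVneq (d x y) 0; first by rewrite expr0n mulr_ge0 ?dot_ge0.
  have := H (- (d y y + 1) / (2 * d x y)); rewrite x0.
  have -> : 2 * (- (d y y + 1) / (2 * d x y)) * d x y = - (d y y + 1) by field.
  by rewrite mulr0; lra.
have xp : 0 < d x x by rewrite lt_def x0 dot_ge0.
have := H (- d x y / d x x).
have -> : (- d x y / d x x) ^+ 2 * d x x + 2 * (- d x y / d x x) * d x y + d y y =
   (d x x * d y y - d x y ^+ 2) / d x x by field.
by rewrite pmulr_lge0 ?invr_gt0 // subr_ge0.
Qed.

Lemma dot_le x y : `|d x y| <= seminorm d x * seminorm d y.
Proof.
rewrite -sqrtrM ?dot_ge0 // -sqrtr_sqr; apply: ler_wsqrtr; exact: dot_sqr_le.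
Qed.

Lemma seminormD x y : seminorm d (x + y) <= seminorm d x + seminorm d y.
Proof.
rewrite -(@ler_pXn2r _ 2) ?nnegrE ?addr_ge0 ?seminorm_ge0 //.
rewrite sqrrD !sqr_seminorm !(dotDl, dotDr) (dotC y x).
have := le_trans (ler_norm _) (dot_le x y); lra.
Qed.

Lemma seminormZ a x : seminorm d (a *: x) = `|a| * seminorm d x.
Proof. by rewrite /seminorm dotZl dotZr mulrA -expr2 sqrtrM ?sqr_ge0 // sqrtr_sqr. Qed.

Lemma seminormN x : seminorm d (- x) = seminorm d x.
Proof. by rewrite /seminorm dotNl dotNr opprK. Qed.

Lemma seminormB x y : seminorm d (x - y) <= seminorm d x + seminorm d y.
Proof. by rewrite -(seminormN y) seminormD. Qed.

Lemma seminorm_dist x y : `|seminorm d x - seminorm d y| <= seminorm d (x - y).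
Proof.
have H u v : seminorm d u - seminorm d v <= seminorm d (u - v).
  by rewrite lerBlDr -[in leLHS](subrK v u) seminormD.
by rewrite ler_norml H andbT lerNl opprB -(seminormN (x - y)) opprB H.
Qed.

Lemma seminorm_sub4 x y x' y' :
  seminorm d (x' - y') <= seminorm d (x - y) + seminorm d (x - x') + seminorm d (y - y').
Proof.
have -> : x' - y' = ((x - y) - (x - x')) + (y - y').
  by rewrite opprB [(x - y) + _]addrC !subrKA.
by apply: le_trans (seminormD _ _) _; rewrite lerD2r seminormB.
Qed.

(** Estimates of a vector are obtained from estimates of its scalar products: this
    turns vector-valued Taylor formulas into scalar ones. *)
Lemma seminorm_dual x C : 0 <= C -> (forall y, `|d x y| <= C * seminorm d y) -> seminorm d x <= C.
Proof.
move=> C0 /(_ x); rewrite ger0_norm ?dot_ge0 // -sqr_seminorm expr2.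
have [->//|x0] := eqVneq (seminorm d x) 0.
by rewrite ler_pM2r // lt_def x0 seminorm_ge0.
Qed.

End SemiInner.

(** The scalar product of the gradients is of this form. *)
Definition prod_dot {R : realType} {V W : lmodType R} (d : V -> V -> R) (e : W -> W -> R)
  (x y : V * W) : R := d x.1 y.1 + e x.2 y.2.

Lemma prod_semi_inner {R : realType} {V W : lmodType R} (d : V -> V -> R) (e : W -> W -> R) :
  semi_inner d -> semi_inner e -> semi_inner (prod_dot d e).
Proof.
move=> hd he; split; rewrite /prod_dot.
- by move=> x y; rewrite (dotC hd) (dotC he).
- by move=> c x y z /=; rewrite (dotP hd) (dotP he); ring.
- by move=> x; rewrite addr_ge0 ?(dot_ge0 hd) ?(dot_ge0 he).
Qed.

Lemma prod_seminorm_le {R : realType} {V W : lmodType R} (d : V -> V -> R) (e : W -> W -> R)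
  (hd : semi_inner d) (he : semi_inner e) (x : V * W) :
  seminorm (prod_dot d e) x <= seminorm d x.1 + seminorm e x.2.
Proof.
rewrite -(@ler_pXn2r _ 2) ?nnegrE ?addr_ge0 ?seminorm_ge0 //.
rewrite (sqr_seminorm (prod_semi_inner hd he)) sqrrD !sqr_seminorm // /prod_dot.
have : 0 <= seminorm d x.1 * seminorm e x.2 by rewrite mulr_ge0 ?seminorm_ge0.
lra.
Qed.
(** * Energy estimate for the abstract scheme *)

(** A discrete Gronwall inequality on a time interval short enough for the
    exponential factor to stay below 2. *)
Lemma gronwall_short {R : realType} (y : nat -> R) (kap : R) (m : nat) :
  0 <= kap -> (forall k, (1 <= k <= m)%N -> 0 <= y k) -> 4 * kap * m%:R <= 1 ->
  (forall k, (1 <= k < m)%N -> y k.+1 - y k <= kap * (y k.+1 + y k)) ->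
  forall k, (1 <= k <= m)%N -> y k <= 2 * y 1%N.
Proof.
move=> kap0 y0 km step.
suff H k : (k < m)%N -> y k.+1 * (1 - 2 * kap * k%:R) <= y 1%N.
  case=> [//|k] /andP[_ km']; have := H _ km'.
  have : k%:R <= m%:R :> R by rewrite ler_nat ltnW.
  move=> kle h; have : kap * k%:R <= kap * m%:R by rewrite ler_wpM2l.
  have := y0 k.+1 km'; set Y := y k.+1 in h *; set K := kap * k%:R => Y0 Kle.
  have : 0 <= Y * (1 / 2 - 2 * K) by rewrite mulr_ge0 //; lra.
  by move: h; rewrite -(mulrA 2) -/K; lra.
elim: k => [_|k IH km']; first by rewrite mulr0 subr0 mulr1.
have := step k.+1 km'; have := IH (ltnW km'); have := y0 k.+1 (ltnW km'); have := y0 k.+2 km'.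
have h : k.+2%:R <= m%:R :> R by rewrite ler_nat.
move: h; rewrite -(natr1 k.+1) -(natr1 k); have : 0 <= k%:R :> R by rewrite ler0n.
set K := k%:R; set M := m%:R in km *; set a := y k.+2; set b := y k.+1; set c := y 1%N.
move=> K0 KM a0 b0 IHk st.
have kK : 0 <= kap * K by rewrite mulr_ge0.
have kM : kap * (K + 1 + 1) <= kap * M by rewrite ler_wpM2l.
have st' : a * (1 - kap) <= b * (1 + kap) by nra.
(* the growth factor (1 + kap) / (1 - kap) is absorbed by the decrease of the weight *)
have p1 : 0 <= 1 - 2 * kap * (K + 1) by nra.
have p2 : 0 < 1 - kap by nra.
have e1 : a * (1 - 2 * kap * (K + 1)) * (1 - kap) <= b * (1 + kap) * (1 - 2 * kap * (K + 1)).
  by rewrite mulrAC ler_wpM2r.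
have e2 : b * (1 + kap) * (1 - 2 * kap * (K + 1)) <= b * (1 - 2 * kap * K) * (1 - kap).
  rewrite -subr_ge0.
  have -> : b * (1 - 2 * kap * K) * (1 - kap) - b * (1 + kap) * (1 - 2 * kap * (K + 1)) =
    b * (2 * (kap * kap) + 4 * (kap * (kap * K))) by ring.
  by apply: mulr_ge0 => //; rewrite addr_ge0 // !mulr_ge0.
have e3 : b * (1 - 2 * kap * K) * (1 - kap) <= c * (1 - kap) by apply: ler_wpM2r => //; exact: ltW.
by rewrite -(ler_pM2r p2); exact: le_trans e1 (le_trans e2 e3).
Qed.

Section EnergyStep.
Context {R : realType} {V W : lmodType R} {d : V -> V -> R} {a : W -> W -> R}.
Hypotheses (hd : semi_inner d) (ha : semi_inner a).

(** Testing the scheme with [zp - zm] makes both terms telescope. *)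
Lemma test_scheme (tau q X : R) (zp z zm : V) (gp gm : W) : tau != 0 ->
  d (zp - 2 *: z + zm) (zp - zm) + tau ^+ 2 / 2 * (q * a (gp + gm) (gp - gm)) = tau ^+ 2 * X ->
  d (zp - z) (zp - z) / tau ^+ 2 - d (z - zm) (z - zm) / tau ^+ 2 +
    q / 2 * (a gp gp - a gm gm) = X.
Proof.
move=> t0; rewrite !(dotDl hd, dotDr hd, dotBl hd, dotBr hd, dotDl ha, dotDr ha, dotBl ha,
  dotBr ha, dotZl hd, dotZr hd, dotNl hd, dotNr hd, dotNl ha, dotNr ha).
rewrite (dotC hd z zp) (dotC hd z zm) (dotC hd zm zp) (dotC ha gm gp) => E.
have t2 : tau ^+ 2 != 0 by rewrite expf_neq0.
apply: (mulfI t2); rewrite -E; field.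
exact: t0.
Qed.

End EnergyStep.

(** The squared gradient norm of the discrete solution is [b + A]. The contribution of [A] to
    the coefficient [q] telescopes into the squares; what is left on the right contains only
    increments in time of [b], [s] and [be]. *)
Lemma energy_balance {R : realType} (D' D A2 A1 A0 al be be' b2 b1 b0 q s s' X : R) :
  q = al + be / 2 * ((b2 + A2) + (b0 + A0)) -> s = al + be * b1 ->
  D' - D + q / 2 * (A2 - A0) = X ->
  (D' + s' / 2 * (A2 + A1) + be' / 4 * (A2 ^+ 2 + A1 ^+ 2)) -
  (D + s / 2 * (A1 + A0) + be / 4 * (A1 ^+ 2 + A0 ^+ 2)) =
  X - be / 4 * ((b2 - b1) - (b1 - b0)) * (A2 - A0) + (s' - s) / 2 * (A2 + A1) +
    (be' - be) / 4 * (A2 ^+ 2 + A1 ^+ 2).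
Proof. by move=> -> -> <-; field. Qed.
Section AbstractScheme.
Context {R : realType} {V W : lmodType R} (d : V -> V -> R) (a : W -> W -> R).
Hypotheses (hd : semi_inner d) (ha : semi_inner a).

Definition scheme_coef (al be : nat -> R) (gU : nat -> W) (k : nat) : R :=
  al k + be k / 2 * (a (gU k.+1) (gU k.+1) + a (gU k.-1) (gU k.-1)).

(** Sampled exact solution [u] and discrete solution [U]: [gu], [gU] are their
    gradients, [l] is minus the Laplacian of [u]. Every constant is the same [M],
    which must not depend on [tau] and [n]. The scheme is needed only in weak form,
    against the vectors that the energy method uses. *)
Record consistent (M c tau : R) (n : nat) (al be : nat -> R)
    (f u l U : nat -> V) (gu gU : nat -> W) : Prop := {
  al_bound : forall k, (k <= n)%N -> c <= al k <= M ;
  be_bound : forall k, (k <= n)%N -> c <= be k <= M ;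
  al_lip : forall k, (k < n)%N -> `|al k.+1 - al k| <= M * tau ;
  be_lip : forall k, (k < n)%N -> `|be k.+1 - be k| <= M * tau ;
  f_bound : forall k, (k <= n)%N -> seminorm d (f k) <= M ;
  u_lip : forall k, (k < n)%N -> seminorm d (u k.+1 - u k) <= M * tau ;
  l_bound : forall k, (k <= n)%N -> seminorm d (l k) <= M ;
  l_lip : forall k, (k < n)%N -> seminorm d (l k.+1 - l k) <= M * tau ;
  gu_bound : forall k, (k <= n)%N -> seminorm a (gu k) <= M ;
  gu_lip : forall k, (k < n)%N -> `|a (gu k.+1) (gu k.+1) - a (gu k) (gu k)| <= M * tau ;
  green : forall k j, (k <= n)%N -> (j <= n)%N ->
    a (gu k) (gu j - gU j) = d (l k) (u j - U j) ;
  scheme_u : forall k j, (1 <= k < n)%N -> (j <= n)%N ->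
    d (U k.+1 - 2 *: U k + U k.-1) (u j) +
    tau ^+ 2 / 2 * (scheme_coef al be gU k * a (gU k.+1 + gU k.-1) (gu j)) =
    tau ^+ 2 * d (f k) (u j) ;
  scheme_U : forall k j, (1 <= k < n)%N -> (j <= n)%N ->
    d (U k.+1 - 2 *: U k + U k.-1) (U j) +
    tau ^+ 2 / 2 * (scheme_coef al be gU k * a (gU k.+1 + gU k.-1) (gU j)) =
    tau ^+ 2 * d (f k) (U j) ;
  residual : forall k w, (1 <= k < n)%N ->
    `|d (u k.+1 - 2 *: u k + u k.-1) w +
      tau ^+ 2 / 2 * (scheme_coef al be gu k * d (l k.+1 + l k.-1) w) -
      tau ^+ 2 * d (f k) w| <= M * tau ^+ 4 * seminorm d w ;
  init_z0 : seminorm d (u 0%N - U 0%N) = 0 ;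
  init_gz0 : seminorm a (gu 0%N - gU 0%N) = 0 ;
  init_z1 : seminorm d (u 1%N - U 1%N) <= M * tau ^+ 3 ;
  init_gz1 : seminorm a (gu 1%N - gU 1%N) <= M * tau ^+ 2 }.

Lemma sqr_le_bound (x y : R) : 0 <= x -> x <= y -> x ^+ 2 <= y ^+ 2.
Proof. by move=> x0 xy; rewrite ler_pXn2r // nnegrE // (le_trans x0). Qed.

(** The scheme conserves an energy quartic in the gradient up to the variation of
    its coefficients, so the discrete solutions are bounded uniformly in [tau]. *)
Lemma a_priori (M c : R) : 0 <= M -> 0 < c ->
  exists N Tb : R, [/\ 0 <= N, 0 < Tb & forall (tau : R) n al be f u l U gu gU,
    0 < tau <= 1 -> (0 < n)%N -> consistent M c tau n al be f u l U gu gU ->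
    forall k, (1 <= k <= n)%N -> k%:R * tau <= Tb ->
      seminorm d (U k - U k.-1) <= N * tau /\
      (seminorm a (gU k) <= N /\ seminorm a (gU k.-1) <= N)].
Proof.
move=> M0 c0.
(* [N1] bounds the energy at the first step; [N2] bounds it on the short interval, by
   the Gronwall inequality with source [M ^+ 2]. *)
pose K := 1 + M / c; have K0 : 0 < K by rewrite ltr_pwDl // divr_ge0 // ltW.
pose N1 := 4 * M ^+ 2 + M / 2 * (5 * M ^+ 2) + M / 4 * (17 * M ^+ 4).
pose N2 := 2 * (N1 + M ^+ 2).
have N10 : 0 <= N1 by nonneg.
have N20 : 0 <= N2 by nonneg.
pose N := Num.sqrt N2 + Num.sqrt (2 * N2 / c).
exists N, (1 / (4 * K)); split.
- by nonneg.
- by rewrite divr_gt0 // mulr_gt0.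
move=> tau n al be f u l U gu gU /andP[t0 t1] n0 H.
pose D k := d (U k - U k.-1) (U k - U k.-1) / tau ^+ 2.
pose B k := a (gU k) (gU k).
pose F k := D k + al k / 2 * (B k + B k.-1) + be k / 4 * (B k ^+ 2 + B k.-1 ^+ 2).
have t20 : 0 < tau ^+ 2 by rewrite exprn_gt0.
have D0 k : 0 <= D k by rewrite divr_ge0 ?(dot_ge0 hd) // ltW.
have B0 k : 0 <= B k by exact: dot_ge0.
have FE k : (k <= n)%N -> D k + c / 2 * (B k + B k.-1) + c / 4 * (B k ^+ 2 + B k.-1 ^+ 2) <= F k.
  move=> kn; have /andP[h1 _] := al_bound H kn; have /andP[h2 _] := be_bound H kn.
  rewrite /F !lerD //; apply: ler_wpM2r; try nonneg; lra.
have Fp k : (k <= n)%N -> 0 <= F k.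
  by move=> kn; apply: le_trans (FE k kn); nonneg.
have F1 : F 1%N <= N1.
  have hz : seminorm d (U 1%N - U 0%N) <= 2 * M * tau.
    apply: le_trans (seminorm_sub4 hd (u 1%N) (u 0%N) _ _) _.
    rewrite (init_z0 H) addr0.
    have := u_lip H n0; have := init_z1 H.
    have : M * tau ^+ 3 <= M * tau by apply: ler_wpM2l => //; rewrite exprS ler_piMr ?exprn_ile1 // ltW.
    lra.
  have h0 : seminorm a (gU 0%N) <= M.
    have := seminorm_dist ha (gu 0%N) (gU 0%N); rewrite (init_gz0 H).
    have := gu_bound H (leq0n n); rewrite ler_norml => ? /andP[+ _]; lra.
  have h1 : seminorm a (gU 1%N) <= 2 * M.
    have := seminorm_dist ha (gu 1%N) (gU 1%N).
    have := gu_bound H n0; have := init_gz1 H.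
    have : M * tau ^+ 2 <= M by rewrite ler_piMr // exprn_ile1 // ltW.
    rewrite ler_norml => ? ? ? /andP[+ _]; lra.
  have b0 : B 0%N <= M ^+ 2.
    by rewrite /B -(sqr_seminorm ha); apply: sqr_le_bound => //; exact: seminorm_ge0.
  have b1 : B 1%N <= 4 * M ^+ 2.
    have -> : 4 * M ^+ 2 = (2 * M) ^+ 2 by ring.
    by rewrite /B -(sqr_seminorm ha); apply: sqr_le_bound => //; exact: seminorm_ge0.
  have d1 : D 1%N <= 4 * M ^+ 2.
    rewrite /D ler_pdivrMr //.
    have -> : 4 * M ^+ 2 * tau ^+ 2 = (2 * M * tau) ^+ 2 by ring.
    by rewrite -(sqr_seminorm hd); apply: sqr_le_bound => //; exact: seminorm_ge0.
  have bb0 := sqr_le_bound (B0 0%N) b0; have bb1 := sqr_le_bound (B0 1%N) b1.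
  have /andP[g1 g1'] := al_bound H n0; have /andP[g2 g2'] := be_bound H n0.
  rewrite /F /N1 !lerD //; apply: ler_pM; rewrite ?addr_ge0 ?sqr_ge0 //=; try lra.
have step k : (1 <= k < n)%N ->
    (F k.+1 + M ^+ 2) - (F k + M ^+ 2) <= K * tau * ((F k.+1 + M ^+ 2) + (F k + M ^+ 2)).
  move=> kn; have /andP[k1 kn'] := kn.
  have km : (k.-1 <= n)%N by apply: leq_trans (leq_pred _) (ltnW kn').
  have E1 := scheme_U H kn kn'; have E0 := scheme_U H kn km.
  have := @test_scheme _ _ _ _ _ hd ha tau (scheme_coef al be gU k)
    (d (f k) (U k.+1 - U k.-1)) (U k.+1) (U k) (U k.-1) (gU k.+1) (gU k.-1).
  have -> : d (U k.+1 - 2 *: U k + U k.-1) (U k.+1 - U k.-1) +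
      tau ^+ 2 / 2 * (scheme_coef al be gU k * a (gU k.+1 + gU k.-1) (gU k.+1 - gU k.-1)) =
      tau ^+ 2 * d (f k) (U k.+1 - U k.-1).
    by rewrite !(dotBr hd (U k.+1)) !(dotBr ha (gU k.+1)) [RHS]mulrBr -E1 -E0; ring.
  move=> /(_ (lt0r_neq0 t0) erefl).
  set X := d (f k) _ => bal.
  have qE : scheme_coef al be gU k = al k + be k / 2 * ((0 + B k.+1) + (0 + B k.-1)).
    by rewrite !add0r.
  have sE : al k = al k + be k * 0 by rewrite mulr0 addr0.
  have EB := energy_balance (B k) (be k.+1) (al k.+1) qE sE bal.
  set T2 := (al k.+1 - al k) / 2 * (B k.+1 + B k).
  set T3 := (be k.+1 - be k) / 4 * (B k.+1 ^+ 2 + B k ^+ 2).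
  have FF : F k.+1 - F k = X + T2 + T3 by rewrite [LHS]EB /T2 /T3; ring.
  have Xle : X <= tau * (M ^+ 2 + (D k.+1 + D k) / 2).
    have h1 : seminorm d (U k.+1 - U k) = Num.sqrt (D k.+1) * tau.
      rewrite /D sqrtrM ?(dot_ge0 hd) // sqrtrV ?sqr_ge0 // sqrtr_sqr ger0_norm ?ltW //=.
      by rewrite mulrVK // unitfE lt0r_neq0.
    have h0 : seminorm d (U k - U k.-1) = Num.sqrt (D k) * tau.
      rewrite /D sqrtrM ?(dot_ge0 hd) // sqrtrV ?sqr_ge0 // sqrtr_sqr ger0_norm ?ltW //=.
      by rewrite mulrVK // unitfE lt0r_neq0.
    apply: le_trans (ler_norm _) _; apply: le_trans (dot_le hd _ _) _.
    have -> : U k.+1 - U k.-1 = (U k.+1 - U k) + (U k - U k.-1) by rewrite subrKA.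
    have := seminormD hd (U k.+1 - U k) (U k - U k.-1); rewrite h1 h0.
    have := f_bound H (ltnW kn').
    rewrite -{2}(sqr_sqrtr (D0 k.+1)) -{2}(sqr_sqrtr (D0 k)).
    move: (sqrtr_ge0 (D k.+1)) (sqrtr_ge0 (D k)) (seminorm_ge0 (d := d) (f k))
      (seminorm_ge0 (d := d) (U k.+1 - U k + (U k - U k.-1))).
    move: (Num.sqrt (D k.+1)) (Num.sqrt (D k)) (seminorm d (f k)) (seminorm d (U k.+1 - U k + (U k - U k.-1))) => x y p r x0 y0 p0 r0 pM rle.
    apply: (@le_trans _ _ (M * (x * tau + y * tau))); first exact: ler_pM.
    rewrite -mulrDl mulrA mulrC ler_pM2l //.
    have := sqr_ge0 (M - x); have := sqr_ge0 (M - y); rewrite !sqrrB; lra.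
  have T2le : T2 <= M * tau * ((B k.+1 + B k) / 2).
    rewrite /T2 mulrAC -mulrA; apply: ler_wpM2r; first by nonneg.
    exact: le_trans (ler_norm _) (al_lip H kn').
  have T3le : T3 <= M * tau * ((B k.+1 ^+ 2 + B k ^+ 2) / 4).
    rewrite /T3 mulrAC -mulrA; apply: ler_wpM2r; first by nonneg.
    exact: le_trans (ler_norm _) (be_lip H kn').
  have hF := FE k.+1 kn'; have hFk := FE k (ltnW kn').
  rewrite /= in hF hFk.
  have cF : (B k.+1 + B k) / 2 + (B k.+1 ^+ 2 + B k ^+ 2) / 4 <= F k.+1 / c.
    by rewrite ler_pdivlMr //; have := D0 k.+1; lra.
  have D'F : D k.+1 <= F k.+1 by apply: le_trans hF; rewrite -addrA lerDl; nonneg.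
  have DF : D k <= F k by apply: le_trans hFk; rewrite -addrA lerDl; nonneg.
  have Mc : M * tau * ((B k.+1 + B k) / 2 + (B k.+1 ^+ 2 + B k ^+ 2) / 4) <= tau * (M / c * F k.+1).
    have -> : tau * (M / c * F k.+1) = M * tau * (F k.+1 / c) by ring.
    by apply: ler_wpM2l => //; nonneg.
  have FkM : 0 <= M / c * (F k + M ^+ 2 + M ^+ 2) by have := Fp k (ltnW kn') => ?; nonneg.
  have : tau * (M / c * F k.+1 + (M ^+ 2 + (F k.+1 + F k) / 2)) <= tau * (K * (F k.+1 + M ^+ 2 + (F k + M ^+ 2))).
    by apply: ler_wpM2l; [exact: ltW|rewrite /K; have := Fp _ kn'; have := Fp _ (ltnW kn'); have := sqr_ge0 M; lra].
  have : tau * (M ^+ 2 + (D k.+1 + D k) / 2) <= tau * (M ^+ 2 + (F k.+1 + F k) / 2).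
    by apply: ler_wpM2l; [exact: ltW|lra].
  move: Xle T2le T3le Mc FF; rewrite -!mulrA (mulrCA K); lra.
move=> k kn ktau; have /andP[k1 kn'] := kn.
have Fk : F k <= N2.
  have := @gronwall_short _ (fun j => F j + M ^+ 2) (K * tau) k.
  have h1 : 0 <= K * tau by nonneg.
  have h2 j : (1 <= j <= k)%N -> 0 <= F j + M ^+ 2.
    by move=> /andP[_ jk]; rewrite addr_ge0 ?sqr_ge0 // Fp // (leq_trans jk).
  have h3 : 4 * (K * tau) * k%:R <= 1.
    by move: ktau; rewrite ler_pdivlMr ?mulr_gt0 //; lra.
  have h4 j : (1 <= j < k)%N -> (F j.+1 + M ^+ 2) - (F j + M ^+ 2) <= K * tau * ((F j.+1 + M ^+ 2) + (F j + M ^+ 2)).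
    by move=> /andP[j1 jk]; apply: step; rewrite j1 (leq_trans jk).
  move=> /(_ h1 h2 h3 h4 k); rewrite k1 leqnn => /(_ isT) /=; rewrite /N2.
  have := sqr_ge0 M; lra.
have hFk := le_trans (FE k kn') Fk.
have Bk : B k <= 2 * N2 / c /\ B k.-1 <= 2 * N2 / c.
  have h : c / 2 * (B k + B k.-1) <= N2.
    apply: le_trans hFk; rewrite addrAC lerDr; nonneg.
  by split; rewrite ler_pdivlMr //; move: (mulr_ge0 (ltW c0) (B0 k)) (mulr_ge0 (ltW c0) (B0 k.-1)); lra.
have Dk : D k <= N2 by apply: le_trans hFk; rewrite -addrA lerDl; nonneg.
split.
  apply: (@le_trans _ _ (Num.sqrt N2 * tau)); last by rewrite ler_wpM2r ?lerDl ?sqrtr_ge0 // ltW.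
  rewrite -(ger0_norm (ltW t0)) -sqrtr_sqr -sqrtrM //; apply: ler_wsqrtr.
  by move: Dk; rewrite /D ler_pdivrMr.
by case: Bk => B1 B2; split; (apply: le_trans (_ : Num.sqrt (2 * N2 / c) <= _); [exact: ler_wsqrtr|rewrite lerDr sqrtr_ge0]).
Qed.


Lemma seminorm_rate (tau : R) (x : V) : 0 < tau ->
  seminorm d x = Num.sqrt (d x x / tau ^+ 2) * tau.
Proof.
move=> t0; rewrite sqrtrM ?(dot_ge0 hd) // sqrtrV ?sqr_ge0 // sqrtr_sqr ger0_norm ?ltW //=.
by rewrite mulrVK // unitfE lt0r_neq0.
Qed.

Lemma seminorm_steps (z : nat -> V) (k : nat) (del : R) : seminorm d (z 0%N) = 0 ->
  (forall j, (1 <= j <= k)%N -> seminorm d (z j - z j.-1) <= del) ->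
  forall j, (j <= k)%N -> seminorm d (z j) <= j%:R * del.
Proof.
move=> z0 step; elim=> [_|j IH jk]; first by rewrite z0 mul0r.
have := seminormD hd (z j.+1 - z j) (z j); rewrite subrK => /le_trans; apply.
by rewrite -natr1 mulrDl mul1r addrC lerD ?step ?IH // ltnW.
Qed.

Lemma norm_mul_le (x y X Y : R) : `|x| <= X -> `|y| <= Y -> x * y <= X * Y.
Proof. by move=> xX yY; apply: le_trans (ler_norm _) _; rewrite normrM ler_pM. Qed.

(** All the terms of the energy balance carry a factor [tau], once the coefficients
    [s], [b], [be] are known to be Lipschitz. *)
Lemma energy_growth (M Q N5 N7 tau tau4 D' D A2 A1 A0 be be' b2 b1 b0 s s' X : R) :
  0 <= M -> 0 <= N5 -> 0 <= N7 -> 0 <= tau -> 0 <= tau4 -> 0 <= D' -> 0 <= D ->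
  0 <= A2 <= Q ^+ 2 -> 0 <= A1 <= Q ^+ 2 -> 0 <= A0 -> 0 <= Q -> 0 <= be <= M ->
  `|b2 - b1| <= N5 * tau -> `|b1 - b0| <= N5 * tau -> `|be' - be| <= M * tau ->
  `|s' - s| <= N7 * tau ->
  X <= tau * (M * (tau4 + (D' + D) / 2) + M ^+ 2 * Q / 2 * (A2 + A0 + D' + D)) ->
  X - be / 4 * ((b2 - b1) - (b1 - b0)) * (A2 - A0) + (s' - s) / 2 * (A2 + A1) +
    (be' - be) / 4 * (A2 ^+ 2 + A1 ^+ 2) <=
  tau * (M + M ^+ 2 * Q + M * N5 + N7 + M * Q ^+ 2) * (D' + D + (A2 + A1 + A0) + tau4).
Proof.
move=> M0 N50 N70 t0 t40 D'0 D0 /andP[A20 A2Q] /andP[A10 A1Q] A00 Q0 /andP[be0 beM] hb1 hb0 hbe hs hX.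
set S := D' + D + (A2 + A1 + A0).
have S0 : 0 <= S by rewrite /S; nonneg.
have h1 : - (be / 4 * ((b2 - b1) - (b1 - b0)) * (A2 - A0)) <= tau * (M * N5) * (S + tau4).
  rewrite -mulNr -mulrN.
  apply: (@le_trans _ _ ((M / 4 * (2 * (N5 * tau))) * (A2 + A0))).
    apply: norm_mul_le; last by rewrite (le_trans (ler_normB _ _)) // !ger0_norm.
    rewrite normrM normrN; apply: ler_pM => //; first by rewrite ger0_norm ?divr_ge0 // ler_wpM2r.
    by apply: le_trans (ler_normB _ _) _; lra.
  have -> : M / 4 * (2 * (N5 * tau)) = tau * (M * N5) / 2 by field.
  by rewrite -mulrA; apply: ler_wpM2l; [nonneg|rewrite /S; lra].
have h2 : (s' - s) / 2 * (A2 + A1) <= tau * N7 * (S + tau4).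
  apply: (@le_trans _ _ (N7 * tau * (A2 + A1))).
    apply: norm_mul_le; last by rewrite ger0_norm ?addr_ge0.
    rewrite normrM (ger0_norm (_ : 0 <= 2^-1)) ?invr_ge0 //.
    have := normr_ge0 (s' - s); lra.
  by rewrite (mulrC N7); apply: ler_wpM2l; [nonneg|rewrite /S; lra].
have h3 : (be' - be) / 4 * (A2 ^+ 2 + A1 ^+ 2) <= tau * (M * Q ^+ 2) * (S + tau4).
  apply: (@le_trans _ _ (M * tau * (Q ^+ 2 * (A2 + A1)))).
    apply: norm_mul_le.
      rewrite normrM (ger0_norm (_ : 0 <= 4^-1)) ?invr_ge0 //.
      have := normr_ge0 (be' - be); lra.
    rewrite ger0_norm ?addr_ge0 ?sqr_ge0 // mulrDr !expr2 -!expr2.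
    by rewrite lerD // expr2 ler_wpM2r.
  have -> : M * tau * (Q ^+ 2 * (A2 + A1)) = tau * (M * Q ^+ 2) * (A2 + A1) by ring.
  by apply: ler_wpM2l; [nonneg|rewrite /S; lra].
have h4 : X <= tau * (M + M ^+ 2 * Q) * (S + tau4).
  apply: le_trans hX _; rewrite -[leRHS]mulrA; apply: ler_wpM2l => //; rewrite [leRHS]mulrDl; apply: lerD.
    by apply: ler_wpM2l => //; rewrite /S; lra.
  by rewrite -[leLHS]mulrA; apply: ler_wpM2l; [nonneg|rewrite /S; lra].
have -> : tau * (M + M ^+ 2 * Q + M * N5 + N7 + M * Q ^+ 2) * (S + tau4) =
  tau * (M + M ^+ 2 * Q) * (S + tau4) + tau * (M * N5) * (S + tau4) + tau * N7 * (S + tau4) +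
  tau * (M * Q ^+ 2) * (S + tau4) by ring.
by rewrite !lerD.
Qed.

(** The error satisfies the scheme with the coefficient [q] of the discrete solution, up to the
    residual and to the term [(q - q') l], which is controlled by the gradient of the error.
    Since [a (gu k) (gz k) = d (l k) (z k)], the quantity [b k] is Lipschitz in time by the a
    priori bound on the increments of [z], and the energy balance gives a Gronwall inequality. *)
Theorem second_order_energy (M c : R) : 0 <= M -> 0 < c ->
  exists Tb C : R, [/\ 0 < Tb, 0 <= C & forall (tau : R) n al be f u l U gu gU,
    0 < tau <= 1 -> (0 < n)%N -> consistent M c tau n al be f u l U gu gU ->
    forall k, (1 <= k <= n)%N -> k%:R * tau <= Tb ->
      seminorm d (u k - U k) <= C * tau ^+ 2].
Proof.
move=> M0 c0; have [N [Tb0 [N0 Tb00 apri]]] := a_priori M0 c0.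
pose Q := N + M; have Q0 : 0 <= Q by exact: addr_ge0.
pose N6 := M ^+ 2 + 2 * (M * Q).
pose N5 := M + 4 * (M * Q).
pose N7 := M + M * N6 + M * N5.
pose K := (M + M ^+ 2 * Q + M * N5 + N7 + M * Q ^+ 2) * (1 + 4 / c) + 1.
pose C1 := M ^+ 2 + (M + M * N6) / 2 * M ^+ 2 + M / 4 * (Q ^+ 2 * M ^+ 2).
have N60 : 0 <= N6 by nonneg.
have N50 : 0 <= N5 by nonneg.
have N70 : 0 <= N7 by rewrite /N7; nonneg.
have K0 : 0 < K by rewrite /K ltr_wpDl //; nonneg.
have C10 : 0 <= C1 by rewrite /C1; nonneg.
(* The bounds serve, in this order, the step size, the a priori estimate, the positivity
   of [s], and the Gronwall inequality. *)
pose Tb := Num.min (Num.min 1 Tb0) (Num.min (c / (4 * (M ^+ 2 * Q) + 1)) (1 / (4 * K))).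
exists Tb, (Num.sqrt (2 * (C1 + 1))); split; last 1 first; last 2 first.
- rewrite /Tb !lt_min ltr01 Tb00 /= !divr_gt0 ?mulr_gt0 // ltr_wpDl //; nonneg.
- exact: sqrtr_ge0.
move=> tau n al be f u l U gu gU tau01 n0 H k k1n; rewrite !le_min.
move=> /andP[/andP[kt1 ktT]] /andP[ktc ktK].
have /andP[t0 t1] := tau01; have /andP[k1 kn] := k1n.
have t20 : 0 < tau ^+ 2 by rewrite exprn_gt0.
have ktj j : (j <= k)%N -> j%:R * tau <= k%:R * tau by move=> jk; rewrite ler_pM2r // ler_nat.
have jn j : (j <= k)%N -> (j <= n)%N by move=> jk; exact: leq_trans kn.
have pk j : (j <= k)%N -> (j.-1 <= k)%N by move=> jk; apply: leq_trans (leq_pred _) jk.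
have AP j : (1 <= j <= k)%N -> seminorm d (U j - U j.-1) <= N * tau /\
      (seminorm a (gU j) <= N /\ seminorm a (gU j.-1) <= N).
  move=> /andP[j1 jk]; apply: (apri tau n al be f u l U gu gU tau01 n0 H j).
    by rewrite j1 jn.
  exact: le_trans (ktj _ jk) ktT.
have gUN j : (j <= k)%N -> seminorm a (gU j) <= N.
  case: j => [_|j jk]; last by have [] := AP j.+1 jk; move=> _ [].
  by have [|_ []] := AP 1%N; rewrite ?k1.
pose z j := u j - U j; pose gz j := gu j - gU j.
pose A j := a (gz j) (gz j); pose D j := d (z j - z j.-1) (z j - z j.-1) / tau ^+ 2.
pose b j := a (gu j) (gu j) - 2 * d (l j) (z j); pose s j := al j + be j * b j.
pose E j := D j + s j / 2 * (A j + A j.-1) + be j / 4 * (A j ^+ 2 + A j.-1 ^+ 2).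
have D0 j : 0 <= D j by rewrite divr_ge0 ?(dot_ge0 hd) // ltW.
have A0 j : 0 <= A j by exact: dot_ge0.
have gzQ j : (j <= k)%N -> seminorm a (gz j) <= Q.
  move=> jk; apply: le_trans (seminormB ha _ _) _.
  by rewrite addrC lerD ?gUN // (gu_bound H) // jn.
have AQ j : (j <= k)%N -> 0 <= A j <= Q ^+ 2.
  move=> jk; rewrite A0 /= /A -(sqr_seminorm ha); apply: sqr_le_bound; last exact: gzQ.
  exact: seminorm_ge0.
have dz j : (1 <= j <= k)%N -> seminorm d (z j - z j.-1) <= Q * tau.
  move=> /andP[j1 jk].
  have -> : z j - z j.-1 = (u j - u j.-1) - (U j - U j.-1).
    by rewrite /z !opprB addrACA [RHS]addrACA [- U j + _]addrC.
  apply: le_trans (seminormB hd _ _) _; rewrite mulrDl addrC lerD //.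
    by have [|] := AP j; rewrite ?j1.
  by move: (u_lip H (k := j.-1)); rewrite prednK //; apply; exact: jn.
have zQ j : (j <= k)%N -> seminorm d (z j) <= Q * (k%:R * tau).
  move=> jk; apply: le_trans (seminorm_steps (init_z0 H) dz jk) _.
  by rewrite mulrCA ler_wpM2l // ktj.
have zQ1 j : (j <= k)%N -> seminorm d (z j) <= Q.
  by move=> jk; apply: le_trans (zQ _ jk) _; rewrite ler_piMr.
have lz j x : (j <= k)%N -> `|d (l j) x| <= M * seminorm d x.
  move=> jk; apply: le_trans (dot_le hd _ _) _; apply: ler_wpM2r; first exact: seminorm_ge0.
  exact: (l_bound H (jn _ jk)).
have gu0 j : (j <= k)%N -> 0 <= a (gu j) (gu j) <= M ^+ 2.
  move=> jk; rewrite (dot_ge0 ha) /= -(sqr_seminorm ha); apply: sqr_le_bound.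
    exact: seminorm_ge0.
  exact: (gu_bound H (jn _ jk)).
have bN j : (j <= k)%N -> `|b j| <= N6.
  move=> jk; apply: le_trans (ler_normB _ _) _; rewrite lerD //.
    by have /andP[h0 h1] := gu0 j jk; rewrite ger0_norm.
  rewrite normrM ger0_norm // ler_wpM2l //; apply: le_trans (lz _ _ jk) _.
  by rewrite ler_wpM2l // zQ1.
have be0 j : (j <= k)%N -> 0 <= be j <= M.
  by move=> jk; have /andP[h1 h2] := be_bound H (jn _ jk); rewrite h2 andbT (le_trans (ltW c0)).
(* On a short interval [z] is small, hence the coefficient of [A] stays positive. *)
have sc j : (j <= k)%N -> c / 2 <= s j.
  move=> jk; have /andP[h1 _] := al_bound H (jn _ jk); have /andP[h2 h3] := be0 j jk.
  have h4 : - (2 * (M * (Q * (k%:R * tau)))) <= b j.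
    have /andP[h4 _] := gu0 j jk.
    have := ler_norm (d (l j) (z j)); have := lz _ (z j) jk.
    have : M * seminorm d (z j) <= M * (Q * (k%:R * tau)) by rewrite ler_wpM2l ?zQ.
    rewrite /b; lra.
  have h5 : 4 * (M ^+ 2 * Q) * (k%:R * tau) <= c.
    move: ktc; rewrite ler_pdivlMr; last by rewrite ltr_wpDl //; nonneg.
    by have : 0 <= k%:R * tau by [nonneg]; lra.
  have h6 : be j * - (2 * (M * (Q * (k%:R * tau)))) <= be j * b j by rewrite ler_wpM2l.
  have h7 : be j * (2 * (M * (Q * (k%:R * tau)))) <= M * (2 * (M * (Q * (k%:R * tau)))).
    by rewrite ler_wpM2r //; nonneg.
  by rewrite /s; lra.
have bstep j : (j < k)%N -> `|b j.+1 - b j| <= N5 * tau.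
  move=> jk.
  have -> : b j.+1 - b j = (a (gu j.+1) (gu j.+1) - a (gu j) (gu j)) -
     2 * (d (l j.+1 - l j) (z j.+1) + d (l j) (z j.+1 - z j)).
    by rewrite /b !(dotBl hd, dotBr hd); ring.
  apply: le_trans (ler_normB _ _) _.
  have h1 := gu_lip H (jn _ jk).
  have h2 : `|d (l j.+1 - l j) (z j.+1)| <= M * tau * Q.
    apply: le_trans (dot_le hd _ _) _; apply: ler_pM; try exact: seminorm_ge0.
      exact: (l_lip H (jn _ jk)).
    exact: zQ1.
  have h3 : `|d (l j) (z j.+1 - z j)| <= M * (Q * tau).
    by apply: le_trans (lz _ _ (ltnW jk)) _; rewrite ler_wpM2l // (dz j.+1).
  rewrite normrM (ger0_norm (_ : 0 <= 2)) //.
  by have := ler_normD (d (l j.+1 - l j) (z j.+1)) (d (l j) (z j.+1 - z j)); rewrite /N5; lra.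
have sstep j : (j < k)%N -> `|s j.+1 - s j| <= N7 * tau.
  move=> jk.
  have -> : s j.+1 - s j = (al j.+1 - al j) + ((be j.+1 - be j) * b j.+1 + be j * (b j.+1 - b j)).
    by rewrite /s; ring.
  apply: le_trans (ler_normD _ _) _; rewrite /N7 -(addrA M) [leRHS]mulrDl.
  apply: lerD; first exact: (al_lip H (jn _ jk)).
  apply: le_trans (ler_normD _ _) _; rewrite [leRHS]mulrDl !normrM; apply: lerD.
    by rewrite mulrAC ler_pM // ?(be_lip H (jn _ jk)) // bN.
  have /andP[h1 h2] := be0 j (ltnW jk).
  by rewrite -mulrA ler_pM // ?bstep // ger0_norm.
have EE j : (1 <= j <= k)%N -> D j + c / 4 * (A j + A j.-1) <= E j.
  move=> /andP[j1 jk]; have h := sc j jk; have /andP[h2 _] := be0 j jk.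
  rewrite /E -[leLHS]addr0; apply: lerD; last by nonneg.
  rewrite lerD2l; apply: ler_wpM2r; [by nonneg|lra].
have E0 j : (1 <= j <= k)%N -> 0 <= E j.
  by move=> jk; apply: le_trans (EE j jk); nonneg.
have E1 : E 1%N <= C1 * tau ^+ 4.
  have a0 : A 0%N = 0 by rewrite /A -(sqr_seminorm ha) (init_gz0 H) expr0n.
  have a1 : A 1%N <= M ^+ 2 * tau ^+ 4.
    have -> : M ^+ 2 * tau ^+ 4 = (M * tau ^+ 2) ^+ 2 by ring.
    rewrite /A -(sqr_seminorm ha); apply: sqr_le_bound (init_gz1 H); exact: seminorm_ge0.
  have d1 : D 1%N <= M ^+ 2 * tau ^+ 4.
    rewrite /D ler_pdivrMr //.
    have -> : M ^+ 2 * tau ^+ 4 * tau ^+ 2 = (M * tau ^+ 3) ^+ 2 by ring.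
    rewrite -(sqr_seminorm hd); apply: sqr_le_bound; first exact: seminorm_ge0.
    apply: le_trans (seminormB hd _ _) _; rewrite (init_z0 H) addr0; exact: (init_z1 H).
  have /andP[_ a1Q] := AQ 1%N k1.
  have /andP[h1 h2] := be0 1%N k1; have h3 := sc 1%N k1; have := bN 1%N k1.
  have /andP[_ h4] := al_bound H (jn _ k1) => h5.
  have h6 : s 1%N <= M + M * N6 by rewrite /s lerD // norm_mul_le // ger0_norm.
  have h7 : s 1%N / 2 * A 1%N <= (M + M * N6) / 2 * (M ^+ 2 * tau ^+ 4).
    by apply: ler_pM => //; lra.
  have h8 : be 1%N / 4 * A 1%N ^+ 2 <= M / 4 * (Q ^+ 2 * (M ^+ 2 * tau ^+ 4)).
    by apply: ler_pM; [lra|exact: sqr_ge0|lra|rewrite expr2 ler_pM].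
  rewrite /E /= a0 expr0n !addr0 /C1; lra.
have step j : (1 <= j < k)%N ->
    (E j.+1 + tau ^+ 4) - (E j + tau ^+ 4) <= K * tau * ((E j.+1 + tau ^+ 4) + (E j + tau ^+ 4)).
  move=> /andP[j1 jk].
  have jk' := ltnW jk; have jp := pk _ jk'; have jj : (j.-1.+1 = j)%N by rewrite prednK.
  have jn' : (1 <= j < n)%N by rewrite j1 (leq_trans jk).
  pose h := z j.+1 - z j.-1.
  pose L := l j.+1 + l j.-1.
  pose q := scheme_coef al be gU j; pose q' := scheme_coef al be gu j.
  pose r := d (u j.+1 - 2 *: u j + u j.-1) h + tau ^+ 2 / 2 * (q' * d L h) - tau ^+ 2 * d (f j) h.
  pose X := r / tau ^+ 2 + (q - q') / 2 * d L h.
  have t0' := lt0r_neq0 t0.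
  have bal : D j.+1 - D j + q / 2 * (A j.+1 - A j.-1) = X.
    apply: (test_scheme hd ha t0').
    have -> : z j.+1 - 2 *: z j + z j.-1 =
        (u j.+1 - 2 *: u j + u j.-1) - (U j.+1 - 2 *: U j + U j.-1).
      by rewrite /z scalerBr !opprD [RHS]addrACA; congr (_ + _); rewrite [RHS]addrACA.
    have -> : d (u j.+1 - 2 *: u j + u j.-1 - (U j.+1 - 2 *: U j + U j.-1)) (z j.+1 - z j.-1) =
        r - tau ^+ 2 / 2 * (q' * d L h) + tau ^+ 2 * d (f j) h - d (U j.+1 - 2 *: U j + U j.-1) h.
      by rewrite (dotBl hd) /r; ring.
    have -> : a (gz j.+1 + gz j.-1) (gz j.+1 - gz j.-1) =
        d L h - a (gU j.+1 + gU j.-1) (gz j.+1 - gz j.-1).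
      have G i m : (i <= k)%N -> (m <= k)%N -> d (l i) (z m) = a (gu i) (gz m).
        by move=> ik mk; rewrite (green H) // jn.
      rewrite /L /h (dotDl hd) !(dotBr hd (z j.+1) (z j.-1)) !G //.
      have -> : gz j.+1 + gz j.-1 = (gu j.+1 + gu j.-1) - (gU j.+1 + gU j.-1).
        by rewrite /gz opprD addrACA.
      rewrite (dotBl ha (gu j.+1 + gu j.-1)) (dotDl ha (gu j.+1)) !(dotBr ha (gz j.+1) (gz j.-1)); ring.
    have -> : d (U j.+1 - 2 *: U j + U j.-1) h = tau ^+ 2 * d (f j) h -
        tau ^+ 2 / 2 * (q * a (gU j.+1 + gU j.-1) (gz j.+1 - gz j.-1)).
      have jn1 := jn _ jk; have jn0 := jn _ jp.
      have e1 := scheme_u H jn' jn1; have e2 := scheme_u H jn' jn0.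
      have e3 := scheme_U H jn' jn1; have e4 := scheme_U H jn' jn0.
      have S x : d x h = d x (u j.+1) - d x (U j.+1) - (d x (u j.-1) - d x (U j.-1)).
        by rewrite /h /z !(dotBr hd).
      have T x : a x (gz j.+1 - gz j.-1) = a x (gu j.+1) - a x (gU j.+1) - (a x (gu j.-1) - a x (gU j.-1)).
        by rewrite /gz !(dotBr ha).
      have -> : tau ^+ 2 * d (f j) h = tau ^+ 2 * d (f j) (u j.+1) - tau ^+ 2 * d (f j) (U j.+1) -
          (tau ^+ 2 * d (f j) (u j.-1) - tau ^+ 2 * d (f j) (U j.-1)) by rewrite S; ring.
      by rewrite -e1 -e2 -e3 -e4 S T -/q; ring.
    by rewrite /X; field.
  have qE : q = al j + be j / 2 * ((b j.+1 + A j.+1) + (b j.-1 + A j.-1)).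
    have G i : (i <= k)%N -> a (gU i) (gU i) = b i + A i.
      move=> ik; rewrite /b -(green H (jn _ ik) (jn _ ik)) -/(gz i).
      rewrite -{1 2}[gU i](subKr (gu i)) -/(gz i) /A.
      rewrite !(dotBl ha (gu i) (gz i)) !(dotBr ha (gu i) (gz i)) (dotC ha (gz i) (gu i)); ring.
    by rewrite /q /scheme_coef !G.
  have EB := energy_balance (A j) (be j.+1) (s j.+1) qE (erefl (s j)) bal.
  have hh : seminorm d h <= (Num.sqrt (D j.+1) + Num.sqrt (D j)) * tau.
    have -> : h = (z j.+1 - z j) + (z j - z j.-1) by rewrite /h subrKA.
    by apply: le_trans (seminormD hd _ _) _; rewrite !(@seminorm_rate tau) // mulrDl.
  have aA i : seminorm a (gz i) = Num.sqrt (A i) by [].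
  have qq : `|q - q'| <= M / 2 * Q * (Num.sqrt (A j.+1) + Num.sqrt (A j.-1)).
    have G i : (i <= k)%N -> `|a (gU i) (gU i) - a (gu i) (gu i)| <= Num.sqrt (A i) * Q.
      move=> ik.
      have -> : a (gU i) (gU i) - a (gu i) (gu i) = - a (gz i) (gU i + gu i).
        by rewrite /gz (dotBl ha (gu i)) !(dotDr ha (gU i)) (dotC ha (gU i) (gu i)); ring.
      rewrite normrN; apply: le_trans (dot_le ha _ _) _; rewrite aA ler_wpM2l ?sqrtr_ge0 //.
      by apply: le_trans (seminormD ha _ _) _; rewrite lerD ?gUN // (gu_bound H) // jn.
    have /andP[h1 h2] := be0 j jk'.
    have -> : q - q' = be j / 2 * ((a (gU j.+1) (gU j.+1) - a (gu j.+1) (gu j.+1)) +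
        (a (gU j.-1) (gU j.-1) - a (gu j.-1) (gu j.-1))).
      by rewrite /q /q' /scheme_coef; ring.
    rewrite normrM -mulrA; apply: ler_pM => //.
      by rewrite ger0_norm ?divr_ge0 // ler_wpM2r.
    apply: le_trans (ler_normD _ _) _.
    by have := G _ jk; have := G _ jp; lra.
  have Lh : `|d L h| <= 2 * M * seminorm d h.
    rewrite /L (dotDl hd); apply: le_trans (ler_normD _ _) _.
    by have := lz _ h jk; have := lz _ h jp; lra.
  have rr : `|r / tau ^+ 2| <= M * tau ^+ 2 * seminorm d h.
    rewrite normrM normfV (gtr0_norm t20) ler_pdivrMr //.
    have -> : M * tau ^+ 2 * seminorm d h * tau ^+ 2 = M * tau ^+ 4 * seminorm d h by ring.
    exact: (residual H h jn').
  have Xle : X <= tau * (M * (tau ^+ 4 + (D j.+1 + D j) / 2) +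
      M ^+ 2 * Q / 2 * (A j.+1 + A j.-1 + D j.+1 + D j)).
    have X1 : X <= (M * tau ^+ 2 + M * (M / 2 * Q * (Num.sqrt (A j.+1) + Num.sqrt (A j.-1)))) * seminorm d h.
      rewrite /X [leRHS]mulrDl; apply: lerD; first exact: le_trans (ler_norm _) rr.
      have -> : M * (M / 2 * Q * (Num.sqrt (A j.+1) + Num.sqrt (A j.-1))) * seminorm d h =
        M / 2 * Q * (Num.sqrt (A j.+1) + Num.sqrt (A j.-1)) / 2 * (2 * M * seminorm d h) by field.
      apply: norm_mul_le Lh.
      by rewrite normrM (ger0_norm (_ : 0 <= 2^-1)) ?invr_ge0 // ler_wpM2r ?invr_ge0.
    apply: le_trans X1 _; set w := (X in X * _ <= _).
    have w0 : 0 <= w by rewrite /w; nonneg.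
    apply: le_trans (ler_wpM2l w0 hh) _; rewrite mulrA mulrC ler_pM2l // /w.
    have -> : tau ^+ 4 = (tau ^+ 2) ^+ 2 by ring.
    move: (sqr_sqrtr (A0 j.+1)) (sqr_sqrtr (A0 j.-1)) (sqr_sqrtr (D0 j.+1)) (sqr_sqrtr (D0 j)).
    move: (Num.sqrt (A j.+1)) (Num.sqrt (A j.-1)) (Num.sqrt (D j.+1)) (Num.sqrt (D j)).
    move: (tau ^+ 2) => t A2 A1 e2 e1 <- <- <- <-.
    rewrite [leLHS]mulrDl; apply: lerD.
      rewrite -mulrA ler_wpM2l //; have := sqr_ge0 (t - e2); have := sqr_ge0 (t - e1).
      by rewrite !sqrrB; lra.
    have -> : M * (M / 2 * Q * (A2 + A1)) * (e2 + e1) = M ^+ 2 * Q / 2 * ((A2 + A1) * (e2 + e1)) by ring.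
    apply: ler_wpM2l; first by nonneg.
    have := sqr_ge0 (A2 - e2); have := sqr_ge0 (A2 - e1); have := sqr_ge0 (A1 - e2).
    have := sqr_ge0 (A1 - e1); rewrite !sqrrB; lra.
  have t40 : 0 <= tau ^+ 4 by rewrite exprn_ge0 // ltW.
  have jj1 : `|b j - b j.-1| <= N5 * tau by rewrite -{1}jj; apply: bstep; rewrite jj.
  have := energy_growth M0 N50 N70 (ltW t0) t40 (D0 j.+1) (D0 j) (AQ _ jk) (AQ _ jk') (A0 j.-1)
    Q0 (be0 j jk') (bstep _ jk) jj1 (be_lip H (jn _ jk)) (sstep _ jk) Xle.
  rewrite -EB -/(E j.+1) -/(E j) => EE1.
  have e1 := EE j.+1 jk; have e0 : D j + c / 4 * (A j + A j.-1) <= E j by apply: EE; rewrite j1.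
  rewrite /= in e1.
  have -> : E j.+1 + tau ^+ 4 - (E j + tau ^+ 4) = E j.+1 - E j by ring.
  apply: le_trans EE1 _.
  set K2 := M + _ + _ + _ + _.
  have K20 : 0 <= K2 by rewrite /K2; nonneg.
  have : (D j.+1 + D j + (A j.+1 + A j + A j.-1) + tau ^+ 4) <=
      (1 + 4 / c) * (E j.+1 + tau ^+ 4 + (E j + tau ^+ 4)).
    rewrite [leRHS]mulrDl mul1r.
    have h1 : A j.+1 + A j + A j.-1 <= 4 / c * (E j.+1 + tau ^+ 4 + (E j + tau ^+ 4)).
      rewrite [leRHS]mulrAC ler_pdivlMr //.
      have := D0 j.+1; have := D0 j; have := mulr_ge0 (ltW c0) (A0 j).
      have := mulr_ge0 (ltW c0) (A0 j.+1); have := mulr_ge0 (ltW c0) (A0 j.-1); lra.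
    have := A0 j.+1; have := A0 j; have := A0 j.-1; move=> *.
    have : 0 <= c / 4 * (A j.+1 + A j) by nonneg.
    have : 0 <= c / 4 * (A j + A j.-1) by nonneg.
    lra.
  move=> SS; apply: (@le_trans _ _ (tau * K2 * ((1 + 4 / c) * (E j.+1 + tau ^+ 4 + (E j + tau ^+ 4))))).
    by apply: ler_wpM2l SS; nonneg.
  have -> : tau * K2 * ((1 + 4 / c) * (E j.+1 + tau ^+ 4 + (E j + tau ^+ 4))) =
     (K - 1) * tau * (E j.+1 + tau ^+ 4 + (E j + tau ^+ 4)) by rewrite /K -/K2; ring.
  have Ep : 0 <= tau * (E j.+1 + tau ^+ 4 + (E j + tau ^+ 4)).
    have h1 := E0 j.+1 jk; have h2 : 0 <= E j by apply: E0; rewrite j1.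
    by nonneg.
  rewrite -!mulrA; lra.
have Ek j : (1 <= j <= k)%N -> E j <= 2 * (C1 + 1) * tau ^+ 4.
  move=> jk.
  have h1 : 0 <= K * tau by nonneg.
  have h2 i : (1 <= i <= k)%N -> 0 <= E i + tau ^+ 4.
    by move=> ik; rewrite addr_ge0 ?E0 // exprn_ge0 // ltW.
  have h3 : 4 * (K * tau) * k%:R <= 1.
    by move: ktK; rewrite ler_pdivlMr ?mulr_gt0 //; lra.
  have := gronwall_short h1 h2 h3 step jk.
  have : 0 <= tau ^+ 4 by rewrite exprn_ge0 // ltW.
  move: E1; lra.
have dzk j : (1 <= j <= k)%N -> seminorm d (z j - z j.-1) <= Num.sqrt (2 * (C1 + 1)) * tau ^+ 3.
  move=> jk; rewrite (@seminorm_rate tau) // [in leRHS]exprSr mulrA ler_pM2r //.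
  have -> : Num.sqrt (2 * (C1 + 1)) * tau ^+ 2 = Num.sqrt (2 * (C1 + 1) * tau ^+ 4).
    rewrite (_ : tau ^+ 4 = (tau ^+ 2) ^+ 2); last by ring.
    rewrite [RHS]sqrtrM; last by nonneg.
    by rewrite sqrtr_sqr ger0_norm ?sqr_ge0.
  have DE : D j <= E j by apply: le_trans (EE j jk); rewrite lerDl; nonneg.
  exact: ler_wsqrtr (le_trans DE (Ek j jk)).
apply: le_trans (seminorm_steps (init_z0 H) dzk (leqnn k)) _.
have -> : k%:R * (Num.sqrt (2 * (C1 + 1)) * tau ^+ 3) =
  (k%:R * tau) * (Num.sqrt (2 * (C1 + 1)) * tau ^+ 2) by ring.
by rewrite ler_piMl //; nonneg.
Qed.
End AbstractScheme.
(** * The plane and its square-integrable functions *)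

(** The product measure lives on the product of two copies of [measurableTypeR R]: the
    same measurable sets as those of [R * R], but under another display. *)
Notation mplane R := (measurableTypeR R * measurableTypeR R)%type.

Definition mu2 {R : realType} : {measure set (mplane R) -> \bar R} :=
  (@lebesgue_measure R \x @lebesgue_measure R)%E.

(** The boxes with rational corners form a countable base of the topology. *)
Lemma open_measurable_plane (R : realType) (A : set (R * R)) :
  open A -> measurable A.
Proof.
move=> oA.
pose box (q : rat * rat * rat * rat) : set (R * R) :=
  `]ratr q.1.1.1 : R, ratr q.1.1.2[%classic `*` `]ratr q.1.2 : R, ratr q.2[%classic.
pose F q := if `[< box q `<=` A >] then box q else set0.
have -> : A = \bigcup_q F q.
  apply/seteqP; split => [[x y] Axy|z [q _]]; last first.
    by rewrite /F; case: asboolP => // + zq; apply.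
  move/open_nbhs_nbhs/nbhs_ballP : (conj oA Axy) => [e /= e0 eA].
  have lt1 (c : R) : c - e < c by rewrite ltrBlDr ltrDl.
  have lt2 (c : R) : c < c + e by rewrite ltrDl.
  have [a ha] := rat_in_itvoo (lt1 x); have [b hb] := rat_in_itvoo (lt2 x).
  have [c hc] := rat_in_itvoo (lt1 y); have [d hd] := rat_in_itvoo (lt2 y).
  move: ha hb hc hd; rewrite !in_itv /= => /andP[a1 a2] /andP[b1 b2] /andP[c1 c2] /andP[d1 d2].
  have inb : box (a, b, c, d) (x, y).
    by split => /=; rewrite in_itv /= ?a2 ?b1 ?c2 ?d1.
  exists (a, b, c, d) => //; rewrite /F asboolT // => -[s t] [/=].
  rewrite !in_itv /= => /andP[s1 s2] /andP[t1 t2].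
  apply: eA; split; rewrite /ball /= ltr_distlC; apply/andP; split.
  - exact: lt_trans s1. - exact: lt_trans b2.
  - exact: lt_trans t1. - exact: lt_trans d2.
apply: countable_bigcupT_measurable => // q; rewrite /F; case: asboolP => _; last exact: measurable0.
by apply: measurableX; exact: measurable_itv.
Qed.

Lemma continuous_measurable_plane (R : realType) (A : set (R * R)) (g : R * R -> R) :
  open A -> {in A, continuous g} -> measurable_fun A g.
Proof.
move=> oA cg.
apply: (measurability _ (RGenOInfty.measurableE R)) => /= Y [B [x ->]] <-.
apply: open_measurable_plane.
rewrite openE => z [Az]; rewrite /= in_itv /= andbT => xg.
apply: filterI; first exact: (open_nbhs_nbhs (conj oA Az)).
have /cg : z \in A by rewrite inE.
move=> /(_ _ (lt_nbhsr xg)); rewrite /= => H.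
have E : g @^-1` `]x, +oo[%classic = [set t | x < g t].
  by apply/seteqP; split => t /=; rewrite in_itv /= andbT.
by rewrite E.
Qed.

Section SquareIntegrable.
Context {R : realType} {Omega : set (plane R)}.
Hypothesis mO : measurable Omega.
Implicit Types (g h : fld R) (a : R).

Let mO' : measurable (Omega : set (mplane R)) := mO.

Lemma L2_measurable g : L2 Omega g -> measurable_fun (Omega : set (mplane R)) g.
Proof. by case. Qed.

Lemma L2_integrable_sqr g : L2 Omega g ->
  mu2.-integrable (Omega : set (mplane R)) (fun z => (g z ^+ 2)%:E).
Proof. by case. Qed.

Lemma L2_integrableM g h : L2 Omega g -> L2 Omega h ->
  mu2.-integrable (Omega : set (mplane R)) (EFin \o (fun z => g z * h z)).
Proof.
move=> Lg Lh; have mg := L2_measurable Lg; have mh := L2_measurable Lh.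
apply: (@le_integrable _ _ _ _ _ mO' _ ((fun z => ((g z)^+2)%:E) \+ (fun z => ((h z)^+2)%:E))%E).
- by apply/measurable_EFinP; exact: measurable_funM.
- move=> z _ /=; rewrite lee_fin normrM.
  rewrite [leRHS]ger0_norm ?addr_ge0 ?sqr_ge0//.
  rewrite -(real_normK (num_real (g z))) -(real_normK (num_real (h z))).
  have := sqr_ge0 (`|g z| - `|h z|); have := sqr_ge0 (`|g z| + `|h z|); lra.
- by apply: integrableD => //; exact: L2_integrable_sqr.
Qed.

Lemma L2_linear a g h : L2 Omega g -> L2 Omega h -> L2 Omega (a *: g + h).
Proof.
move=> Lg Lh; have [mg ig] := Lg; have [mh ih] := Lh; split.
  by apply: measurable_funD => //; apply: measurable_funM.
have e : (fun z => (((a *: g + h) z) ^+ 2)%:E) =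
  ((fun z => (a^+2)%:E * ((g z)^+2)%:E) \+ ((fun z => (2*a)%:E * (g z * h z)%:E) \+
   (fun z => ((h z)^+2)%:E)))%E.
  apply/funext => z /=; rewrite -!EFinM -!EFinD; congr EFin.
  by have -> : (a *: g + h) z = a * g z + h z by []; ring.
suff : mu2.-integrable (Omega : set (mplane R)) (fun z => (((a *: g + h) z) ^+ 2)%:E) by [].
rewrite e; apply: integrableD => //.
  by apply: integrableZl => //; exact: (L2_integrable_sqr Lg).
apply: integrableD => //.
by apply: integrableZl => //; exact: (L2_integrableM Lg Lh).
Qed.

Lemma L2_0 : L2 Omega 0.
Proof.
split; first exact: measurable_cst.
suff : mu2.-integrable (Omega : set (mplane R)) (cst 0%E).
  by congr (_.-integrable _ _); apply/funext => z; rewrite expr0n.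
exact: integrable0.
Qed.

Lemma ip_linear a g h k : L2 Omega g -> L2 Omega h -> L2 Omega k ->
  ip Omega (a *: g + h) k = a * ip Omega g k + ip Omega h k.
Proof.
move=> Lg Lh Lk.
have I1 := L2_integrableM Lg Lk; have I2 := L2_integrableM Lh Lk.
have I3 : mu2.-integrable (Omega : set (mplane R)) (EFin \o (fun z => a * (g z * k z))).
  by apply: (integrableZl mO' a) I1.
have E1 : ip Omega g k = \int[mu2]_(z in Omega) (g z * k z) by [].
have E2 : ip Omega h k = \int[mu2]_(z in Omega) (h z * k z) by [].
have E3 : ip Omega (a *: g + h) k = \int[mu2]_(z in Omega) ((a * g z + h z) * k z) by [].
rewrite E1 E2 E3 -RintegralZl // -RintegralD //.
by apply: eq_Rintegral => z _; rewrite mulrDl mulrA.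
Qed.

Lemma ip_sym g h : ip Omega g h = ip Omega h g.
Proof. by apply: eq_Rintegral => z _; rewrite mulrC. Qed.

Lemma ip_ge0 g : 0 <= ip Omega g g.
Proof. by apply: Rintegral_ge0 => z _; rewrite -expr2 sqr_ge0. Qed.

Lemma ip_eqO g g' h : L2 Omega g -> L2 Omega g' -> L2 Omega h -> eqO Omega g g' ->
  ip Omega g h = ip Omega g' h.
Proof.
move=> Lg Lg' Lh gg'; rewrite /ip /Rintegral; congr fine.
have me k : L2 Omega k -> measurable_fun (Omega : set (mplane R)) (fun z => (k z * h z)%:E).
  by move=> Lk; apply/measurable_EFinP; apply: measurable_funM; exact: L2_measurable.
apply: (@ae_eq_integral _ _ _ (mu2 : {measure set (mplane R) -> \bar R})) => //; try exact: me.
have : ae_eq mu2 (Omega : set (mplane R)) g g' by [].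
by apply: filterS => z /= E /E ->.
Qed.

Lemma L2_eqO g g' : measurable_fun Omega g -> L2 Omega g' -> eqO Omega g g' -> L2 Omega g.
Proof.
move=> mg Lg' gg'; split => //.
have I := L2_integrable_sqr Lg'.
have mg' : measurable_fun (Omega : set (mplane R)) g by [].
suff : mu2.-integrable (Omega : set (mplane R)) (fun z => (g z ^+ 2)%:E) by [].
have mE : measurable_fun (Omega : set (mplane R)) (fun z => (g z ^+ 2)%:E).
  by apply/measurable_EFinP; exact: measurable_funX.
apply/integrableP; split => //; move/integrableP : I => [mI].
rewrite (@ae_eq_integral _ _ _ mu2 (Omega : set (mplane R)) (fun z => `|(g z ^+ 2)%:E|%E)) //.
- exact: measurableT_comp.
- exact: measurableT_comp.
- have : ae_eq mu2 (Omega : set (mplane R)) g g' by [].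
  by apply: filterS => z /= E /E ->.
Qed.

Definition L2pred (_ : measurable Omega) : {pred fld R} := [pred g | `[< L2 Omega g >]].

Lemma L2_submod : GRing.submod_closed (L2pred mO).
Proof.
split; first by apply/asboolP; exact: L2_0.
by move=> a g h /asboolP Lg /asboolP Lh; apply/asboolP; exact: L2_linear.
Qed.

HB.instance Definition _ := GRing.isSubmodClosed.Build R (fld R) (L2pred mO) L2_submod.

Record L2space := L2Space { L2val :> fld R ; _ : L2val \in L2pred mO }.

HB.instance Definition _ := [isSub for L2val].
HB.instance Definition _ := [Choice of L2space by <:].
HB.instance Definition _ := [SubChoice_isSubLmodule of L2space by <:].

End SquareIntegrable.

Lemma eqO_sym {R : realType} (Omega : set (plane R)) (g h : fld R) :
  eqO Omega g h -> eqO Omega h g.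
Proof.
move=> H; have H' : ae_eq mu2 (Omega : set (mplane R)) g h by [].
suff : ae_eq mu2 (Omega : set (mplane R)) h g by [].
by apply: filterS H' => z /= E Oz; rewrite E.
Qed.

Section L2Inner.
Context {R : realType} {Omega : set (plane R)} {mO : measurable Omega}.
Implicit Types g h : fld R.

Definition ipL (x y : L2space mO) : R := ip Omega x y.

Lemma L2spaceP (x : L2space mO) : L2 Omega x.
Proof. by case: x => g h; exact: (asboolW h). Qed.

Lemma ipL_semi_inner : semi_inner ipL.
Proof.
split; first by move=> x y; exact: ip_sym.
- by move=> a x y z; apply: (ip_linear mO); exact: L2spaceP.
- by move=> x; exact: ip_ge0.
Qed.

(** The element of the space with representative [g], and 0 if [g] is not
    square-integrable. *)
Definition toL2 (g : fld R) : L2space mO := insubd 0 g.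

Lemma toL2K g : L2 Omega g -> toL2 g = g :> fld R.
Proof. by move=> Lg; rewrite /toL2 insubdK //; apply/asboolP. Qed.

Lemma ip_toL2 g h : L2 Omega g -> L2 Omega h -> ip Omega g h = ipL (toL2 g) (toL2 h).
Proof. by move=> Lg Lh; rewrite /ipL !toL2K. Qed.

Lemma toL2_linear a g h : L2 Omega g -> L2 Omega h ->
  toL2 (a *: g + h) = a *: toL2 g + toL2 h.
Proof.
move=> Lg Lh; apply/val_inj => /=.
by rewrite (toL2K (L2_linear mO a Lg Lh)) /= !toL2K.
Qed.

Lemma L2D g h : L2 Omega g -> L2 Omega h -> L2 Omega (fun z => g z + h z).
Proof. by move=> Lg Lh; have := L2_linear mO 1 Lg Lh; rewrite scale1r. Qed.

Lemma L2Z a g : L2 Omega g -> L2 Omega (fun z => a * g z).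
Proof. by move=> Lg; have := L2_linear mO a Lg L2_0; rewrite addr0. Qed.

Lemma toL2D g h : L2 Omega g -> L2 Omega h -> toL2 (fun z => g z + h z) = toL2 g + toL2 h.
Proof. by move=> Lg Lh; rewrite -[RHS](congr1 (+%R^~ _) (scale1r _)) -toL2_linear // scale1r. Qed.

Lemma toL2Z a g : L2 Omega g -> toL2 (fun z => a * g z) = a *: toL2 g.
Proof.
move=> Lg; have := toL2_linear a Lg L2_0; rewrite addr0 => ->.
by rewrite (_ : toL2 0 = 0) ?addr0 //; apply/val_inj; rewrite /= toL2K //; exact: L2_0.
Qed.

Lemma toL2B g h : L2 Omega g -> L2 Omega h -> toL2 (fun z => g z - h z) = toL2 g - toL2 h.
Proof.
move=> Lg Lh; rewrite addrC -scaleN1r -toL2_linear //; congr toL2.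
by apply/funext => z; rewrite [RHS]/((-1) * h z + g z) mulN1r addrC.
Qed.

Lemma L2B g h : L2 Omega g -> L2 Omega h -> L2 Omega (fun z => g z - h z).
Proof.
move=> Lg Lh; have := L2_linear mO (-1) Lh Lg; congr L2.
by apply/funext => z; rewrite [LHS]/((-1) * h z + g z) mulN1r addrC.
Qed.

Lemma L2norm_toL2B g h : L2 Omega g -> L2 Omega h ->
  L2norm Omega (fun z => g z - h z) = seminorm ipL (toL2 g - toL2 h).
Proof. by move=> Lg Lh; rewrite -toL2B // /seminorm /ipL toL2K //; exact: L2B. Qed.

Lemma toL2_eqO g g' (w : L2space mO) : L2 Omega g -> L2 Omega g' -> eqO Omega g g' ->
  ipL (toL2 g) w = ipL (toL2 g') w.
Proof. by move=> Lg Lg' E; rewrite /ipL !toL2K //; apply: ip_eqO => //; exact: L2spaceP. Qed.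

End L2Inner.
(** * Integration by parts against test functions *)

Lemma integral_derive_line (R : realType) (F f : R -> R) (M : R) : 0 < M ->
  (forall x : R, is_derive x (1 : R) F (f x)) -> continuous f ->
  (forall x, M <= `|x| -> F x = 0) -> (forall x, M <= `|x| -> f x = 0) ->
  (\int[lebesgue_measure]_x (f x)%:E = 0)%E.
Proof.
move=> M0 dF cf F0 f0.
have cF : continuous F.
  move=> x; apply: differentiable_continuous; apply/derivable1_diffP; exact: ex_derive.
have -> : (fun x => (f x)%:E) = (fun x => (f x)%:E) \_ `[- M, M]%classic.
  apply/funext => x; rewrite patchE; case: ifPn => // /negP; rewrite in_setE /= => xM.
  rewrite f0 // ltW // ltNge; apply/negP => h; apply: xM.
  by rewrite in_itv /= -ler_norml.
rewrite -integral_mkcond.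
have -> : (\int[lebesgue_measure]_(x in `[(- M)%R, M]) (f x)%:E = (F M - F (- M))%R%:E)%E.
  rewrite EFinB; apply: continuous_FTC2; first by rewrite gtrN.
  - exact: continuous_subspaceT.
  - split.
    + by move=> x _; exact: ex_derive.
    + exact/cvg_at_right_filter/cF.
    + exact/cvg_at_left_filter/cF.
  - by move=> x _; rewrite derive1E derive_val.
by rewrite !F0 ?normrN ?(gtr0_norm M0) // subrr.
Qed.

Section Plane.
Context {R : realType}.
Implicit Types (K O : set (plane R)) (g F G phi : fld R) (e z : plane R).

Lemma compact_plane_closed K : compact K -> closed K.
Proof. by apply: compact_closed; exact: norm_hausdorff. Qed.

Lemma near_out_compact K z : compact K -> ~ K z -> \near z, ~ K z.
Proof.
move=> cK Kz; apply: open_nbhs_nbhs; split => //.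
by rewrite openC; exact: compact_plane_closed.
Qed.

Lemma compact_in_box K : compact K ->
  exists2 M : R, 0 < M & forall z, K z -> `|z.1| < M /\ `|z.2| < M.
Proof.
move=> /compact_bounded [B [_ hB]]; exists (`|B| + 2); first by rewrite ltr_wpDl.
move=> z /(hB (`|B| + 1)) h.
have : `|z| <= `|B| + 1 by apply: h; rewrite ltr_pwDr // ler_norm.
rewrite prod_normE ge_max => /andP[h1 h2].
by split; [apply: le_lt_trans h1 _|apply: le_lt_trans h2 _]; rewrite ltrD2l ltr1n.
Qed.

Lemma compact_support_integrable K G : compact K -> continuous G ->
  (forall z, ~ K z -> G z = 0) -> mu2.-integrable [set: mplane R] (EFin \o G).
Proof.
move=> cK cG G0; have [M M0 KM] := compact_in_box cK.
pose B : set (mplane R) := (`[- M, M]%classic : set (measurableTypeR R)) `*` `[- M, M]%classic.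
have mI : measurable (`[- M, M]%classic : set (measurableTypeR R)) by exact: measurable_itv.
have mB : measurable B by exact: measurableX.
have mG : measurable_fun [set: plane R] G.
  by apply: continuous_measurable_plane; [exact: openT|move=> z _; exact: cG].
have -> : EFin \o G = (EFin \o G) \_ B.
  apply/funext => z; rewrite patchE; case: ifPn => //= /negP zB.
  rewrite G0 // => Kz; apply: zB; rewrite inE; have [h1 h2] := KM _ Kz.
  by split => /=; rewrite in_itv /= -ler_norml ltW.
apply/(integrable_mkcond _ mB); apply: measurable_bounded_integrable => //.
- rewrite [X in (X < _)%E](product_measure1E lebesgue_measure lebesgue_measure mI mI).
  have E : lebesgue_measure (`[- M, M]%classic : set R) = (M - - M)%:E.
    by rewrite lebesgue_measure_itv /= lte_fin gtrN.
  suff : (lebesgue_measure (`[(- M)%R, M]%classic : set R) *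
          lebesgue_measure (`[(- M)%R, M]%classic : set R) < +oo)%E by [].
  by rewrite E -EFinM ltry.
- exact: (@measurable_funS _ _ _ _ setT).
- have /compact_bounded [b [br hb]] : compact (G @` K).
    by apply: continuous_compact => //; exact: continuous_subspaceT.
  exists `|b|; split; first exact: num_real.
  move=> x bx z _ /=; have [Kz|Kz] := pselect (K z).
    by apply: (hb x); [exact: le_lt_trans (ler_norm _) bx|exists z].
  by rewrite G0 // normr0 ltW // (le_lt_trans _ bx).
Qed.

Lemma is_derive_slice1 F (x y : R) : derivable F (x, y) ex ->
  is_derive (x : R) (1 : R) (fun s => F (s, y)) (partial ex F (x, y)).
Proof.
have E : (fun h : R => h^-1 *: ((F \o shift (x, y)) (h *: ex) - F (x, y))) =
    (fun h : R => h^-1 *: (((fun s => F (s, y)) \o shift x) (h *: (1 : R)) - F (x, y))).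
  apply/funext => h; congr (_ *: (F _ - _)).
  by congr pair; rewrite /= scaler0 add0r.
rewrite /partial /derivable /derive E => dF.
exact: DeriveDef dF erefl.
Qed.

Lemma is_derive_slice2 F (x y : R) : derivable F (x, y) ey ->
  is_derive (y : R) (1 : R) (fun s => F (x, s)) (partial ey F (x, y)).
Proof.
have E : (fun h : R => h^-1 *: ((F \o shift (x, y)) (h *: ey) - F (x, y))) =
    (fun h : R => h^-1 *: (((fun s => F (x, s)) \o shift y) (h *: (1 : R)) - F (x, y))).
  apply/funext => h; congr (_ *: (F _ - _)).
  by congr pair; rewrite /= scaler0 add0r.
rewrite /partial /derivable /derive E => dF.
exact: DeriveDef dF erefl.
Qed.

Definition coordinate e := e = ex \/ e = ey.

(** By Fubini's theorem it suffices to integrate along the lines parallel to [e], where the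
    fundamental theorem of calculus applies on a segment that contains the support. *)
Lemma integral_partial e F G K : coordinate e ->
  compact K -> continuous G -> (forall z, derivable F z e) -> (forall z, partial e F z = G z) ->
  (forall z, ~ K z -> F z = 0) -> (forall z, ~ K z -> G z = 0) ->
  (\int[mu2]_z (G z)%:E = 0)%E.
Proof.
move=> he cK cG dF FG F0 G0; have [M M0 KM] := compact_in_box cK.
have I := compact_support_integrable cK cG G0.
have out z : M <= `|z.1| \/ M <= `|z.2| -> ~ K z.
  by move=> [h|h] /KM [h1 h2]; [move: h1|move: h2]; rewrite ltNge h.
have c1 y : continuous (fun s : R => (s, y) : plane R).
  move=> s A [[B C] [/= nB nC] BC]; apply: filterS nB => t Bt.
  by apply: BC; split => //=; exact: nbhs_singleton nC.
have c2 x : continuous (fun s : R => (x, s) : plane R).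
  move=> s A [[B C] [/= nB nC] BC]; apply: filterS nC => t Ct.
  by apply: BC; split => //=; exact: nbhs_singleton nB.
have -> : (\int[mu2]_z (G z)%:E = \int[lebesgue_measure]_x \int[lebesgue_measure]_y (EFin \o G) (x, y))%E.
  by symmetry; exact: (integral12_prod_meas1 I).
case: he => he; rewrite he in dF FG.
- rewrite (Fubini I); apply: (@integral0_eq _ _ _ (@lebesgue_measure R)) => y _.
  apply: (@integral_derive_line _ (fun x => F (x, y)) (fun x => G (x, y)) M) => //.
  + by move=> x; rewrite -FG; exact: is_derive_slice1.
  + by move=> x; apply: (@continuous_comp _ _ _ (fun s : R => (s, y) : plane R) G); [exact: c1|exact: cG].
  + by move=> x h; apply: F0; apply: out; left.
  + by move=> x h; apply: G0; apply: out; left.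
- apply: (@integral0_eq _ _ _ (@lebesgue_measure R)) => x _.
  apply: (@integral_derive_line _ (fun y => F (x, y)) (fun y => G (x, y)) M) => //.
  + by move=> y; rewrite -FG; exact: is_derive_slice2.
  + by move=> y; apply: (@continuous_comp _ _ _ (fun s : R => (x, s) : plane R) G); [exact: c2|exact: cG].
  + by move=> y h; apply: F0; apply: out; right.
  + by move=> y h; apply: G0; apply: out; right.
Qed.

Lemma test_continuous O phi : test_function O phi -> continuous phi.
Proof. by move=> [sm _] z; exact: differentiable_continuous (sm [::] z). Qed.

Lemma test_derivable O phi z e : test_function O phi -> derivable phi z e.
Proof. by move=> [sm _]; exact: diff_derivable (sm [::] z). Qed.

Lemma partial_out_compact K phi z e : compact K -> (forall z, ~ K z -> phi z = 0) -> ~ K z ->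
  partial e phi z = 0.
Proof.
move=> cK p0 Kz; rewrite /partial (@near_eq_derive _ _ _ phi (cst 0)) ?derive_cst //.
by apply: filterS (near_out_compact cK Kz) => t /p0.
Qed.

Lemma test_partial O phi e : test_function O phi -> test_function O (partial e phi).
Proof.
move=> [sm [K [cK KO p0]]]; split.
  by move=> es z; have := sm (rcons es e) z; rewrite foldr_rcons.
by exists K; split => // z; exact: partial_out_compact.
Qed.

(** Outside [K], a closed subset of [O], the product vanishes on a neighbourhood. *)
Lemma continuous_mul_test O g phi K : open O -> {in O, continuous g} -> compact K -> K `<=` O ->
  continuous phi -> (forall z, ~ K z -> phi z = 0) -> continuous (fun z => g z * phi z).
Proof.
move=> oO cg cK KO cp p0 z; have [Oz|Oz] := pselect (O z).
  by apply: cvgM; [apply: cg; rewrite inE|exact: cp].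
have Kz : ~ K z by move=> /KO.
rewrite /continuous_at (p0 _ Kz) mulr0; apply: cvg_near_cst.
by apply: filterS (near_out_compact cK Kz) => t /p0 ->; rewrite mulr0.
Qed.

Lemma integrable_mul_test O g phi : open O -> test_function O phi -> {in O, continuous g} ->
  mu2.-integrable (O : set (mplane R)) (EFin \o (fun z => g z * phi z)).
Proof.
move=> oO tphi cg; have [sm [K [cK KO p0]]] := tphi.
have C := continuous_mul_test oO cg cK KO (test_continuous tphi) p0.
apply: (@integrableS _ _ _ _ setT) => //; first exact: (open_measurable_plane oO).
by apply: (compact_support_integrable cK C) => z /p0 ->; rewrite mulr0.
Qed.

Lemma integration_by_parts_test O g phi e : coordinate e -> open O -> test_function O phi ->
  {in O, continuous g} -> (forall z, O z -> derivable g z e) -> {in O, continuous (partial e g)} ->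
  ip O (partial e g) phi = - ip O g (partial e phi).
Proof.
move=> he oO tphi cg dg cdg; have [sm [K [cK KO p0]]] := tphi.
have tp := test_partial e tphi; have p0' z : ~ K z -> partial e phi z = 0.
  by move=> Kz; exact: partial_out_compact cK p0 Kz.
have C1 := continuous_mul_test oO cdg cK KO (test_continuous tphi) p0.
have C2 := continuous_mul_test oO cg cK KO (test_continuous tp) p0'.
have Z1 z : ~ K z -> partial e g z * phi z = 0 by move=> /p0 ->; rewrite mulr0.
have Z2 z : ~ K z -> g z * partial e phi z = 0 by move=> /p0' ->; rewrite mulr0.
have I1 := compact_support_integrable cK C1 Z1.
have I2 := compact_support_integrable cK C2 Z2.
have ext (h : fld R) : (forall z, ~ K z -> h z = 0) -> \int[mu2]_(z in O) h z = \int[mu2]_z h z.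
  move=> h0; rewrite /Rintegral integral_mkcond; congr fine; apply: eq_integral => z _.
  rewrite patchE; case: ifPn => // /negP; rewrite in_setE => Oz.
  by rewrite h0 // => /KO.
apply/eqP; rewrite -addr_eq0; apply/eqP.
have -> : ip O (partial e g) phi = \int[mu2]_z (partial e g z * phi z) by exact: ext.
have -> : ip O g (partial e phi) = \int[mu2]_z (g z * partial e phi z) by exact: ext.
rewrite -RintegralD //.
rewrite /Rintegral (@integral_partial e (fun z => g z * phi z) _ K) //.
- by move=> z; apply: cvgD; [exact: C1|exact: C2].
- move=> z; have [Oz|Oz] := pselect (O z).
    by apply: derivableM; [exact: dg|exact: test_derivable tphi].
  have Kz : ~ K z by move=> /KO.
  apply: (@near_eq_derivable _ _ _ (cst 0)); last exact: derivable_cst.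
  by apply: filterS (near_out_compact cK Kz) => t /p0 ->; rewrite mulr0.
- move=> z; have [Oz|Oz] := pselect (O z).
    rewrite /partial deriveM; [|exact: dg|exact: test_derivable tphi].
    by rewrite addrC /GRing.scale /=; congr (_ + _); rewrite mulrC.
  have Kz : ~ K z by move=> /KO.
  rewrite p0 // p0' // !mulr0 addr0; apply: (@partial_out_compact K _ z e) => // t /p0 ->.
  by rewrite mulr0.
- by move=> z /p0 ->; rewrite mulr0.
- by move=> z Kz; rewrite Z1 // Z2 // addr0.
Qed.
End Plane.
(** * Calculus on the time interval *)

Section ScalarTime.
Context {R : realType}.
Implicit Types (T s t : R) (p q : R -> R).

Definition sderiv T p dp : Prop := forall t, t \in `[0, T] ->
  (s - t)^-1 * (p s - p t) @[s --> within `[0, T] t^'] --> (dp t : R).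

Lemma sderivP T p dp : sderiv T p dp <-> forall t, t \in `[0, T] ->
  forall e, 0 < e -> exists2 r, 0 < r & forall s, s \in `[0, T] -> s != t -> `|s - t| < r ->
    `|dp t - (s - t)^-1 * (p s - p t)| < e.
Proof.
split=> H t tT.
  move=> e e0; have /cvgrPdist_lt /(_ e e0) := H t tT.
  rewrite near_withinE => /nbhs_ballP [r /= r0 hr].
  exists r => // s sT st sr; apply: hr => //.
  by rewrite /ball /= distrC.
apply/cvgrPdist_lt => e e0; have [r r0 hr] := H t tT e e0.
rewrite near_withinE; apply/nbhs_ballP; exists r => //= s sr st sT.
by apply: hr => //; rewrite distrC.
Qed.

Lemma sderiv_unique T p dp dp' : 0 < T -> sderiv T p dp -> sderiv T p dp' ->
  forall t, t \in `[0, T] -> dp t = dp' t.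
Proof.
move=> T0 /sderivP h /sderivP h' t tT; apply/eqP; rewrite -subr_eq0 -normr_eq0.
rewrite eq_le normr_ge0 andbT; apply/ler_addgt0Pl => e e0; rewrite addr0.
have e2 : 0 < e / 2 by rewrite divr_gt0.
have [r r0 hr] := h t tT _ e2; have [r' r0' hr'] := h' t tT _ e2.
have [s [sT st s1 s2]] : exists s, [/\ s \in `[0, T], s != t, `|s - t| < r & `|s - t| < r'].
  pose del := Num.min (Num.min r r') T / 2.
  have m0 : 0 < Num.min (Num.min r r') T by rewrite !lt_min r0 r0'.
  have d0 : 0 < del by rewrite divr_gt0.
  have dT : del <= T / 2 by rewrite ler_pM2r ?invr_gt0 // ge_min lexx orbT.
  have dr : del < Num.min r r'.
    have : Num.min (Num.min r r') T <= Num.min r r' by rewrite ge_min lexx.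
    by rewrite /del; lra.
  move: dr; rewrite lt_min => /andP[dr dr'].
  move: tT; rewrite in_itv /= => /andP[t0 tT].
  have [th|th] := leP t (T / 2).
    exists (t + del); rewrite in_itv /= addrAC subrr add0r gtr0_norm //; split => //.
      by apply/andP; split; lra.
    by rewrite -subr_eq0 addrAC subrr add0r gt_eqF.
  exists (t - del); rewrite in_itv /= addrAC subrr add0r normrN gtr0_norm //; split => //.
    by apply/andP; split; lra.
  by rewrite -subr_eq0 addrAC subrr add0r oppr_eq0 gt_eqF.
have := hr s sT st s1; have := hr' s sT st s2.
set x := _^-1 * _ => h1 h2; have := ler_distD x (dp t) (dp' t); rewrite (distrC x); lra.
Qed.

Lemma sderiv_unique_on T p dp q dq : 0 < T -> (forall t, t \in `[0, T] -> p t = q t) ->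
  sderiv T p dp -> sderiv T q dq -> forall t, t \in `[0, T] -> dp t = dq t.
Proof.
move=> T0 pq hp; apply: sderiv_unique => //; apply/sderivP => t tT e e0.
have /sderivP /(_ t tT e e0) [r r0 hr] := hp.
by exists r => // s sT st sr; rewrite -!pq //; exact: hr.
Qed.

Lemma sderiv_continuous T p dp : sderiv T p dp -> {within `[0, T], continuous p}.
Proof.
move=> /sderivP h; apply/subspace_continuousP => t tT.
apply/cvgrPdist_lt => e e0; have [r r0 hr] := h t tT 1 ltr01.
pose B := `|dp t| + 1; have B0 : 0 < B by rewrite ltr_wpDl.
near=> s.
have sT : s \in `[0, T] by near: s; exact: withinT.
have [->|st] := eqVneq s t; first by rewrite subrr normr0.
have sr : `|s - t| < r.
  by near: s; apply: cvg_within; apply/nbhs_ballP; exists r => //= s; rewrite /ball /= distrC.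
have se : `|s - t| < e / B.
  near: s; apply: cvg_within; apply/nbhs_ballP; exists (e / B); first exact: divr_gt0.
  by move=> s; rewrite /ball /= distrC.
have := hr s sT st sr; set x := _^-1 * _ => hx.
have -> : p t - p s = - ((s - t) * x) by rewrite /x mulrA divff ?subr_eq0 // mul1r opprB.
rewrite normrN normrM; move: se; rewrite ltr_pdivlMr // => se; apply: le_lt_trans se.
rewrite ler_wpM2l // /B; have := ler_distD (dp t) x 0; rewrite !subr0 (distrC x).
by move=> h1; lra.
Unshelve. all: by end_near.
Qed.

Lemma sderiv_is_derive T p dp x : sderiv T p dp -> 0 < x < T -> is_derive (x : R) (1 : R) p (dp x).
Proof.
move=> /sderivP h /andP[x0 xT].
have L : h^-1 *: ((p \o shift x) (h *: (1 : R)) - p x) @[h --> 0^'] --> (dp x : R).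
  apply/cvgrPdist_lt => e e0.
  have [|r r0 hr] := h x _ e e0; first by rewrite in_itv /= !ltW.
  near=> k.
  have k0 : k != 0 by near: k; exact: nbhs_dnbhs_neq.
  have kr : `|k| < Num.min r (Num.min x (T - x)).
    near: k; apply: dnbhs0_lt.
    by rewrite !lt_min r0 x0 subr_gt0.
  move: kr; rewrite !lt_min => /and3P[kr kx kT].
  have := hr (k + x); rewrite addrK /= /GRing.scale /= mulr1; apply => //.
  - rewrite in_itv /=; have := ler_norm k; have := ler_norm (- k); rewrite normrN => h1 h2.
    by apply/andP; split; lra.
  - by rewrite -subr_eq0 addrK.
apply: DeriveDef; first by apply/cvg_ex; exists (dp x).
exact: cvg_lim L.
Unshelve. all: by end_near.
Qed.

Lemma sderiv_mvt T p dp s t : sderiv T p dp -> s \in `[0, T] -> t \in `[0, T] ->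
  exists c, [/\ c \in `[0, T], `|c - t| <= `|s - t| , `|c - s| <= `|s - t| &
    p s - p t = dp c * (s - t)].
Proof.
move=> dp_; wlog st : s t / s < t.
  move=> wl sT tT; have [st|ts|->] := ltgtP s t.
  - exact: wl.
  - have [c [cT ct cs E]] := wl _ _ ts tT sT; exists c; rewrite (distrC s t).
    by split => //; rewrite -opprB E; ring.
  - by exists t; split => //; rewrite !subrr // mulr0.
move=> sT tT; move: (sT) (tT); rewrite !in_itv /= => /andP[s0 sT'] /andP[t0 tT'].
have [c] : exists2 c, c \in `]s, t[ & p t - p s = dp c * (t - s).
  apply: MVT => //.
    move=> x; rewrite in_itv /= => /andP[sx xt]; apply: (sderiv_is_derive dp_).
    by rewrite (le_lt_trans s0 sx) (lt_le_trans xt).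
  apply: continuous_subspaceW (sderiv_continuous dp_) => x /=; rewrite !in_itv /= => /andP[sx xt].
  by rewrite (le_trans s0 sx) (le_trans xt).
rewrite in_itv /= => /andP[sc ct] E; exists c; split.
- by rewrite in_itv /= (le_trans s0 (ltW sc)) (le_trans (ltW ct)).
- by rewrite !ltr0_norm ?subr_lt0 // lerN2 lerD2r ltW.
- by rewrite distrC !ltr0_norm ?subr_lt0 // !opprB lerD2r ltW.
- by rewrite -opprB E; ring.
Qed.

Lemma sderiv_linear T a p dp q dq : sderiv T p dp -> sderiv T q dq ->
  sderiv T (fun t => a * p t + q t) (fun t => a * dp t + dq t).
Proof.
move=> hp hq t tT.
have -> : (fun s => (s - t)^-1 * (a * p s + q s - (a * p t + q t))) =
  (fun s => a * ((s - t)^-1 * (p s - p t)) + (s - t)^-1 * (q s - q t)).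
  by apply/funext => s; ring.
by apply: cvgD; [apply: cvgMr; exact: hp|exact: hq].
Qed.

Lemma is_derive_sderiv T p dp : (forall t, is_derive (t : R) (1 : R) p (dp t)) -> sderiv T p dp.
Proof.
move=> H; apply/sderivP => t tT e e0; have Ht := H t.
have /cvgrPdist_lt /(_ e e0) : h^-1 *: ((p \o shift t) (h *: (1 : R)) - p t) @[h --> 0^'] --> (dp t : R).
  by rewrite -(@derive_val _ _ _ _ _ _ _ Ht); exact: (@ex_derive _ _ _ _ _ _ _ Ht).
rewrite near_withinE => /nbhs_ballP [r /= r0 hr]; exists r => // s sT st sr.
have := hr (s - t); rewrite /= /GRing.scale /= mulr1 subrK; apply; last by rewrite subr_eq0.
by rewrite /ball /= sub0r normrN.
Qed.

Lemma continuous_segment_bounded T p : 0 < T -> {within `[0, T], continuous p} ->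
  exists2 M : R, 0 <= M & forall t, t \in `[0, T] -> `|p t| <= M.
Proof.
move=> T0 cp.
have cn : {within `[0, T], continuous (fun t => `|p t|)}.
  by move=> t; apply: continuous_comp; [exact: cp|exact: norm_continuous].
have [c cT hc] := EVT_max (ltW T0) cn.
by exists `|p c|.
Qed.

(** The one-sided difference quotients in [C1_interval] are those of [sderiv], so the
    mean value theorem applies to them. *)
Lemma C1_interval_lipschitz T p : 0 < T -> C1_interval T p ->
  exists2 M : R, 0 <= M & (forall t, t \in `[0, T] -> `|p t| <= M) /\
    (forall s t, s \in `[0, T] -> t \in `[0, T] -> `|p s - p t| <= M * `|s - t|).
Proof.
move=> T0 [dp [hdp cdp]]; have hd : sderiv T p dp by [].
have [M1 M10 h1] := continuous_segment_bounded T0 cdp.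
have [M2 M20 h2] := continuous_segment_bounded T0 (sderiv_continuous hd).
exists (M1 + M2); first exact: addr_ge0.
split=> [t tT|s t sT tT]; first by apply: le_trans (h2 t tT) _; rewrite lerDr.
have [c [cT _ _ ->]] := sderiv_mvt hd sT tT.
rewrite normrM ler_wpM2r //; apply: le_trans (h1 c cT) _; by rewrite lerDl.
Qed.

Lemma C1_interval_pos T p : 0 < T -> C1_interval T p -> (forall t, t \in `[0, T] -> 0 < p t) ->
  exists2 c : R, 0 < c & forall t, t \in `[0, T] -> c <= p t.
Proof.
move=> T0 [dp [hdp _]] p0; have hd : sderiv T p dp by [].
have [c cT hc] := EVT_min (ltW T0) (sderiv_continuous hd).
by exists (p c) => //; exact: p0.
Qed.
End ScalarTime.

Section VectorTime.
Context {R : realType} {V : lmodType R} (d : V -> V -> R).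
Hypothesis hd : semi_inner d.
Implicit Types (T s t : R) (x y dx dy : R -> V).

(** Derivatives of the scalar products with every fixed vector: weaker than the norm
    derivative, and enough for mean value and Taylor estimates by duality. *)
Definition wderiv T x dx : Prop := forall w, sderiv T (fun t => d (x t) w) (fun t => d (dx t) w).

Lemma wderiv_linear T a x dx y dy : wderiv T x dx -> wderiv T y dy ->
  wderiv T (fun t => a *: x t + y t) (fun t => a *: dx t + dy t).
Proof.
move=> hx hy w; have := sderiv_linear (a := a) (hx w) (hy w).
by under eq_fun do rewrite -(dotP hd); under [X in sderiv _ _ X]eq_fun do rewrite -(dotP hd).
Qed.

Lemma wderivN T x dx : wderiv T x dx -> wderiv T (fun t => - x t) (fun t => - dx t).
Proof.
move=> hx; have := wderiv_linear (a := -2) hx hx.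
have N (v : V) : -2 *: v + v = - v by rewrite scaleNr scaler_nat mulr2n opprD addrNK.
by congr wderiv; apply/funext => t; exact: N.
Qed.

Lemma wderivD T x dx y dy : wderiv T x dx -> wderiv T y dy ->
  wderiv T (fun t => x t + y t) (fun t => dx t + dy t).
Proof.
move=> hx hy; have := wderiv_linear (a := 1) hx hy.
by congr wderiv; apply/funext => t; rewrite scale1r.
Qed.

Lemma wderiv_scale T (p dp : R -> R) (v : V) : (forall t, is_derive (t : R) (1 : R) p (dp t)) ->
  wderiv T (fun t => p t *: v) (fun t => dp t *: v).
Proof.
move=> hp w; have h0 : sderiv T (fun=> 0 : R) (fun=> 0 : R).
  by apply: is_derive_sderiv => t; exact: is_derive_cst.
have := sderiv_linear (a := d v w) (is_derive_sderiv (T := T) hp) h0.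
by congr sderiv; apply/funext => t; rewrite (dotZl hd) addr0 mulrC.
Qed.

Lemma wderiv_mean_value T x dx t C k : 0 <= C -> t \in `[0, T] -> wderiv T x dx ->
  (forall s, s \in `[0, T] -> seminorm d (dx s) <= C * `|s - t| ^+ k) ->
  forall s, s \in `[0, T] -> seminorm d (x s - x t) <= C * `|s - t| ^+ k.+1.
Proof.
move=> C0 tT hx hdx s sT; apply: (seminorm_dual hd); first by rewrite mulr_ge0 ?exprn_ge0.
move=> w; rewrite (dotBl hd).
have [c [cT ct _ ->]] := sderiv_mvt (hx w) sT tT.
rewrite normrM exprSr mulrA mulrAC ler_wpM2r //.
apply: le_trans (dot_le hd _ _) _; rewrite ler_wpM2r ?seminorm_ge0 //.
apply: le_trans (hdx c cT) _; rewrite ler_wpM2l //.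
by rewrite lerXn2r // nnegrE.
Qed.

(** Taylor polynomials are subtracted before the mean value estimate is applied. *)
Lemma wderiv_sub_taylor T x dx t (v1 v2 v3 : V) : wderiv T x dx ->
  wderiv T (fun s => x s - ((s - t) *: v1 + ((s - t) ^+ 2 / 2) *: v2 + ((s - t) ^+ 3 / 6) *: v3))
    (fun s => dx s - (v1 + (s - t) *: v2 + ((s - t) ^+ 2 / 2) *: v3)).
Proof.
move=> hx.
have p1 (r : R) : is_derive (r : R) (1 : R) (fun s => s - t) (1 : R).
  by apply: is_derive_eq; rewrite subr0.
have p2 (r : R) : is_derive (r : R) (1 : R) (fun s => (s - t) ^+ 2 / 2) (r - t).
  by apply: is_derive_eq; rewrite /GRing.scale /=; field.
have p3 (r : R) : is_derive (r : R) (1 : R) (fun s => (s - t) ^+ 3 / 6) ((r - t) ^+ 2 / 2).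
  by apply: is_derive_eq; rewrite /GRing.scale /=; field.
have h1 := wderiv_scale (T := T) (v := v1) p1; have h2 := wderiv_scale (T := T) (v := v2) p2; have h3 := wderiv_scale (T := T) (v := v3) p3.
have := wderiv_linear (a := -1) (wderiv_linear (a := 1) (wderiv_linear (a := 1) h1 h2) h3) hx.
by congr wderiv; apply/funext => s; rewrite !scale1r scaleN1r addrC.
Qed.

Lemma taylor1 T x x1 K t : 0 <= K -> t \in `[0, T] -> wderiv T x x1 ->
  (forall s, s \in `[0, T] -> seminorm d (x1 s - x1 t) <= K * `|s - t|) ->
  forall s, s \in `[0, T] -> seminorm d (x s - x t - (s - t) *: x1 t) <= K * `|s - t| ^+ 2.
Proof.
move=> K0 tT hx hL s sT.
have := @wderiv_mean_value _ _ _ t K 1 K0 tT (wderiv_sub_taylor (t := t) (v1 := x1 t) (v2 := 0) (v3 := 0) hx) _ s sT.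
rewrite !scaler0 !addr0 subrr scale0r subr0 -addrA (addrC (- _)) addrA; apply.
by move=> r rT; rewrite !scaler0 !addr0 expr1; exact: hL.
Qed.

Lemma taylor3 T x x1 x2 x3 K t : 0 <= K -> t \in `[0, T] ->
  wderiv T x x1 -> wderiv T x1 x2 -> wderiv T x2 x3 ->
  (forall s, s \in `[0, T] -> seminorm d (x3 s - x3 t) <= K * `|s - t|) ->
  forall s, s \in `[0, T] ->
    seminorm d (x s - x t - ((s - t) *: x1 t + ((s - t) ^+ 2 / 2) *: x2 t +
      ((s - t) ^+ 3 / 6) *: x3 t)) <= K * `|s - t| ^+ 4.
Proof.
move=> K0 tT hx hx1 hx2 hL.
have z n c : (0 < n)%N -> (t - t) ^+ n / c = 0 by case: n => // n _; rewrite subrr exprS !mul0r.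
have s2 s : s \in `[0, T] ->
    seminorm d (x2 s - (x2 t + (s - t) *: x3 t)) <= K * `|s - t| ^+ 2.
  move=> sT.
  have := @wderiv_mean_value _ _ _ t K 1 K0 tT (wderiv_sub_taylor (t := t) (v1 := x3 t) (v2 := 0) (v3 := 0) hx2) _ s sT.
  rewrite !scaler0 !addr0 subrr scale0r subr0 -addrA -opprD (addrC _ (x2 t)); apply.
  by move=> r rT; rewrite !scaler0 !addr0 expr1; exact: hL.
have s1 s : s \in `[0, T] ->
    seminorm d (x1 s - (x1 t + (s - t) *: x2 t + ((s - t) ^+ 2 / 2) *: x3 t)) <= K * `|s - t| ^+ 3.
  move=> sT.
  have := @wderiv_mean_value _ _ _ t K 2 K0 tT (wderiv_sub_taylor (t := t) (v1 := x2 t) (v2 := x3 t) (v3 := 0) hx1) _ s sT.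
  rewrite !scaler0 !addr0 z // subrr !scale0r addr0 subr0 -addrA -opprD (addrC _ (x1 t)) addrA; apply.
  by move=> r rT; rewrite !scaler0 !addr0; exact: s2.
move=> s sT.
have := @wderiv_mean_value _ _ _ t K 3 K0 tT (wderiv_sub_taylor (t := t) (v1 := x1 t) (v2 := x2 t) (v3 := x3 t) hx) _ s sT.
rewrite !z // subrr !scale0r !addr0 subr0 addrAC; apply.
by move=> r rT; exact: s1.
Qed.

(** Symmetric second differences: the odd Taylor terms cancel. *)
Lemma second_difference1 T x x1 K t h : 0 <= K -> t - h \in `[0, T] -> t \in `[0, T] ->
  t + h \in `[0, T] -> wderiv T x x1 ->
  (forall s, s \in `[0, T] -> seminorm d (x1 s - x1 t) <= K * `|s - t|) ->
  seminorm d (x (t + h) - 2 *: x t + x (t - h)) <= 2 * K * h ^+ 2.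
Proof.
move=> K0 t1 t2 t3 hx hL.
have := taylor1 K0 t2 hx hL t3; have := taylor1 K0 t2 hx hL t1.
rewrite [t + h - t]addrAC [t - h - t]addrAC subrr !add0r normrN !real_normK ?num_real //.
set a := seminorm d _ => h1; set b := seminorm d _ => h2.
apply: (seminorm_dual hd) => [|w]; first by rewrite mulr_ge0 ?exprn_even_ge0 // mulr_ge0.
have := dot_le hd (x (t + h) - x t - h *: x1 t) w; have := dot_le hd (x (t - h) - x t - - h *: x1 t) w.
rewrite -/a -/b => e1 e2.
have -> : d (x (t + h) - 2 *: x t + x (t - h)) w =
    d (x (t + h) - x t - h *: x1 t) w + d (x (t - h) - x t - - h *: x1 t) w.
  rewrite !(dotDl hd, dotBl hd, dotNl hd, dotZl hd); ring.
apply: le_trans (ler_normD _ _) _.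
have g1 := ler_wpM2r (seminorm_ge0 (d := d) w) h1; have g2 := ler_wpM2r (seminorm_ge0 (d := d) w) h2.
lra.
Qed.

Lemma second_difference3 T x x1 x2 x3 K t h : 0 <= K -> t - h \in `[0, T] -> t \in `[0, T] ->
  t + h \in `[0, T] -> wderiv T x x1 -> wderiv T x1 x2 -> wderiv T x2 x3 ->
  (forall s, s \in `[0, T] -> seminorm d (x3 s - x3 t) <= K * `|s - t|) ->
  seminorm d (x (t + h) - 2 *: x t + x (t - h) - h ^+ 2 *: x2 t) <= 2 * K * h ^+ 4.
Proof.
move=> K0 t1 t2 t3 hx hx1 hx2 hL.
have := taylor3 K0 t2 hx hx1 hx2 hL t3; have := taylor3 K0 t2 hx hx1 hx2 hL t1.
rewrite [t + h - t]addrAC [t - h - t]addrAC subrr !add0r normrN.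
have -> : `|h| ^+ 4 = h ^+ 4 by rewrite (_ : 4 = 2 * 2)%N // !exprM real_normK ?num_real.
set a := seminorm d _ => h1; set b := seminorm d _ => h2.
apply: (seminorm_dual hd) => [|w]; first by rewrite mulr_ge0 ?exprn_even_ge0 // mulr_ge0.
have := dot_le hd (x (t + h) - x t - (h *: x1 t + (h ^+ 2 / 2) *: x2 t + (h ^+ 3 / 6) *: x3 t)) w; have := dot_le hd (x (t - h) - x t - (- h *: x1 t + ((- h) ^+ 2 / 2) *: x2 t + ((- h) ^+ 3 / 6) *: x3 t)) w.
rewrite -/a -/b => e1 e2.
have -> : d (x (t + h) - 2 *: x t + x (t - h) - h ^+ 2 *: x2 t) w =
    d (x (t + h) - x t - (h *: x1 t + (h ^+ 2 / 2) *: x2 t + (h ^+ 3 / 6) *: x3 t)) w + d (x (t - h) - x t - (- h *: x1 t + ((- h) ^+ 2 / 2) *: x2 t + ((- h) ^+ 3 / 6) *: x3 t)) w.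
  rewrite !(dotDl hd, dotBl hd, dotNl hd, dotZl hd); lra.
apply: le_trans (ler_normD _ _) _.
have g1 := ler_wpM2r (seminorm_ge0 (d := d) w) h1; have g2 := ler_wpM2r (seminorm_ge0 (d := d) w) h2.
lra.
Qed.
End VectorTime.
(** * Taylor bounds for the exact solution *)

Section BoundedLipschitz.
Context {R : realType} {V : lmodType R} (d : V -> V -> R).
Hypothesis hd : semi_inner d.
Implicit Types (x dx : R -> V) (T C K : R).

Definition tbounded T x C := forall t, t \in `[0, T] -> seminorm d (x t) <= C.
Definition tlip T x K := forall s t, s \in `[0, T] -> t \in `[0, T] ->
  seminorm d (x s - x t) <= K * `|s - t|.

Lemma wderiv_tlip T x dx C : 0 <= C -> wderiv d T x dx -> tbounded T dx C -> tlip T x C.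
Proof.
move=> C0 hx hb s t sT tT; have := wderiv_mean_value hd (k := 0) C0 tT hx _ sT.
by rewrite expr1; apply => r rT; rewrite expr0 mulr1; exact: hb.
Qed.

Lemma tlipD T x y K L : tlip T x K -> tlip T y L -> tlip T (fun t => x t + y t) (K + L).
Proof.
move=> hx hy s t sT tT; rewrite opprD addrACA; apply: le_trans (seminormD hd _ _) _.
by rewrite mulrDl lerD ?hx ?hy.
Qed.

Lemma tlipN T x K : tlip T x K -> tlip T (fun t => - x t) K.
Proof. by move=> hx s t sT tT; rewrite -opprD (seminormN hd); exact: hx. Qed.

Lemma tlip_tbounded T x K : 0 < T -> 0 <= K -> tlip T x K ->
  tbounded T x (seminorm d (x 0) + K * T).
Proof.
move=> T0 K0 hL t tT.
have z0 : 0 \in `[0, T] by rewrite in_itv /= lexx ltW.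
have := seminormD hd (x 0) (x t - x 0); rewrite addrC subrK => /le_trans; apply.
rewrite lerD2l; apply: le_trans (hL _ _ tT z0) _; rewrite subr0.
by move: tT; rewrite in_itv /= => /andP[t0 tT]; rewrite ger0_norm // ler_wpM2l.
Qed.

End BoundedLipschitz.

Section ExactSolution.
Context {R : realType} {V W : lmodType R} (d : V -> V -> R) (a : W -> W -> R).
Hypotheses (hd : semi_inner d) (ha : semi_inner a).

(** [x] solves [x'' + (al + be |g|^2) l = f]; it has the gradient [g], and [l] is minus its Laplacian. *)
Record smooth_solution (T : R) (al be : R -> R) (f x x1 x2 x3 l l1 : R -> V) (g g1 g2 : R -> W)
    (K : R) : Prop := {
  ss_x : wderiv d T x x1 ;
  ss_x1 : wderiv d T x1 x2 ;
  ss_x2 : wderiv d T x2 x3 ;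
  ss_x3 : tlip d T x3 K ;
  ss_l : wderiv d T l l1 ;
  ss_l1 : tlip d T l1 K ;
  ss_g : wderiv a T g g1 ;
  ss_g1 : wderiv a T g1 g2 ;
  ss_g2 : tbounded a T g2 K ;
  ss_f : tbounded d T f K ;
  ss_be : forall t, t \in `[0, T] -> `|be t| <= K ;
  ss_al : forall t, t \in `[0, T] -> `|al t| <= K ;
  ss_eq : forall t w, t \in `[0, T] ->
    d (x2 t) w + (al t + be t * a (g t) (g t)) * d (l t) w = d (f t) w }.

Lemma sqr_second_difference (p0 p p1 : W) :
  a p1 p1 + a p0 p0 - 2 * a p p =
  2 * a p (p1 - 2 *: p + p0) + a (p1 - p) (p1 - p) + a (p0 - p) (p0 - p).
Proof.
rewrite !(dotDl ha, dotBl ha, dotNl ha, dotZl ha, dotDr ha, dotBr ha, dotNr ha, dotZr ha).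
by rewrite (dotC ha p1 p) (dotC ha p0 p); ring.
Qed.

(** The residual is [O(h^4)] because every term is compared with its value at the middle point [t],
    where the equation holds: symmetric differences of [x] and averages of [l] by Taylor's
    formula, and the average of the nonlocal coefficient by [sqr_second_difference]. *)
Lemma smooth_solution_bounds (T : R) (al be : R -> R) (f x x1 x2 x3 l l1 : R -> V)
    (g g1 g2 : R -> W) (K : R) : 0 < T -> 0 <= K ->
  smooth_solution T al be f x x1 x2 x3 l l1 g g1 g2 K ->
  exists2 M : R, 0 <= M &
    [/\ tbounded d T l M /\ tbounded a T g M,
        [/\ tlip d T x M, tlip d T l M & forall s t, s \in `[0, T] -> t \in `[0, T] ->
          `|a (g s) (g s) - a (g t) (g t)| <= M * `|s - t|],
        forall t h w, t - h \in `[0, T] -> t \in `[0, T] -> t + h \in `[0, T] ->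
          `|d (x (t + h) - 2 *: x t + x (t - h)) w +
            h ^+ 2 / 2 * ((al t + be t / 2 * (a (g (t + h)) (g (t + h)) + a (g (t - h)) (g (t - h)))) *
              d (l (t + h) + l (t - h)) w) - h ^+ 2 * d (f t) w| <= M * h ^+ 4 * seminorm d w &
        forall h, h \in `[0, T] -> h <= 1 ->
          seminorm d (x h - x 0 - (h *: x1 0 + (h ^+ 2 / 2) *: x2 0)) <= M * h ^+ 3 /\
          seminorm a (g h - g 0 - (h *: g1 0 + (h ^+ 2 / 2) *: g2 0)) <= M * h ^+ 2].
Proof.
move=> T0 K0 H.
have z0 : 0 \in `[0, T] by rewrite in_itv /= lexx ltW.
have sn0 := @seminorm_ge0 R V d; have sna0 := @seminorm_ge0 R W a.
have bn := tlip_tbounded hd T0.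
pose X3 := seminorm d (x3 0) + K * T; have X30 : 0 <= X3 by nonneg.
have x3b : tbounded d T x3 X3 := bn _ _ K0 (ss_x3 H).
have x2L := wderiv_tlip hd X30 (ss_x2 H) x3b.
pose X2 := seminorm d (x2 0) + X3 * T; have X20 : 0 <= X2 by nonneg.
have x2b : tbounded d T x2 X2 := bn _ _ X30 x2L.
have x1L := wderiv_tlip hd X20 (ss_x1 H) x2b.
pose X1 := seminorm d (x1 0) + X2 * T; have X10 : 0 <= X1 by nonneg.
have x1b : tbounded d T x1 X1 := bn _ _ X20 x1L.
have xL := wderiv_tlip hd X10 (ss_x H) x1b.
pose L1 := seminorm d (l1 0) + K * T; have L10 : 0 <= L1 by nonneg.
have l1b : tbounded d T l1 L1 := bn _ _ K0 (ss_l1 H).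
have lL := wderiv_tlip hd L10 (ss_l H) l1b.
pose L0 := seminorm d (l 0) + L1 * T; have L00 : 0 <= L0 by nonneg.
have lb : tbounded d T l L0 := bn _ _ L10 lL.
have g1L := wderiv_tlip ha K0 (ss_g1 H) (ss_g2 H).
pose G1 := seminorm a (g1 0) + K * T; have G10 : 0 <= G1 by nonneg.
have g1b : tbounded a T g1 G1 := tlip_tbounded ha T0 K0 g1L.
have gL := wderiv_tlip ha G10 (ss_g H) g1b.
pose G0 := seminorm a (g 0) + G1 * T; have G00 : 0 <= G0 by nonneg.
have gb : tbounded a T g G0 := tlip_tbounded ha T0 G10 gL.
pose CQ := 4 * (K * G0) + 2 * G1 ^+ 2; have CQ0 : 0 <= CQ by rewrite /CQ; nonneg.
pose QB := K + K * G0 ^+ 2; have QB0 : 0 <= QB by rewrite /QB; nonneg.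
pose CR := 2 * K + QB * K + K * CQ * L0.
have CR0 : 0 <= CR by rewrite /CR; nonneg.
pose M := X1 + L0 + L1 + G0 + 2 * (G0 * G1) + CR + (K + X3) + 2 * K.
have GG0 : 0 <= G0 * G1 by nonneg.
have qb s : s \in `[0, T] -> 0 <= a (g s) (g s) <= G0 ^+ 2.
  move=> sT; rewrite (dot_ge0 ha) /= -(sqr_seminorm ha).
  by rewrite ler_pXn2r ?nnegrE //; exact: gb.
exists M; first by rewrite /M; nonneg.
split.
- by split=> t tT; [apply: le_trans (lb t tT) _|apply: le_trans (gb t tT) _]; rewrite /M; lra.
- split=> s t sT tT.
  + by apply: le_trans (xL s t sT tT) _; apply: ler_wpM2r => //; rewrite /M; lra.
  + by apply: le_trans (lL s t sT tT) _; apply: ler_wpM2r => //; rewrite /M; lra.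
  + have -> : a (g s) (g s) - a (g t) (g t) = a (g s - g t) (g s + g t).
      by rewrite (dotBl ha) !(dotDr ha) (dotC ha (g s) (g t)); ring.
    apply: le_trans (dot_le ha _ _) _.
    apply: (@le_trans _ _ (G1 * `|s - t| * (2 * G0))).
      apply: ler_pM => //; first exact: gL.
      by apply: le_trans (seminormD ha _ _) _; have := gb s sT; have := gb t tT; lra.
    have -> : G1 * `|s - t| * (2 * G0) = 2 * (G0 * G1) * `|s - t| by ring.
    by apply: ler_wpM2r => //; rewrite /M; lra.
- move=> t h w t1 t2 t3.
  have dx := second_difference3 hd K0 t1 t2 t3 (ss_x H) (ss_x1 H) (ss_x2 H)
    (fun s sT => ss_x3 H sT t2).
  have dl := second_difference1 hd K0 t1 t2 t3 (ss_l H) (fun s sT => ss_l1 H sT t2).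
  have dg := second_difference1 ha K0 t1 t2 t3 (ss_g H) (fun s sT => g1L s t sT t2).
  have h20 : 0 <= h ^+ 2 by exact: sqr_ge0.
  have dq : `|a (g (t + h)) (g (t + h)) + a (g (t - h)) (g (t - h)) - 2 * a (g t) (g t)| <= CQ * h ^+ 2.
    rewrite sqr_second_difference.
    have e1 := dot_le ha (g t) (g (t + h) - 2 *: g t + g (t - h)).
    have e2 : seminorm a (g t) * seminorm a (g (t + h) - 2 *: g t + g (t - h)) <= G0 * (2 * K * h ^+ 2).
      by apply: ler_pM => //; exact: gb.
    have sq k : `|k| = `|h| -> t + k \in `[0, T] -> a (g (t + k) - g t) (g (t + k) - g t) <= G1 ^+ 2 * h ^+ 2.
      move=> kh tk; have := gL _ _ tk t2; rewrite addrAC subrr add0r kh => e.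
      have -> : G1 ^+ 2 * h ^+ 2 = (G1 * `|h|) ^+ 2 by rewrite exprMn real_normK ?num_real.
      by rewrite -(sqr_seminorm ha) ler_pXn2r ?nnegrE //; nonneg.
    have e3 := sq h erefl t3; have e4 := sq (- h) (normrN h) t1.
    have e5 := dot_ge0 ha (g (t + h) - g t); have e6 := dot_ge0 ha (g (t - h) - g t).
    move: e1; set A := a _ _ => e1; have := ler_norm A; have := ler_norm (- A); rewrite normrN => e7 e8.
    by rewrite ler_norml /CQ; apply/andP; split; lra.
  set q := al t + _.
  pose q0 := al t + be t * a (g t) (g t).
  set D := x (t + h) - 2 *: x t + x (t - h) in dx *.
  set Ll := l (t + h) - 2 *: l t + l (t - h) in dl.
  have -> : d D w + h ^+ 2 / 2 * (q * d (l (t + h) + l (t - h)) w) - h ^+ 2 * d (f t) w =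
      d (D - h ^+ 2 *: x2 t) w + h ^+ 2 / 2 * (q * d Ll w + 2 * (q - q0) * d (l t) w).
    rewrite -(ss_eq H w t2) -/q0 /Ll (dotBl hd D) (dotZl hd) (dotDl hd (l (t + h) - _)).
    by rewrite (dotBl hd (l (t + h))) (dotZl hd) (dotDl hd (l (t + h))); field.
  have w0 := sn0 w; have h40 : 0 <= h ^+ 4 by rewrite exprn_even_ge0.
  have e1 : `|d (D - h ^+ 2 *: x2 t) w| <= 2 * K * h ^+ 4 * seminorm d w.
    by apply: le_trans (dot_le hd _ _) _; apply: ler_wpM2r.
  have e2 : `|q * d Ll w| <= QB * (2 * K * h ^+ 2 * seminorm d w).
    rewrite normrM; apply: ler_pM => //.
      have /andP[f1 f2] := qb _ t1; have /andP[f3 f4] := qb _ t3.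
      apply: le_trans (ler_normD _ _) _; rewrite /QB lerD //; first exact: (ss_al H).
      rewrite -mulrA normrM; apply: ler_pM => //; first exact: (ss_be H).
      by rewrite ger0_norm; [lra|nonneg].
    by apply: le_trans (dot_le hd _ _) _; apply: ler_wpM2r.
  have e3 : `|2 * (q - q0) * d (l t) w| <= K * (CQ * h ^+ 2) * (L0 * seminorm d w).
    rewrite normrM; apply: ler_pM => //.
      have -> : 2 * (q - q0) = be t * (a (g (t + h)) (g (t + h)) + a (g (t - h)) (g (t - h)) - 2 * a (g t) (g t)).
        by rewrite /q /q0; field.
      by rewrite normrM; apply: ler_pM => //; exact: (ss_be H).
    by apply: le_trans (dot_le hd _ _) _; apply: ler_wpM2r => //; exact: lb.
  apply: le_trans (ler_normD _ _) _; rewrite normrM (ger0_norm (_ : 0 <= h ^+ 2 / 2)); last by nonneg.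
  have e4 := le_trans (ler_normD (q * d Ll w) (2 * (q - q0) * d (l t) w)) (lerD e2 e3).
  have h220 : 0 <= h ^+ 2 / 2 by nonneg.
  have e5 := lerD e1 (ler_wpM2l h220 e4).
  apply: le_trans e5 _.
  apply: (@le_trans _ _ (CR * (h ^+ 4 * seminorm d w))).
    have -> : 2 * K * h ^+ 4 * seminorm d w + h ^+ 2 / 2 *
      (QB * (2 * K * h ^+ 2 * seminorm d w) + K * (CQ * h ^+ 2) * (L0 * seminorm d w)) =
      (2 * K + QB * K + K * CQ * L0 / 2) * (h ^+ 4 * seminorm d w) by field.
    apply: ler_wpM2r; first by nonneg.
    have : 0 <= K * CQ * L0 by nonneg.
    by rewrite /CR; lra.
  rewrite -mulrA; apply: ler_wpM2r; first by nonneg.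
  by rewrite /M; lra.
- move=> h hT h1; have h0 : 0 <= h by move: hT; rewrite in_itv /= => /andP[].
  have nh : `|h - 0| = h by rewrite subr0 ger0_norm.
  split.
  + have := taylor3 hd K0 z0 (ss_x H) (ss_x1 H) (ss_x2 H) (fun s sT => ss_x3 H sT z0) hT.
    rewrite nh !subr0 opprD addrA => e1.
    have := seminormD hd (x h - x 0 - (h *: x1 0 + (h ^+ 2 / 2) *: x2 0) - (h ^+ 3 / 6) *: x3 0) ((h ^+ 3 / 6) *: x3 0).
    rewrite subrK => /le_trans; apply; rewrite (seminormZ hd) ger0_norm; last by nonneg.
    have e2 : h ^+ 3 / 6 * seminorm d (x3 0) <= h ^+ 3 * X3.
      apply: ler_pM => //; first by nonneg.
        by rewrite ler_piMr ?exprn_ge0 //; lra.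
      by apply: x3b.
    have e3 : K * h ^+ 4 <= K * h ^+ 3.
      by rewrite ler_wpM2l // exprS ler_piMl ?exprn_ge0.
    have h30 : 0 <= h ^+ 3 by nonneg.
    apply: (@le_trans _ _ ((K + X3) * h ^+ 3)); first lra.
    by apply: ler_wpM2r => //; rewrite /M; lra.
  + have := taylor1 ha K0 z0 (ss_g H) (fun s sT => g1L s 0 sT z0) hT.
    rewrite nh !subr0 => e1.
    have -> : g h - g 0 - (h *: g1 0 + (h ^+ 2 / 2) *: g2 0) = (g h - g 0 - h *: g1 0) - (h ^+ 2 / 2) *: g2 0.
      by rewrite opprD addrA.
    apply: le_trans (seminormB ha _ _) _; rewrite (seminormZ ha) ger0_norm; last by nonneg.
    have h20 : 0 <= h ^+ 2 by nonneg.
    have e2 : h ^+ 2 / 2 * seminorm a (g2 0) <= h ^+ 2 * K.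
      apply: ler_pM => //; first by nonneg.
        by lra.
      exact: (ss_g2 H).
    apply: (@le_trans _ _ (2 * K * h ^+ 2)); first lra.
    by apply: ler_wpM2r => //; rewrite /M; lra.
Qed.
End ExactSolution.
(** * Sampling the exact solution on the grid *)

Section Sampling.
Context {R : realType} {V W : lmodType R} (d : V -> V -> R) (a : W -> W -> R).
Hypotheses (hd : semi_inner d) (ha : semi_inner a).

Lemma smooth_solution_consistent (T : R) (al be : R -> R) (f x x1 x2 x3 l l1 : R -> V) (g g1 g2 : R -> W) (K La c : R) :
  0 < T -> 0 <= K -> 0 <= La ->
  smooth_solution d a T al be f x x1 x2 x3 l l1 g g1 g2 K ->
  (forall t, t \in `[0, T] -> c <= al t) -> (forall t, t \in `[0, T] -> c <= be t) ->
  (forall s t, s \in `[0, T] -> t \in `[0, T] -> `|al s - al t| <= La * `|s - t|) ->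
  (forall s t, s \in `[0, T] -> t \in `[0, T] -> `|be s - be t| <= La * `|s - t|) ->
  exists2 M : R, 0 <= M & forall n (U : nat -> V) (gU : nat -> W),
    let tau := T / n%:R in let tk k := k%:R * tau in
    (0 < n)%N -> tau <= 1 ->
    (forall k j, (k <= n)%N -> (j <= n)%N ->
       a (g (tk k)) (g (tk j) - gU j) = d (l (tk k)) (x (tk j) - U j)) ->
    (forall k j, (1 <= k < n)%N -> (j <= n)%N ->
       d (U k.+1 - 2 *: U k + U k.-1) (x (tk j)) +
       tau ^+ 2 / 2 * (scheme_coef a (fun k => al (tk k)) (fun k => be (tk k)) gU k *
         a (gU k.+1 + gU k.-1) (g (tk j))) = tau ^+ 2 * d (f (tk k)) (x (tk j))) ->
    (forall k j, (1 <= k < n)%N -> (j <= n)%N ->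
       d (U k.+1 - 2 *: U k + U k.-1) (U j) +
       tau ^+ 2 / 2 * (scheme_coef a (fun k => al (tk k)) (fun k => be (tk k)) gU k *
         a (gU k.+1 + gU k.-1) (gU j)) = tau ^+ 2 * d (f (tk k)) (U j)) ->
    (forall w, d (U 0%N) w = d (x 0) w) -> gU 0%N = g 0 ->
    (forall w, d (U 1%N) w = d (x 0 + (tau *: x1 0 + (tau ^+ 2 / 2) *: x2 0)) w) ->
    (forall w, a (gU 1%N) w = a (g 0 + (tau *: g1 0 + (tau ^+ 2 / 2) *: g2 0)) w) ->
    consistent d a M c tau n (fun k => al (tk k)) (fun k => be (tk k)) (fun k => f (tk k))
      (fun k => x (tk k)) (fun k => l (tk k)) U (fun k => g (tk k)) gU.
Proof.
move=> T0 K0 La0 H alc bec alL beL.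
have [M0 M00 [[lb gb] [xL lL gL] res ini]] := smooth_solution_bounds hd ha T0 K0 H.
exists (M0 + K + La); first by rewrite !addr_ge0.
move=> n U gU tau tk n0 tau1 hgreen hu hU hU0 hg0 hU1 hg1.
have nR : 0 < n%:R :> R by rewrite ltr0n.
have t0 : 0 < tau by rewrite divr_gt0.
have tkT k : (k <= n)%N -> tk k \in `[0, T].
  move=> kn; rewrite in_itv /= mulr_ge0 ?ler0n ?(ltW t0) //=.
  by rewrite /tk /tau mulrCA ler_piMr ?(ltW T0) // ler_pdivrMr // mul1r ler_nat.
have tkS k : tk k.+1 = tk k + tau by rewrite /tk -natr1 mulrDl mul1r.
have dtk k : `|tk k.+1 - tk k| = tau by rewrite tkS addrAC subrr add0r gtr0_norm.
have tk0 : tk 0%N = 0 by rewrite /tk mul0r.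
have tk1 : tk 1%N = tau by rewrite /tk mul1r.
have tauT : tau \in `[0, T] by rewrite -tk1; exact: tkT.
have M0M : M0 <= M0 + K + La by lra.
have KM : K <= M0 + K + La by lra.
have LM : La <= M0 + K + La by lra.
have lip (y z : R) : y <= z -> y * tau <= z * tau by move=> yz; rewrite ler_wpM2r // ltW.
split=> //.
- move=> k kn; rewrite alc ?tkT //=; apply: le_trans (ler_norm _) _.
  by apply: le_trans (ss_al H (tkT _ kn)) KM.
- move=> k kn; rewrite bec ?tkT //=; apply: le_trans (ler_norm _) _.
  by apply: le_trans (ss_be H (tkT _ kn)) KM.
- move=> k kn; apply: le_trans (alL _ _ (tkT _ kn) (tkT _ (ltnW kn))) _.
  by rewrite dtk lip.
- move=> k kn; apply: le_trans (beL _ _ (tkT _ kn) (tkT _ (ltnW kn))) _.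
  by rewrite dtk lip.
- by move=> k kn; apply: le_trans (ss_f H (tkT _ kn)) KM.
- move=> k kn; apply: le_trans (xL _ _ (tkT _ kn) (tkT _ (ltnW kn))) _.
  by rewrite dtk lip.
- by move=> k kn; apply: le_trans (lb _ (tkT _ kn)) M0M.
- move=> k kn; apply: le_trans (lL _ _ (tkT _ kn) (tkT _ (ltnW kn))) _.
  by rewrite dtk lip.
- by move=> k kn; apply: le_trans (gb _ (tkT _ kn)) M0M.
- move=> k kn; apply: le_trans (gL _ _ (tkT _ kn) (tkT _ (ltnW kn))) _.
  by rewrite dtk lip.
- move=> k w /andP[k1 kn].
  have kp : tk k.-1 = tk k - tau.
    by have := tkS k.-1; rewrite prednK // => ->; rewrite addrK.
  have kp' := tkT _ (leq_trans (leq_pred k) (ltnW kn)).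
  have kn' := tkT _ kn.
  rewrite kp in kp'; rewrite tkS in kn'.
  have := res (tk k) tau w kp' (tkT _ (ltnW kn)) kn'.
  rewrite -kp -tkS => h; apply: le_trans h _.
  by rewrite ler_wpM2r ?seminorm_ge0 // ler_wpM2r // exprn_ge0 // ltW.
- have z : d (x (tk 0%N) - U 0%N) (x (tk 0%N) - U 0%N) = 0 by rewrite (dotBl hd) hU0 tk0 subrr.
  by rewrite /seminorm z sqrtr0.
- by rewrite /seminorm hg0 tk0 subrr (dot0l ha) sqrtr0.
- have [h _] := ini tau tauT tau1.
  apply: (@le_trans _ _ (M0 * tau ^+ 3)); last by rewrite ler_wpM2r ?exprn_ge0 // ltW.
  apply: (seminorm_dual hd) => [|w]; first by rewrite mulr_ge0 ?exprn_ge0 // ltW.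
  have -> : d (x (tk 1%N) - U 1%N) w = d (x tau - x 0 - (tau *: x1 0 + (tau ^+ 2 / 2) *: x2 0)) w.
    by rewrite (dotBl hd) hU1 tk1 -(dotBl hd) opprD addrA.
  by apply: le_trans (dot_le hd _ _) _; rewrite ler_wpM2r ?seminorm_ge0.
- have [_ h] := ini tau tauT tau1.
  apply: (@le_trans _ _ (M0 * tau ^+ 2)); last by rewrite ler_wpM2r ?exprn_ge0 // ltW.
  apply: (seminorm_dual ha) => [|w]; first by rewrite mulr_ge0 ?exprn_ge0 // ltW.
  have -> : a (g (tk 1%N) - gU 1%N) w = a (g tau - g 0 - (tau *: g1 0 + (tau ^+ 2 / 2) *: g2 0)) w.
    by rewrite (dotBl ha) hg1 tk1 -(dotBl ha) opprD addrA.
  by apply: le_trans (dot_le ha _ _) _; rewrite ler_wpM2r ?seminorm_ge0.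
Qed.

End Sampling.
(** * Weak derivatives and the orthogonal of the test functions *)

Section WeakDerivatives.
Context {R : realType} {Omega : set (plane R)}.
Hypothesis oO : open Omega.

Let mO : measurable Omega := open_measurable_plane oO.

Notation V := (L2space mO).
Notation dd := (@ipL R Omega mO).
Notation "[L g ]" := (@toL2 R Omega mO g) (format "[L  g ]").

Implicit Types (g h phi : fld R) (w x : V).

Let hd : semi_inner dd := ipL_semi_inner.

Lemma test_L2 phi : test_function Omega phi -> L2 Omega phi.
Proof.
move=> tphi; have cphi := test_continuous tphi; have [sm [K [cK KO p0]]] := tphi.
split; first by apply: continuous_measurable_plane => // z _; exact: cphi.
have I : mu2.-integrable [set: mplane R] (EFin \o (fun z => phi z * phi z)).
  apply: (compact_support_integrable cK); first by move=> z; apply: cvgM; exact: cphi.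
  by move=> z /p0 ->; rewrite mulr0.
suff : mu2.-integrable (Omega : set (mplane R)) (fun z => (phi z ^+ 2)%:E) by [].
by apply: integrableS I.
Qed.

(** The functions in the closure of the test functions, described as a double
    orthogonal: this is visibly stable under linear combinations, limits and time derivatives. *)
Definition test_orth w : Prop := forall phi, test_function Omega phi -> dd w [L phi] = 0.
Definition test_closure x : Prop := forall w, test_orth w -> dd x w = 0.

Lemma test_closure_linear (c : R) x y : test_closure x -> test_closure y -> test_closure (c *: x + y).
Proof. by move=> hx hy w hw; rewrite (dotP hd) hx // hy // mulr0 addr0. Qed.

Lemma test_closure_null x : test_closure x -> test_orth x -> forall w, dd x w = 0.
Proof.
move=> h1 h2 w; apply/eqP; rewrite -normr_eq0 eq_le normr_ge0 andbT.
by apply: le_trans (dot_le hd _ _) _; rewrite /seminorm h1 // sqrtr0 mul0r.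
Qed.

Lemma dot_cvg (xn : nat -> V) x : seminorm dd (xn j - x) @[j --> \oo] --> (0 : R) ->
  forall w, dd (xn j) w @[j --> \oo] --> dd x w.
Proof.
move=> h w; apply/cvgrPdist_le => e e0.
have e1 : 0 < e / (seminorm dd w + 1) by rewrite divr_gt0 // ltr_wpDl // seminorm_ge0.
have /cvgrPdist_le /(_ _ e1) := h; apply: filterS => j.
rewrite sub0r normrN ger0_norm ?seminorm_ge0 // ler_pdivlMr ?ltr_wpDl ?seminorm_ge0 // => hj.
rewrite distrC -(dotBl hd); apply: le_trans (dot_le hd _ _) _; apply: le_trans hj.
by rewrite ler_wpM2l ?seminorm_ge0 // lerDl.
Qed.

Lemma test_closure_limit (phi : nat -> fld R) g : L2 Omega g -> (forall j, test_function Omega (phi j)) ->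
  L2norm Omega (fun z => phi j z - g z) @[j --> \oo] --> (0 : R) -> test_closure [L g].
Proof.
move=> Lg tphi hc w hw.
have h : seminorm dd ([L phi j] - [L g]) @[j --> \oo] --> (0 : R).
  rewrite (_ : (fun j => _) = (fun j => L2norm Omega (fun z => phi j z - g z))) //.
  by apply/funext => j; rewrite L2norm_toL2B //; exact: test_L2.
have := dot_cvg h (w := w).
have -> : (fun j => dd [L phi j] w) = (fun=> 0).
  by apply/funext => j; rewrite (dotC hd) hw.
by move=> h0; apply/esym; apply: (cvg_unique _ _ h0); [exact: Rhausdorff|exact: cvg_cst].
Qed.

Lemma has_wpartialP e g : has_wpartial Omega e g -> is_wpartial Omega e g (wpartial Omega e g).
Proof. by move=> h; exact: (@xgetPex _ (fun=> 0) [set d | is_wpartial Omega e g d] h). Qed.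

Lemma is_wpartialP e g d : is_wpartial Omega e g d -> forall phi, test_function Omega phi ->
  dd [L g] [L partial e phi] = - dd [L d] [L phi].
Proof.
move=> [Lg Ld h] phi tphi.
by rewrite -!ip_toL2 //; [exact: h|exact: test_L2|apply: test_L2; exact: test_partial].
Qed.

(** [xget] chooses from the set of the weak derivatives, which depends only on the class of
    the function; hence an equality of functions, not only almost everywhere. *)
Lemma wpartial_eqO e g g' : L2 Omega g -> L2 Omega g' -> eqO Omega g g' ->
  wpartial Omega e g = wpartial Omega e g'.
Proof.
move=> Lg Lg' gg'; rewrite /wpartial; congr xget; apply/seteqP.
have H k k' d : L2 Omega k -> L2 Omega k' -> eqO Omega k k' ->
    is_wpartial Omega e k d -> is_wpartial Omega e k' d.
  move=> Lk Lk' kk' [_ Ld h]; split => // phi tphi; rewrite -h //.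
  by apply: (ip_eqO mO) => //; [apply: test_L2; exact: test_partial|exact: eqO_sym].
by split => d /=; apply: H => //; exact: eqO_sym.
Qed.

Lemma H01_wpartial e g : coordinate e -> H01 Omega g -> has_wpartial Omega e g.
Proof. by move=> [->|->] []. Qed.

Lemma H01_L2 g : H01 Omega g -> L2 Omega g.
Proof. by move=> [/has_wpartialP []]. Qed.

Lemma wpartial_L2 e g : has_wpartial Omega e g -> L2 Omega (wpartial Omega e g).
Proof. by move=> /has_wpartialP []. Qed.

Lemma H01_closure g : H01 Omega g -> test_closure [L g].
Proof.
move=> Hg; have Lg := H01_L2 Hg; have [_ _ [phi [t1 t2 _ _]]] := Hg.
exact: test_closure_limit t2.
Qed.

Lemma H01_wpartial_approx e g : coordinate e -> H01 Omega g -> exists phi : nat -> fld R,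
  [/\ forall j, test_function Omega (phi j),
      L2norm Omega (fun z => phi j z - g z) @[j --> \oo] --> (0 : R) &
      L2norm Omega (fun z => partial e (phi j) z - wpartial Omega e g z) @[j --> \oo] --> (0 : R)].
Proof. by move=> [->|->] [_ _ [phi [t1 t2 t3 t4]]]; exists phi. Qed.

Lemma H01_wpartial_closure e g : coordinate e -> H01 Omega g -> test_closure [L wpartial Omega e g].
Proof.
move=> he Hg; have [phi [t1 t2 t3]] := H01_wpartial_approx he Hg.
apply: (test_closure_limit _ _ t3); first by apply: wpartial_L2; exact: H01_wpartial.
by move=> j; exact: test_partial.
Qed.

(** Green's formula in one direction, by density of the test functions in [H01]. *)
Lemma green_direction e p q h : coordinate e -> is_wpartial Omega e p q -> H01 Omega h ->
  dd [L p] [L wpartial Omega e h] = - dd [L q] [L h].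
Proof.
move=> he pq Hh; have [phi [t1 t2 t3]] := H01_wpartial_approx he Hh.
have Lh := H01_L2 Hh; have Lwh := wpartial_L2 (H01_wpartial he Hh).
have h1 : seminorm dd ([L phi j] - [L h]) @[j --> \oo] --> (0 : R).
  rewrite (_ : (fun j => _) = (fun j => L2norm Omega (fun z => phi j z - h z))) //.
  by apply/funext => j; rewrite L2norm_toL2B //; exact: test_L2.
have h2 : seminorm dd ([L partial e (phi j)] - [L wpartial Omega e h]) @[j --> \oo] --> (0 : R).
  rewrite (_ : (fun j => _) = (fun j => L2norm Omega (fun z => partial e (phi j) z - wpartial Omega e h z))) //.
  by apply/funext => j; rewrite L2norm_toL2B //; apply: test_L2; exact: test_partial.
have c1 := dot_cvg h1 (w := [L q]); have c2 := dot_cvg h2 (w := [L p]).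
rewrite (dotC hd [L p]) (dotC hd [L q]).
apply: (cvg_unique _ c2); first exact: Rhausdorff.
have -> : (fun j => dd [L partial e (phi j)] [L p]) = (fun j => - dd [L phi j] [L q]).
  by apply/funext => j; rewrite (dotC hd) (is_wpartialP pq) // (dotC hd [L q]).
exact: cvgN.
Qed.


(** * Time derivatives in L2 *)

Lemma tderiv_L2 T v dv t : tderiv Omega T v dv -> t \in `[0, T] -> L2 Omega (v t) /\ L2 Omega (dv t).
Proof. by move=> h /h []. Qed.

Lemma tderiv_wderiv T v dv : tderiv Omega T v dv ->
  wderiv dd T (fun t => [L v t]) (fun t => [L dv t]).
Proof.
move=> h w t tT; have [Lt Ldt hl] := h t tT.
apply/cvgrPdist_lt => e e0.
have e1 : 0 < e / (seminorm dd w + 1) by rewrite divr_gt0 // ltr_wpDl // seminorm_ge0.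
have /cvgrPdist_lt /(_ _ e1) := hl; apply: filterS2 (withinT _ _) => s sT.
have [Ls _ _] := h s sT.
have Lst : L2 Omega (fun z => v s z - v t z) by exact: L2B.
have -> : L2norm Omega (fun z => (s - t)^-1 * (v s z - v t z) - dv t z) =
    seminorm dd ((s - t)^-1 *: ([L v s] - [L v t]) - [L dv t]).
  by rewrite L2norm_toL2B ?toL2Z ?toL2B //; exact: (@L2Z R Omega mO).
rewrite sub0r normrN ger0_norm ?seminorm_ge0 // ltr_pdivlMr ?ltr_wpDl ?seminorm_ge0 // => hj.
rewrite -(dotBl hd) -(dotZl hd) distrC -(dotBl hd); apply: le_lt_trans (dot_le hd _ _) _.
by apply: le_lt_trans hj; rewrite ler_wpM2l ?seminorm_ge0 // lerDl.
Qed.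

Lemma tcont_L2 T v t : tcont Omega T v -> t \in `[0, T] -> L2 Omega (v t).
Proof. by move=> h /h []. Qed.

Lemma tcont_tbounded T v : 0 < T -> tcont Omega T v ->
  exists2 M : R, 0 <= M & tbounded dd T (fun t => [L v t]) M.
Proof.
move=> T0 h.
have c : {within `[0, T], continuous (fun t => seminorm dd [L v t])}.
  apply/subspace_continuousP => t tT; have [Lt hl] := h t tT.
  apply/cvgrPdist_lt => e e0; have /cvgrPdist_lt /(_ _ e0) := hl.
  apply: filterS2 (withinT _ _) => s sT; have [Ls _] := h s sT.
  rewrite sub0r normrN L2norm_toL2B // ger0_norm ?seminorm_ge0 // => hs.
  by rewrite distrC; apply: le_lt_trans (seminorm_dist hd _ _) hs.
have [M M0 hM] := continuous_segment_bounded T0 c.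
by exists M => // t tT; apply: le_trans (ler_norm _) (hM t tT).
Qed.

Lemma tlipschitz_tlip T v : (forall t, t \in `[0, T] -> L2 Omega (v t)) -> tlipschitz Omega T v ->
  exists2 K : R, 0 <= K & tlip dd T (fun t => [L v t]) K.
Proof.
move=> Lv [K hK]; exists `|K| => // s t sT tT.
have := hK s t sT tT; rewrite (L2norm_toL2B (mO := mO) (Lv s sT) (Lv t tT)) => h.
by apply: le_trans h _; rewrite ler_wpM2r // ler_norm.
Qed.

Lemma test_closure_wderiv (T : R) (x dx : R -> V) : 0 < T -> wderiv dd T x dx ->
  (forall t, t \in `[0, T] -> test_closure (x t)) ->
  forall t, t \in `[0, T] -> test_closure (dx t).
Proof.
move=> T0 hx hc t tT w hw.
have h0 : sderiv T (fun=> 0 : R) (fun=> 0 : R) by apply: is_derive_sderiv => r; exact: is_derive_cst.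
apply: (sderiv_unique_on T0 _ (hx w) h0 tT) => s sT.
exact: hc.
Qed.

(** * The classical Laplacian of the initial value *)

Lemma closure_extension_continuous g h : closure_extension Omega g h -> {in Omega, continuous g}.
Proof.
move=> [ch hg].
have ch' : {in Omega, continuous h}.
  rewrite -continuous_open_subspace //.
  by apply: continuous_subspaceW ch; exact: subset_closure.
move=> z zO; have Oz : Omega z by rewrite inE in zO.
rewrite /continuous_at -(hg z Oz); apply: cvg_trans (ch' z zO); apply: near_eq_cvg.
by apply: filterS (open_nbhs_nbhs (conj oO Oz)) => t Ot; rewrite hg.
Qed.

Lemma Cclosure_continuous k g : Cclosure Omega k g -> {in Omega, continuous g}.
Proof. by case: k => [|k] [[h hh] _]; exact: closure_extension_continuous hh. Qed.

Lemma ip_second_partial e g phi : coordinate e -> Cclosure Omega 2 g -> test_function Omega phi ->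
  ip Omega (partial e (partial e g)) phi = ip Omega g (partial e (partial e phi)).
Proof.
move=> he Cg tphi; have [_ /(_ e) [d1 C1]] := Cg; have [_ /(_ e) [d2 C2]] := C1.
have c0 := Cclosure_continuous (k := 2) Cg; have c1 := Cclosure_continuous (k := 1) C1; have c2 := Cclosure_continuous (k := 0) C2.
rewrite (integration_by_parts_test he oO tphi c1 d2 c2).
by rewrite (integration_by_parts_test he oO (test_partial e tphi) c0 d1 c1) ?opprK.
Qed.

Lemma laplacian_continuous g : Cclosure Omega 2 g -> {in Omega, continuous (laplacian g)}.
Proof.
move=> [_ Cg] z zO; have [_ [_ /(_ ex) [_ C1]]] := Cg ex; have [_ [_ /(_ ey) [_ C2]]] := Cg ey.
by apply: cvgD; [exact: (Cclosure_continuous (k := 0) C1)|exact: (Cclosure_continuous (k := 0) C2)].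
Qed.

Lemma ip_laplacian g phi : Cclosure Omega 2 g -> test_function Omega phi ->
  ip Omega (laplacian g) phi =
  ip Omega g (partial ex (partial ex phi)) + ip Omega g (partial ey (partial ey phi)).
Proof.
move=> Cg tphi.
have e1 := ip_second_partial (or_introl erefl) Cg tphi.
have e2 := ip_second_partial (or_intror erefl) Cg tphi.
apply: (etrans _ (congr2 +%R e1 e2)).
have [_ Cg'] := Cg; have [_ [_ /(_ ex) [_ C1]]] := Cg' ex; have [_ [_ /(_ ey) [_ C2]]] := Cg' ey.
have I1 := integrable_mul_test oO tphi (Cclosure_continuous (k := 0) C1).
have I2 := integrable_mul_test oO tphi (Cclosure_continuous (k := 0) C2).
have mO' : measurable (Omega : set (mplane R)) by [].
apply: (etrans _ (RintegralD mO' I1 I2)).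
by apply: eq_Rintegral => z _; exact: mulrDl.
Qed.

(** Both Laplacians have the same products with test functions; since their
    difference is a limit of test functions, it vanishes. *)
Lemma laplacian_weak u0 u p1 p2 q1 q2 : Cclosure Omega 2 u0 -> L2 Omega u0 -> eqO Omega u u0 ->
  is_wpartial Omega ex u p1 -> is_wpartial Omega ex p1 q1 ->
  is_wpartial Omega ey u p2 -> is_wpartial Omega ey p2 q2 ->
  L2 Omega (laplacian u0) -> test_closure [L laplacian u0] -> test_closure ([L q1] + [L q2]) ->
  forall w, dd [L laplacian u0] w = dd ([L q1] + [L q2]) w.
Proof.
move=> Cu Lu0 uu0 hp1 hq1 hp2 hq2 Ll c1 c2 w; apply/eqP; rewrite -subr_eq0 -(dotBl hd); apply/eqP.
have Lu : L2 Omega u by case: hp1.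
apply: test_closure_null.
  by rewrite addrC -scaleN1r; exact: test_closure_linear.
move=> phi tphi; rewrite (dotBl hd); apply/eqP; rewrite subr_eq0; apply/eqP.
have tpp e : test_function Omega (partial e (partial e phi)) by do 2 apply: test_partial.
have E0 := ip_toL2 (mO := mO) Ll (test_L2 tphi).
rewrite -E0 (ip_laplacian Cu tphi) (dotDl hd).
have H e p q : is_wpartial Omega e u p -> is_wpartial Omega e p q ->
    ip Omega u0 (partial e (partial e phi)) = dd [L q] [L phi].
  move=> hp hq; rewrite -(ip_eqO mO Lu Lu0 _ uu0); last exact: test_L2.
  rewrite ip_toL2 //; last exact: test_L2.
  rewrite (is_wpartialP hp); last exact: test_partial.
  by rewrite (is_wpartialP hq) // opprK.
exact: (congr2 +%R (H ex p1 q1 hp1 hq1) (H ey p2 q2 hp2 hq2)).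
Qed.

(** * Gradients *)

Notation W := (V * V)%type.
Notation aa := (prod_dot dd dd).

Let ha : semi_inner aa := prod_semi_inner hd hd.

Definition grad g : W := ([L wpartial Omega ex g], [L wpartial Omega ey g]).

Lemma form_a_grad g h : H01 Omega g -> H01 Omega h -> form_a Omega g h = aa (grad g) (grad h).
Proof.
move=> Hg Hh; have L e k : coordinate e -> H01 Omega k -> L2 Omega (wpartial Omega e k).
  by move=> he Hk; apply: wpartial_L2; exact: H01_wpartial.
have Lx := L ex _ (or_introl erefl); have Ly := L ey _ (or_intror erefl).
exact: (congr2 +%R (ip_toL2 (Lx g Hg) (Lx h Hh)) (ip_toL2 (Ly g Hg) (Ly h Hh))).
Qed.

Lemma grad_eqO g g' : L2 Omega g -> L2 Omega g' -> eqO Omega g g' -> grad g = grad g'.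
Proof. by move=> Lg Lg' E; rewrite /grad !(wpartial_eqO _ Lg Lg' E). Qed.

Lemma wderiv_grad T (v1 v2 dv1 dv2 : R -> V) : wderiv dd T v1 dv1 -> wderiv dd T v2 dv2 ->
  wderiv aa T (fun t => (v1 t, v2 t)) (fun t => (dv1 t, dv2 t)).
Proof.
move=> h1 h2 w; have := sderiv_linear (a := 1) (h1 w.1) (h2 w.2).
by congr sderiv; apply/funext => t; rewrite mul1r.
Qed.

Lemma is_L_grad g h l : H01 Omega h -> is_L Omega g l -> aa (grad g) (grad h) = dd [L l] [L h].
Proof.
move=> Hh [Hg Ll E]; rewrite -form_a_grad // E // ip_toL2 //; exact: H01_L2.
Qed.

Lemma green_grad u q1 q2 h : is_wpartial Omega ex (wpartial Omega ex u) q1 ->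
  is_wpartial Omega ey (wpartial Omega ey u) q2 -> H01 Omega h ->
  aa (grad u) (grad h) = dd (- ([L q1] + [L q2])) [L h].
Proof.
move=> h1 h2 Hh.
have e1 := green_direction (or_introl erefl) h1 Hh.
have e2 := green_direction (or_intror erefl) h2 Hh.
by apply: (etrans (congr2 +%R e1 e2)); rewrite (dotNl hd) (dotDl hd) opprD.
Qed.

End WeakDerivatives.
(** * The scheme in weak form and its first step *)

Section Scheme.
Context {R : realType} {Omega : set (plane R)}.
Hypothesis oO : open Omega.

Let mO : measurable Omega := open_measurable_plane oO.

Notation V := (L2space mO).
Notation W := (V * V)%type.
Notation dd := (@ipL R Omega mO).
Notation aa := (prod_dot dd dd).
Notation "[L g ]" := (@toL2 R Omega mO g) (format "[L  g ]").

Implicit Types (g h phi : fld R) (w x : V).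

Let hd : semi_inner dd := ipL_semi_inner.
Let ha : semi_inner aa := prod_semi_inner hd hd.

Lemma dom_LP g : dom_L Omega g -> is_L Omega g (Lop Omega g).
Proof. by move=> h; exact: (@xgetPex _ (fun=> 0) [set l | is_L Omega g l] h). Qed.

Lemma dom_L_H01 g : dom_L Omega g -> H01 Omega g.
Proof. by move=> /dom_LP []. Qed.

Lemma norm_Lhalf_sqr g : H01 Omega g -> norm_Lhalf Omega g ^+ 2 = aa (grad oO g) (grad oO g).
Proof. by move=> Hg; rewrite /norm_Lhalf (form_a_grad oO) // sqr_sqrtr // (dot_ge0 ha). Qed.

(** This form of the scheme involves only first derivatives of the discrete solution, so
    it can be tested with the exact solution as well. *)
Lemma scheme_weak T (alpha beta : R -> R) (f : R -> fld R) u0 v0 n U k h :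
  let tau := T / n%:R in let tk k := k%:R * tau in
  0 < T -> scheme_solution Omega T alpha beta f u0 v0 n U -> (1 <= k < n)%N ->
  L2 Omega (f (tk k)) -> H01 Omega h ->
  dd ([L U k.+1] - 2 *: [L U k] + [L U k.-1]) [L h] +
    tau ^+ 2 / 2 * (scheme_coef aa (fun k => alpha (tk k)) (fun k => beta (tk k)) (fun k => grad oO (U k)) k *
      aa (grad oO (U k.+1) + grad oO (U k.-1)) (grad oO h)) = tau ^+ 2 * dd [L f (tk k)] [L h].
Proof.
move=> tau tk T0 [dU _ _ eqU] kn Lf Hh; have /andP[k1 kn'] := kn.
have n0 : (0 < n)%N by exact: ltn_trans kn'.
have t0 : tau != 0 by rewrite /tau mulf_neq0 ?invr_neq0 ?pnatr_eq0 -?lt0n // gt_eqF.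
have D1 := dU k.+1 kn'; have D := dU k (ltnW kn').
have D0 := dU k.-1 (leq_trans (leq_pred _) (ltnW kn')).
have [H1 L1 _] := dom_LP D1; have [H _ _] := dom_LP D; have [H0 L0 _] := dom_LP D0.
have LU1 := H01_L2 H1; have LU := H01_L2 H; have LU0 := H01_L2 H0.
pose Q := scheme_coef aa (fun k => alpha (tk k)) (fun k => beta (tk k)) (fun k => grad oO (U k)) k.
pose N := alpha (tk k) + beta (tk k) / 2 *
  (norm_Lhalf Omega (U k.+1) ^+ 2 + norm_Lhalf Omega (U k.-1) ^+ 2).
have NQ : N = Q.
  have coefE (x y A B : R) : x ^+ 2 = A -> y ^+ 2 = B ->
    alpha (tk k) + beta (tk k) / 2 * (x ^+ 2 + y ^+ 2) = alpha (tk k) + beta (tk k) / 2 * (A + B).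
    by move=> -> ->.
  exact: (coefE _ _ _ _ (norm_Lhalf_sqr H1) (norm_Lhalf_sqr H0)).
pose G (q : R) : fld R := fun z => (U k.+1 z - 2 * U k z + U k.-1 z) / tau ^+ 2 +
  2^-1 * q * (Lop Omega (U k.+1) z + Lop Omega (U k.-1) z).
have E : eqO Omega (G Q) (f (tk k)).
  exact: (eq_ind N (fun q => eqO Omega (G q) (f (tk k))) (eqU k kn) Q NQ).
rewrite -/Q; clear eqU NQ N; clearbody Q.
move: (tk k) Lf E => t Lf E; clear tk; clearbody tau.
have LA : L2 Omega (fun z => U k.+1 z + (- 2) * U k z).
  by apply: (@L2D R Omega mO) => //; exact: (@L2Z R Omega mO).
have LA' : L2 Omega (fun z => (U k.+1 z + (- 2) * U k z) + U k.-1 z) by exact: (@L2D R Omega mO).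
have LB : L2 Omega (fun z => Lop Omega (U k.+1) z + Lop Omega (U k.-1) z) by exact: (@L2D R Omega mO).
have GE : G Q = (fun z => (tau ^+ 2)^-1 * ((U k.+1 z + (- 2) * U k z) + U k.-1 z) +
    (2^-1 * Q) * (Lop Omega (U k.+1) z + Lop Omega (U k.-1) z)).
  apply/funext => z; rewrite /G.
  by move: (U k.+1 z) (U k z) (U k.-1 z) (Lop Omega (U k.+1) z) (Lop Omega (U k.-1) z) => *; ring.
have LG : L2 Omega (G Q).
  by rewrite GE; apply: (@L2D R Omega mO); exact: (@L2Z R Omega mO).
have : dd [L G Q] [L h] = dd [L f t] [L h] by exact: toL2_eqO.
have -> : [L G Q] = (tau ^+ 2)^-1 *: ([L U k.+1] + (- 2) *: [L U k] + [L U k.-1]) +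
    (2^-1 * Q) *: ([L Lop Omega (U k.+1)] + [L Lop Omega (U k.-1)]).
  have L2U := @L2Z R Omega mO (- 2) _ LU.
  rewrite GE (toL2D (mO := mO) (@L2Z R Omega mO _ _ LA') (@L2Z R Omega mO _ _ LB)).
  rewrite (toL2Z (mO := mO) _ LA') (toL2Z (mO := mO) _ LB) (toL2D (mO := mO) LA LU0).
  by rewrite (toL2D (mO := mO) L1 L0) (toL2D (mO := mO) LU1 L2U) (toL2Z (mO := mO) _ LU).
have alg (y A1 A0 : R) : y + tau ^+ 2 / 2 * (Q * (A1 + A0)) =
    tau ^+ 2 * ((tau ^+ 2)^-1 * y + 2^-1 * Q * (A1 + A0)) by field.
move=> <-; rewrite scaleNr (dotDl ha (grad oO (U k.+1))) (dotDl hd ((tau ^+ 2)^-1 *: _)) !(dotZl hd).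
rewrite (dotDl hd [L Lop Omega (U k.+1)]).
have e1 := is_L_grad oO Hh (dom_LP D1); have e0 := is_L_grad oO Hh (dom_LP D0).
pose Y := dd ([L U k.+1] - 2 *: [L U k] + [L U k.-1]) [L h].
have final := etrans (alg Y _ _)
  (congr2 (fun r s : R => tau ^+ 2 * ((tau ^+ 2)^-1 * Y + 2^-1 * Q * (r + s))) e1 e0).
exact: final.
Qed.

(** One step of Taylor's formula carries over to the weak derivatives: the
    difference of the two sides is both orthogonal to the test functions and a limit of them. *)
Lemma grad_first_step e T (x x1 x2 p p1 p2 : R -> V) (U1 : fld R) (tau : R) : coordinate e -> 0 < T ->
  wderiv dd T x x1 -> wderiv dd T x1 x2 -> wderiv dd T p p1 -> wderiv dd T p1 p2 ->
  (forall t phi, t \in `[0, T] -> test_function Omega phi ->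
     dd (p t) [L phi] = - dd (x t) [L partial e phi]) ->
  (forall t, t \in `[0, T] -> test_closure (p t)) ->
  H01 Omega U1 ->
  (forall w, dd [L U1] w = dd (x 0 + (tau *: x1 0 + (tau ^+ 2 / 2) *: x2 0)) w) ->
  forall w, dd [L wpartial Omega e U1] w = dd (p 0 + (tau *: p1 0 + (tau ^+ 2 / 2) *: p2 0)) w.
Proof.
move=> he T0 hx hx1 hp hp1 hpx hcl HU E w.
have z0 : 0 \in `[0, T] by rewrite in_itv /= lexx ltW.
have neg (y dy : R -> V) v : wderiv dd T y dy -> sderiv T (fun t => - dd (y t) v) (fun t => - dd (dy t) v).
  move=> hy; have h0 : sderiv T (fun=> 0 : R) (fun=> 0 : R).
    by apply: is_derive_sderiv => r; exact: is_derive_cst.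
  have := sderiv_linear (a := -1) (hy v) h0.
  by congr sderiv; apply/funext => t; rewrite addr0 mulN1r.
have hpx1 t phi : t \in `[0, T] -> test_function Omega phi ->
     dd (p1 t) [L phi] = - dd (x1 t) [L partial e phi].
  move=> tT tphi.
  by apply: (sderiv_unique_on T0 _ (hp [L phi]) (neg _ _ [L partial e phi] hx) tT) => s sT; exact: hpx.
have hpx2 t phi : t \in `[0, T] -> test_function Omega phi ->
     dd (p2 t) [L phi] = - dd (x2 t) [L partial e phi].
  move=> tT tphi.
  by apply: (sderiv_unique_on T0 _ (hp1 [L phi]) (neg _ _ [L partial e phi] hx1) tT) => s sT; exact: hpx1.
have c1 := test_closure_wderiv T0 hp hcl; have c2 := test_closure_wderiv T0 hp1 c1.
have cP : test_closure (p 0 + (tau *: p1 0 + (tau ^+ 2 / 2) *: p2 0)).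
  rewrite -[p 0]scale1r -[(tau ^+ 2 / 2) *: p2 0]addr0.
  apply: test_closure_linear; first exact: hcl.
  apply: test_closure_linear; first exact: c1.
  apply: test_closure_linear; first exact: c2.
  by move=> v _; exact: (dot0l hd).
apply/eqP; rewrite -subr_eq0 -(dotBl hd); apply/eqP; apply: test_closure_null.
  rewrite addrC -scaleN1r; apply: test_closure_linear => //; exact: H01_wpartial_closure.
move=> phi tphi.
have EE := is_wpartialP oO (has_wpartialP (H01_wpartial he HU)) tphi.
have {}EE : dd [L wpartial Omega e U1] [L phi] = - dd [L U1] [L partial e phi] by rewrite EE opprK.
rewrite (dotBl hd) EE E !(dotDl hd, dotZl hd) hpx // hpx1 // hpx2 //; ring.
Qed.

Section Solution.
Variables (T : R) (alpha beta : R -> R) (f : R -> fld R) (u0 v0 : fld R) (u ut : R -> fld R).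
Variables (u1 u2 u3 p1 p2 r1 r2 sx sy : R -> fld R).
Hypotheses (T0 : 0 < T) (sol : is_solution Omega T alpha beta f u0 v0 u ut).
Hypotheses (Cf : tcont Omega T f) (Du : tderiv Omega T u u1) (Du1 : tderiv Omega T u1 u2).

Let uxx t := wpartial Omega ex (wpartial Omega ex (u t)).
Let uyy t := wpartial Omega ey (wpartial Omega ey (u t)).

(** Minus the Laplacian, from the second weak derivatives of [u]. *)
Definition wlap (t : R) : V := - ([L uxx t] + [L uyy t]).

Lemma solution_H01 t : t \in `[0, T] -> H01 Omega (u t).
Proof. by have [h _ _ _ _] := sol; exact: h. Qed.

Lemma solution_second e t : coordinate e -> t \in `[0, T] ->
  is_wpartial Omega e (wpartial Omega e (u t)) (wpartial Omega e (wpartial Omega e (u t))).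
Proof. by move=> he tT; have [_ h _ _ _] := sol; have [_ h2 _] := h e he; exact: has_wpartialP (h2 t tT). Qed.

Lemma solution_ut t w : t \in `[0, T] -> dd [L u1 t] w = dd [L ut t] w.
Proof.
move=> tT; have [_ _ [Dut _] _ _] := sol.
have h1 := tderiv_wderiv (oO := oO) Du (w := w); have h2 := tderiv_wderiv (oO := oO) Dut (w := w).
exact: (sderiv_unique T0 h1 h2 tT).
Qed.

Lemma weak_equation t w : t \in `[0, T] ->
  dd [L u2 t] w + (alpha t + beta t * aa (grad oO (u t)) (grad oO (u t))) * dd (wlap t) w =
  dd [L f t] w.
Proof.
move=> tT; have [Hu _ [_ [utt [Dut Cut eq]]] _ _] := sol.
have E : dd [L u2 t] w = dd [L utt t] w.
  apply: (sderiv_unique_on T0 _ (tderiv_wderiv (oO := oO) Du1 (w := w)) (tderiv_wderiv (oO := oO) Dut (w := w)) tT) => s sT.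
  exact: solution_ut.
have Lxx : L2 Omega (uxx t) by have [] := solution_second (or_introl erefl) tT.
have Lyy : L2 Omega (uyy t) by have [] := solution_second (or_intror erefl) tT.
have [_ Lutt] := tderiv_L2 Dut tT.
have Hut := Hu t tT; have Lft := tcont_L2 Cf tT.
rewrite E -(form_a_grad oO Hut Hut); have := eq t tT.
rewrite -/(coef Omega alpha beta t (u t)); move: (coef _ _ _ _ _) => q.
rewrite /wlap -/(uxx t) -/(uyy t); move: (uxx t) (uyy t) (utt t) (f t) Lxx Lyy Lutt Lft => a b c g La Lb Lc Lg Eq.
have Lab := L2D (mO := mO) La Lb.
have Lqab := L2Z (mO := mO) q Lab.
have Ll := L2B (mO := mO) Lc Lqab.
rewrite -(toL2_eqO (mO := mO) w Ll Lg Eq).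
rewrite (toL2B (mO := mO) Lc Lqab) (toL2Z (mO := mO) _ Lab) (toL2D (mO := mO) La Lb).
by rewrite (dotNl hd) (dotBl hd) (dotZl hd) mulrN.
Qed.

Lemma solution_test_closure t : t \in `[0, T] -> test_closure [L u t].
Proof. by move=> tT; apply: H01_closure; exact: solution_H01. Qed.

Lemma wlap_test_closure t : t \in `[0, T] -> H01 Omega (f t) ->
  alpha t + beta t * aa (grad oO (u t)) (grad oO (u t)) != 0 -> test_closure (wlap t).
Proof.
move=> tT Hf; have E := weak_equation _ tT; move: (_ + _) E => q E q0.
have c1 := test_closure_wderiv T0 (tderiv_wderiv (oO := oO) Du) solution_test_closure.
have c2 := test_closure_wderiv T0 (tderiv_wderiv (oO := oO) Du1) c1.
move=> w hw; apply: (mulfI q0); rewrite mulr0.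
have := E w; rewrite (c2 t tT w hw) add0r => ->.
exact: (H01_closure (oO := oO) Hf hw).
Qed.

(** The second time derivative at 0 is [w0]; that the starting value [U1] lies in
    [H01] places [w0], hence the classical Laplacian, in the closure of the test functions. *)
Lemma first_step (tau : R) (U1 : fld R) : 0 < tau -> 0 < beta 0 -> 0 < alpha 0 ->
  Cclosure Omega 2 u0 -> H01 Omega u0 -> H01 Omega v0 -> H01 Omega (f 0) -> H01 Omega U1 ->
  eqO Omega U1 (fun z => u0 z + tau * v0 z + tau ^+ 2 / 2 * w0_of Omega alpha beta f u0 z) ->
  forall w, dd [L U1] w = dd ([L u 0] + (tau *: [L u1 0] + (tau ^+ 2 / 2) *: [L u2 0])) w.
Proof.
move=> t0 b0 a0 Cu Hu0 Hv0 Hf HU EU w.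
have z0 : 0 \in `[0, T] by rewrite in_itv /= lexx ltW.
have Hu := solution_H01 z0.
have [_ _ [Dut _] Eu Ev] := sol.
have Lu0 := H01_L2 Hu0; have Lv0 := H01_L2 Hv0; have Lf := H01_L2 Hf; have LU := H01_L2 HU.
have Lu := H01_L2 Hu; have [_ Lut] := tderiv_L2 Dut z0.
have qE : coef Omega alpha beta 0 u0 = alpha 0 + beta 0 * aa (grad oO (u 0)) (grad oO (u 0)).
  have gE := grad_eqO oO Lu Lu0 Eu.
  by rewrite gE -(form_a_grad oO Hu0 Hu0).
have q0 : 0 < coef Omega alpha beta 0 u0.
  by rewrite qE ltr_pwDl // mulr_ge0 ?(dot_ge0 ha) // ltW.
have wE : w0_of Omega alpha beta f u0 = (fun z => f 0 z + coef Omega alpha beta 0 u0 * laplacian u0 z) by [].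
move: EU; rewrite {}wE; move: (coef _ _ _ _ _) qE q0 => q qE q0 EU.
have q0' : q != 0 by rewrite gt_eqF.
have cw : test_closure (wlap 0) by apply: wlap_test_closure => //; rewrite -qE.
have weq := weak_equation _ z0; rewrite -qE in weq.
have [wx wxx] : is_wpartial Omega ex (u 0) (wpartial Omega ex (u 0)) /\
    is_wpartial Omega ex (wpartial Omega ex (u 0)) (uxx 0).
  split; first exact: has_wpartialP (H01_wpartial (or_introl erefl) Hu).
  exact: (solution_second (or_introl erefl) z0).
have [wy wyy] : is_wpartial Omega ey (u 0) (wpartial Omega ey (u 0)) /\
    is_wpartial Omega ey (wpartial Omega ey (u 0)) (uyy 0).
  split; first exact: has_wpartialP (H01_wpartial (or_intror erefl) Hu).
  exact: (solution_second (or_intror erefl) z0).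
have cl := laplacian_continuous oO Cu.
move: (laplacian_weak (oO := oO) Cu Lu0 Eu wx wxx wy wyy).
move: (laplacian u0) cl EU => lap cl EU LW.
pose c := tau ^+ 2 / 2; have c0 : c != 0 by rewrite gt_eqF // divr_gt0 // exprn_gt0.
pose g : fld R := fun z => q^-1 * (c^-1 * (U1 z - (u0 z + tau * v0 z)) - f 0 z).
have Lk1 := L2Z (mO := mO) tau Lv0.
have Lk2 := L2D (mO := mO) Lu0 Lk1.
have Lk3 := L2B (mO := mO) LU Lk2.
have Lk4 := L2Z (mO := mO) c^-1 Lk3.
have Lk5 := L2B (mO := mO) Lk4 Lf.
have Lg : L2 Omega g := L2Z (mO := mO) q^-1 Lk5.
have Elap : eqO Omega lap g.
  have EU' : ae_eq mu2 (Omega : set (mplane R)) U1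
    (fun z => u0 z + tau * v0 z + c * (f 0 z + q * lap z)) by [].
  suff : ae_eq mu2 (Omega : set (mplane R)) lap g by [].
  apply: filterS EU' => z /= H /H; rewrite /g => ->.
  move: (u0 z) (v0 z) (f 0 z) (lap z) => *; field.
  by rewrite q0' c0.
have Ll : L2 Omega lap.
  by apply: (L2_eqO mO _ Lg Elap); exact: continuous_measurable_plane.
have gE : [L g] = q^-1 *: (c^-1 *: ([L U1] - ([L u0] + tau *: [L v0])) - [L f 0]).
  rewrite /g (toL2Z (mO := mO) _ Lk5) (toL2B (mO := mO) Lk4 Lf) (toL2Z (mO := mO) _ Lk3).
  by rewrite (toL2B (mO := mO) LU Lk2) (toL2D (mO := mO) Lu0 Lk1) (toL2Z (mO := mO) _ Lv0).
have lapE v : dd [L lap] v = q^-1 * (c^-1 * (dd [L U1] v - (dd [L u0] v + tau * dd [L v0] v)) - dd [L f 0] v).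
  rewrite (toL2_eqO (mO := mO) v Ll Lg Elap) gE.
  by rewrite (dotZl hd) (dotBl hd) (dotZl hd) (dotBl hd) (dotDl hd) (dotZl hd).
have clap : test_closure [L lap].
  move=> v hv; rewrite lapE (H01_closure (oO := oO) HU hv) (H01_closure (oO := oO) Hu0 hv).
  by rewrite (H01_closure (oO := oO) Hv0 hv) (H01_closure (oO := oO) Hf hv) mulr0 addr0 !subr0 !mulr0.
have cW : test_closure ([L uxx 0] + [L uyy 0]).
  by move=> v hv; have := cw v hv; rewrite /wlap (dotNl hd) => /eqP; rewrite oppr_eq0 => /eqP.
have := LW Ll clap cW w; rewrite lapE.
have e1 : dd [L u 0] w = dd [L u0] w by exact: toL2_eqO.
have e2 : dd [L u1 0] w = dd [L v0] w by rewrite (solution_ut w z0); exact: toL2_eqO.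
have := weq w; rewrite /wlap (dotNl hd).
rewrite (dotDl hd [L u 0]) (dotDl hd (tau *: _)) !(dotZl hd) e1 e2 -/c.
move: (dd ([L uxx 0] + [L uyy 0]) w) (dd [L U1] w) (dd [L u0] w) (dd [L v0] w) (dd [L f 0] w) (dd [L u2 0] w).
move=> A B C D F G EE HH.
have -> : G = F + q * A by rewrite -EE; ring.
by rewrite -HH; field; rewrite q0' c0.
Qed.

Lemma solution_smooth : tderiv Omega T u2 u3 -> tlipschitz Omega T u3 ->
  tderiv Omega T (fun t => wpartial Omega ex (u t)) p1 -> tderiv Omega T p1 p2 -> tcont Omega T p2 ->
  tderiv Omega T (fun t => wpartial Omega ey (u t)) r1 -> tderiv Omega T r1 r2 -> tcont Omega T r2 ->
  tderiv Omega T uxx sx -> tlipschitz Omega T sx -> tderiv Omega T uyy sy -> tlipschitz Omega T sy ->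
  (exists2 K : R, 0 <= K & forall t, t \in `[0, T] -> `|alpha t| <= K) ->
  (exists2 K : R, 0 <= K & forall t, t \in `[0, T] -> `|beta t| <= K) ->
  exists2 K : R, 0 <= K & smooth_solution dd aa T alpha beta (fun t => [L f t]) (fun t => [L u t])
    (fun t => [L u1 t]) (fun t => [L u2 t]) (fun t => [L u3 t]) wlap (fun t => - ([L sx t] + [L sy t]))
    (fun t => grad oO (u t)) (fun t => ([L p1 t], [L r1 t])) (fun t => ([L p2 t], [L r2 t])) K.
Proof.
move=> Du2 Lu3 Dp Dp1 Cp2 Dr Dr1 Cr2 Dsx Lsx Dsy Lsy [Ka Ka0 hKa] [Kb Kb0 hKb].
have [K3 K30 hK3] := tlipschitz_tlip oO (fun t tT => proj2 (tderiv_L2 Du2 tT)) Lu3.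
have [Kx Kx0 hKx] := tlipschitz_tlip oO (fun t tT => proj2 (tderiv_L2 Dsx tT)) Lsx.
have [Ky Ky0 hKy] := tlipschitz_tlip oO (fun t tT => proj2 (tderiv_L2 Dsy tT)) Lsy.
have [Kp Kp0 hKp] := tcont_tbounded oO T0 Cp2.
have [Kr Kr0 hKr] := tcont_tbounded oO T0 Cr2.
have [Kf Kf0 hKf] := tcont_tbounded oO T0 Cf.
pose K := Ka + Kb + K3 + (Kx + Ky) + (Kp + Kr) + Kf.
have lipW (y : R -> V) C : C <= K -> tlip dd T y C -> tlip dd T y K.
  by move=> CK h s t sT tT; apply: le_trans (h s t sT tT) _; rewrite ler_wpM2r.
exists K; first by rewrite /K; nonneg.
split.
- exact: tderiv_wderiv Du.
- exact: tderiv_wderiv Du1.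
- exact: tderiv_wderiv Du2.
- by apply: (lipW _ K3) => //; rewrite /K; lra.
- apply: (wderivN hd); apply: (wderivD hd); [exact: tderiv_wderiv Dsx|exact: tderiv_wderiv Dsy].
- apply: (lipW _ (Kx + Ky)); first by rewrite /K; lra.
  by apply: (tlipN hd); exact: (tlipD hd).
- by apply: wderiv_grad; [exact: tderiv_wderiv Dp|exact: tderiv_wderiv Dr].
- by apply: wderiv_grad; [exact: tderiv_wderiv Dp1|exact: tderiv_wderiv Dr1].
- move=> t tT; apply: le_trans (prod_seminorm_le hd hd _) _.
  by apply: le_trans (lerD (hKp t tT) (hKr t tT)) _; rewrite /K; lra.
- by move=> t tT; apply: le_trans (hKf t tT) _; rewrite /K; lra.
- by move=> t tT; apply: le_trans (hKb t tT) _; rewrite /K; lra.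
- by move=> t tT; apply: le_trans (hKa t tT) _; rewrite /K; lra.
- by move=> t w tT; exact: weak_equation.
Qed.

Lemma first_step_grad (tau : R) (U1 : fld R) :
  tderiv Omega T (fun t => wpartial Omega ex (u t)) p1 -> tderiv Omega T p1 p2 ->
  tderiv Omega T (fun t => wpartial Omega ey (u t)) r1 -> tderiv Omega T r1 r2 -> H01 Omega U1 ->
  (forall w, dd [L U1] w = dd ([L u 0] + (tau *: [L u1 0] + (tau ^+ 2 / 2) *: [L u2 0])) w) ->
  forall w : W, aa (grad oO U1) w =
    aa (grad oO (u 0) + (tau *: ([L p1 0], [L r1 0]) + (tau ^+ 2 / 2) *: ([L p2 0], [L r2 0]))) w.
Proof.
move=> Dp Dp1 Dr Dr1 HU E w.
have hpx e t phi : coordinate e -> t \in `[0, T] -> test_function Omega phi ->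
    dd [L wpartial Omega e (u t)] [L phi] = - dd [L u t] [L partial e phi].
  move=> he tT tphi.
  have h := is_wpartialP oO (has_wpartialP (H01_wpartial he (solution_H01 tT))) tphi.
  by rewrite h opprK.
have hcl e t : coordinate e -> t \in `[0, T] -> test_closure [L wpartial Omega e (u t)].
  by move=> he tT; exact: (H01_wpartial_closure (oO := oO) he (solution_H01 tT)).
have wDu := tderiv_wderiv (oO := oO) Du; have wDu1 := tderiv_wderiv (oO := oO) Du1.
have ex1 := grad_first_step (or_introl erefl) T0 wDu wDu1 (tderiv_wderiv (oO := oO) Dp)
  (tderiv_wderiv (oO := oO) Dp1) (fun t phi => @hpx ex t phi (or_introl erefl))
  (fun t => @hcl ex t (or_introl erefl)) HU E w.1.
have ey1 := grad_first_step (or_intror erefl) T0 wDu wDu1 (tderiv_wderiv (oO := oO) Dr)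
  (tderiv_wderiv (oO := oO) Dr1) (fun t phi => @hpx ey t phi (or_intror erefl))
  (fun t => @hcl ey t (or_intror erefl)) HU E w.2.
exact: (congr2 +%R ex1 ey1).
Qed.

End Solution.
End Scheme.

Unset Implicit Arguments.

Theorem corollary4p6 (R : realType) (Omega : set (R * R)) (T : R)
    (alpha beta : R -> R) (f : R -> R * R -> R) (u0 v0 : R * R -> R)
    (u ut : R -> R * R -> R)
    (hO : bounded_convex_domain Omega)
    (hT : 0 < T)
    (halpha : C1_interval T alpha) (hbeta : C1_interval T beta)
    (halpha0 : forall t, t \in `[0, T] -> 0 < alpha t)
    (hbeta0 : forall t, t \in `[0, T] -> 0 < beta t)
    (hf : tcont Omega T f)
    (hwp : well_posed Omega T alpha beta f u0 v0 u ut)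
    (* (i) *)
    (hu0 : dom_L0 Omega u0)
    (hv0 : Cclosure Omega 1 v0)
    (hw0 : Cclosure Omega 1 (w0_of Omega alpha beta f u0))
    (hux : tCk Omega T 2 (fun t => wpartial Omega ex (u t)))
    (huy : tCk Omega T 2 (fun t => wpartial Omega ey (u t)))
    (hfC1 : forall t, t \in `[0, T] -> Cclosure Omega 1 (f t) /\ zero_on_boundary Omega (f t))
    (hfbd : exists M : R, forall t z, t \in `[0, T] -> Omega z ->
       `|partial ex (f t) z| <= M /\ `|partial ey (f t) z| <= M)
    (hu0L : dom_Lsq Omega u0)
    (hv0L : dom_L Omega v0)
    (hfL : tcont_Lhalf Omega T f)
    (hf0L : dom_L Omega (f 0))
    (* (ii) *)
    (hut : exists u1 u2 u3 : R -> R * R -> R,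
       [/\ tderiv Omega T u u1, tderiv Omega T u1 u2, tderiv Omega T u2 u3,
           tcont Omega T u3 & tlipschitz Omega T u3])
    (* (iii) *)
    (huxx : exists uxxt : R -> R * R -> R,
       [/\ tderiv Omega T (fun t => wpartial Omega ex (wpartial Omega ex (u t))) uxxt,
           tcont Omega T uxxt & tlipschitz Omega T uxxt])
    (huyy : exists uyyt : R -> R * R -> R,
       [/\ tderiv Omega T (fun t => wpartial Omega ey (wpartial Omega ey (u t))) uyyt,
           tcont Omega T uyyt & tlipschitz Omega T uyyt]) :
  exists Tbar C : R, 0 < Tbar <= T /\
    forall (n : nat) (U : nat -> R * R -> R), (1 < n)%N ->
      scheme_solution Omega T alpha beta f u0 v0 n U ->
      let tau := T / n%:R in
      let m := Num.truncn (Tbar / tau) in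
      \big[Num.max/0]_(1 <= k < m.+1)
        L2norm Omega (fun z => u (k%:R * tau) z - U k z) <= C * tau ^+ 2.
Proof.
have [_ oO _ _] := hO; have [sol _ _] := hwp.
have [u1 [u2 [u3 [Du Du1 Du2 Cu3 Lu3]]]] := hut.
have [p1 [Dp [p2 [Dp1 Cp2]]]] := hux; have [r1 [Dr [r2 [Dr1 Cr2]]]] := huy.
have [sx [Dsx _ Lsx]] := huxx; have [sy [Dsy _ Lsy]] := huyy.
have [La La0 [alB alL]] := C1_interval_lipschitz hT halpha.
have [Lb Lb0 [beB beL]] := C1_interval_lipschitz hT hbeta.
have [ca ca0 alc] := C1_interval_pos hT halpha halpha0.
have [cb cb0 bec] := C1_interval_pos hT hbeta hbeta0.
pose mO := open_measurable_plane oO.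
have hd := @ipL_semi_inner R Omega mO; have ha := prod_semi_inner hd hd.
have [K K0 ss] := solution_smooth oO hT sol hf Du Du1 Du2 Lu3 Dp Dp1 Cp2 Dr Dr1 Cr2 Dsx Lsx Dsy Lsy
  (ex_intro2 _ _ La La0 alB) (ex_intro2 _ _ Lb Lb0 beB).
pose c := Num.min ca cb; have c0 : 0 < c by rewrite lt_min ca0.
have alc' t : t \in `[0, T] -> c <= alpha t by move=> tT; rewrite ge_min alc.
have bec' t : t \in `[0, T] -> c <= beta t by move=> tT; rewrite ge_min bec ?orbT.
have alL' s t : s \in `[0, T] -> t \in `[0, T] -> `|alpha s - alpha t| <= (La + Lb) * `|s - t|.
  by move=> sT tT; apply: le_trans (alL s t sT tT) _; rewrite ler_wpM2r // lerDl.
have beL' s t : s \in `[0, T] -> t \in `[0, T] -> `|beta s - beta t| <= (La + Lb) * `|s - t|.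
  by move=> sT tT; apply: le_trans (beL s t sT tT) _; rewrite ler_wpM2r // lerDr.
have [M M0 hM] := smooth_solution_consistent hd ha hT K0 (addr_ge0 La0 Lb0) ss alc' bec' alL' beL'.
have [Tb [C [Tb0 C0 hTb]]] := second_order_energy hd ha M0 c0.
pose Tbar := Num.min T (Num.min Tb 1).
have Tbar0 : 0 < Tbar by rewrite !lt_min hT Tb0 ltr01.
exists Tbar, C; split; first by rewrite Tbar0 ge_min lexx.
move=> n U n1 sc; cbv zeta; set tau := T / n%:R; set m := Num.truncn _.
have n0 : (0 < n)%N := ltnW n1; have nR : 0 < n%:R :> R by rewrite ltr0n.
have t0 : 0 < tau by rewrite divr_gt0.
rewrite big_nat_cond; apply: bigmax_le; first by rewrite mulr_ge0 ?exprn_ge0 // ltW.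
move=> k /andP[/andP[k1 km] _].
have ktau : k%:R * tau <= Tbar.
  rewrite -ler_pdivlMr // -truncn_ge_nat; first exact: km.
  by rewrite divr_ge0 // ltW.
have kT : k%:R * tau <= T by apply: le_trans ktau _; rewrite ge_min lexx.
have kTb : k%:R * tau <= Tb by apply: le_trans ktau _; rewrite !ge_min lexx orbT.
(* For a step larger than [Tbar] the maximum runs over an empty range. *)
have tau1 : tau <= 1.
  apply: (@le_trans _ _ (k%:R * tau)); first by rewrite ler_peMl ?(ltW t0) // ler1n.
  by apply: le_trans ktau _; rewrite !ge_min lexx !orbT.
have kn : (k <= n)%N.
  by move: kT; rewrite /tau mulrCA ger_pMr // ler_pdivrMr // mul1r ler_nat.
have tkT j : (j <= n)%N -> j%:R * tau \in `[0, T].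
  move=> jn; rewrite in_itv /= mulr_ge0 ?ler0n ?(ltW t0) //=.
  by rewrite /tau mulrCA ger_pMr // ler_pdivrMr // mul1r ler_nat.
have z0 : 0 \in `[0, T] by rewrite in_itv /= lexx ltW.
have [domU U0 U1 _] := sc.
have HU j : (j <= n)%N -> H01 Omega (U j) by move=> jn; exact: (dom_L_H01 (domU j jn)).
have Hu j : (j <= n)%N -> H01 Omega (u (j%:R * tau)) by move=> jn; exact: (solution_H01 sol (tkT j jn)).
have Hu0 := dom_L_H01 (proj1 hu0L); have Hv0 := dom_L_H01 hv0L; have Hf0 := dom_L_H01 hf0L.
have Lu0 := H01_L2 Hu0; have LUk j (jn : (j <= n)%N) := H01_L2 (HU j jn).
have Luk j (jn : (j <= n)%N) := H01_L2 (Hu j jn).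
have Eu0 : eqO Omega (u 0) u0 by have [_ _ _ e _] := sol.
have Luz := H01_L2 (solution_H01 sol z0).
have init w : ipL (@toL2 R Omega mO (U 0%N)) w = ipL (toL2 (u 0)) w.
  exact: (etrans (toL2_eqO (mO := mO) w (LUk 0%N isT) Lu0 U0) (esym (toL2_eqO (mO := mO) w Luz Lu0 Eu0))).
have init_grad : grad oO (U 0%N) = grad oO (u 0).
  exact: (etrans (grad_eqO oO (LUk 0%N isT) Lu0 U0) (esym (grad_eqO oO Luz Lu0 Eu0))).
have Lf j : (1 <= j < n)%N -> L2 Omega (f (j%:R * tau)).
  by move=> /andP[_ jn]; exact: (tcont_L2 hf (tkT j (ltnW jn))).
have green_u i h (jn : (i <= n)%N) (Hh : H01 Omega h) :
    prod_dot ipL ipL (grad oO (u (i%:R * tau))) (grad oO h) = ipL (wlap oO u (i%:R * tau)) (@toL2 R Omega mO h).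
  exact: (green_grad oO (solution_second sol (or_introl erefl) (tkT i jn))
    (solution_second sol (or_intror erefl) (tkT i jn)) Hh).
have green_uU i j : (i <= n)%N -> (j <= n)%N ->
    prod_dot ipL ipL (grad oO (u (i%:R * tau))) (grad oO (u (j%:R * tau)) - grad oO (U j)) =
    ipL (wlap oO u (i%:R * tau)) (@toL2 R Omega mO (u (j%:R * tau)) - toL2 (U j)).
  move=> iN jn; rewrite (dotBr ha) (dotBr hd).
  exact: (congr2 (fun r s : R => r - s) (green_u i _ iN (Hu j jn)) (green_u i _ iN (HU j jn))).
have step1 := first_step (oO := oO) hT sol hf Du Du1 t0 (hbeta0 0 z0) (halpha0 0 z0)
  (proj1 hu0) Hu0 Hv0 Hf0 (HU 1%N n0) U1.
have cons := hM n (fun j => @toL2 R Omega mO (U j)) (fun j => grad oO (U j)) n0 tau1 green_uU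
  (fun k j kn jn => scheme_weak oO hT sc kn (Lf k kn) (Hu j jn))
  (fun k j kn jn => scheme_weak oO hT sc kn (Lf k kn) (HU j jn)) init init_grad step1
  (first_step_grad (oO := oO) hT sol Du Du1 Dp Dp1 Dr Dr1 (HU 1%N n0) step1).
have LUu : L2norm Omega (fun z => u (k%:R * tau) z - U k z) =
    seminorm (@ipL R Omega mO) (toL2 (u (k%:R * tau)) - toL2 (U k)).
  by rewrite (L2norm_toL2B (mO := mO) (Luk k kn) (LUk k kn)).
rewrite LUu.
have tau01 : 0 < tau <= 1 by rewrite t0.
have k1n : (1 <= k <= n)%N by rewrite k1.
exact: (hTb tau n _ _ _ _ _ _ _ _ tau01 n0 cons k k1n kTb).
Qed.
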